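(* Suppose $\Omega$ is positively invariant under $\varphi^t$ and $\varphi^t$ admits the maximal attractor $\mathcal A$ in $\Omega$. Suppose that for each $0<\epsilon\ll1$ the eigenvalue problem (EP) admits a classical solution pair $(u_\epsilon,\lambda_\epsilon)$ and that the family of probability measures on $\Omega$ with densities $\{u_\epsilon\}_\epsilon$ is tight. If $\lim_{\epsilon\to0}\frac{\epsilon^2}{2}\ln u_\epsilon=0$ on $\mathcal A$, then $\mathcal A$ is chain-transitive.
   Context: Setting: $\Omega\subset\mathbb R^d$ is open and connected, $k>2$ is an integer, $b\in C^k(\Omega;\mathbb R^d)$, and $A=(a^{ij})\in C^{k+1}(\Omega;\mathbf S^d_+)$, where $\mathbf S^d_+$ is the set of symmetric positive definite $d\times d$ matrices. $\varphi^t$ is the local flow of $\dot x=b(x)$ in $\Omega$. $\mathcal O\subset\subset\Omega$ means that $\overline{\mathcal O}$ is a compact subset of $\Omega$. Positively invariant: $\varphi^t(\Omega)\subset\Omega$ for all $t\ge0$. Maximal attractor in $\Omega$: a compact $\varphi^t$-invariant set $\mathcal A\subset\Omega$ with $\lim_{t\to\infty}\mathrm{dist}_H(\varphi^t(\mathcal O),\mathcal A)=0$ for all $\mathcal O\subset\subset\Omega$, where $\mathrm{dist}_H(B,C)=\sup_{x\in B}\inf_{y\in C}|x-y|$. Eigenvalue problem (EP), for $(u,\lambda)$: $\frac{\epsilon^2}{2}\nabla\cdot(\nabla\cdot(Au))-\nabla\cdot(bu)=-\lambda u$ in $\Omega$ (with $\nabla\cdot(Au)$ the row-wise divergence), $u>0$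 in $\Omega$, $\int_\Omega u=1$, $\lambda\ge0$. Tightness is as probability measures on $\Omega$ (for each $\delta>0$ there is a compact $K\subset\Omega$ carrying mass at least $1-\delta$ for all $\epsilon$). Chain-transitive: for any $x,y\in\mathcal A$, $\eta>0$ and $T>0$, there is a finite sequence $\{x_1=x,x_2,\dots,x_n,x_{n+1}=y;\ t_1,\dots,t_n\}$ with $x_i\in\Omega$ and $t_i\ge T$ such that $|\varphi^{t_i}(x_i)-x_{i+1}|<\eta$ for all $i$. *)

(* Defs.v *)
From HB Require Import structures.
From mathcomp Require Import all_boot all_order all_algebra.
From mathcomp Require Import all_classical all_reals all_analysis.
Import Order.TTheory GRing.Theory Num.Theory numFieldNormedType.Exports.

Set Implicit Arguments.
Unset Strict Implicit.
Unset Printing Implicit Defensive.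

Local Open Scope classical_set_scope.
Local Open Scope ring_scope.

Section lebesgue_tuple.
Variable R : realType.

Definition cons_pair n (z : measurableTypeR R * n.-tuple (measurableTypeR R)) :
  n.+1.-tuple (measurableTypeR R) := [the n.+1.-tuple _ of z.1 :: z.2].

Lemma measurable_cons_pair n : measurable_fun setT (@cons_pair n).
Proof. exact: measurable_cons. Qed.

Section step.
Variables (n : nat).
Variable mu : {sigma_finite_measure set (n.-tuple (measurableTypeR R)) -> \bar R}.

Definition lebesgue_step :=
  pushforward (@lebesgue_measure R \x mu)%E (@cons_pair n).

Let step0 : lebesgue_step set0 = 0%E.
Proof. by rewrite /lebesgue_step /pushforward preimage_set0 measure0. Qed.

Let step_ge0 A : (0 <= lebesgue_step A)%E.
Proof. by rewrite /lebesgue_step /pushforward measure_ge0. Qed.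

Let step_sigma_additive : semi_sigma_additive lebesgue_step.
Proof.
move=> F mF tF mUF; rewrite /lebesgue_step /pushforward preimage_bigcup.
apply: measure_semi_sigma_additive.
- by move=> k; rewrite -[X in measurable X]setTI; exact: measurable_cons_pair.
- apply/trivIsetP => /= i j _ _ ij; rewrite -preimage_setI.
  by move/trivIsetP : tF => /(_ _ _ _ _ ij) ->//; rewrite preimage_set0.
- rewrite -preimage_bigcup -[X in measurable X]setTI.
  exact: measurable_cons_pair.
Qed.

HB.instance Definition _ := isMeasure.Build _ _ _ lebesgue_step
  step0 step_ge0 step_sigma_additive.

Let step_sigma_finite : sigma_finite setT lebesgue_step.
Proof.
have /sigma_finiteP[F [TF ndF Foo]] := sigma_finiteT (@lebesgue_measure R).
have /sigma_finiteP[G [TG ndG Goo]] := sigma_finiteT mu.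
pose h (t : n.+1.-tuple (measurableTypeR R)) := (thead t, [tuple of behead t]).
have consK : cancel (@cons_pair n) h.
  by move=> [x t]; rewrite /h /cons_pair /=; congr pair; apply: val_inj.
have mh1 : measurable_fun setT (fun t => (h t).1) by exact: measurable_tnth.
have mh2 : measurable_fun setT (fun t => (h t).2) by exact: measurable_behead.
exists (fun k => h @^-1` (F k `*` G k)).
  rewrite -preimage_bigcup (_ : \bigcup_k _ = setT) ?preimage_setT//.
  rewrite -subTset => -[x y] _.
  have [n1 _ Fx] : (\bigcup_k F k) x by rewrite -TF.
  have [n2 _ Gy] : (\bigcup_k G k) y by rewrite -TG.
  exists (maxn n1 n2) => //; split.
    by move: x Fx; exact/subsetPset/ndF/leq_maxl.
  by move: y Gy; exact/subsetPset/ndG/leq_maxr.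
move=> k; have [mF Fk] := Foo k; have [mG Gk] := Goo k; split.
  apply: measurableI.
    by rewrite -[X in measurable X]setTI; exact: mh1.
  by rewrite -[X in measurable X]setTI; exact: mh2.
rewrite /lebesgue_step /pushforward (_ : _ @^-1` _ = F k `*` G k); last first.
  rewrite -comp_preimage (_ : h \o _ = id)//.
  by apply/funext => z; exact: consK.
by rewrite product_measure1E// lte_mul_pinfty// ge0_fin_numE.
Qed.

HB.instance Definition _ := Measure_isSigmaFinite.Build _ _ _ lebesgue_step
  step_sigma_finite.

End step.

(* Lebesgue measure on R^n, as the n-fold product of the one-dimensional one;
   on R^0 it is the unit mass at the only point. *)
Fixpoint lebesgue_tuple n :
    {sigma_finite_measure set (n.-tuple (measurableTypeR R)) -> \bar R} :=
  match n with
  | 0 => (\d_ ([tuple] : 0.-tuple (measurableTypeR R)))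
  | n'.+1 => lebesgue_step (lebesgue_tuple n')
  end.

End lebesgue_tuple.

Section euclidean.
Variables (R : realType) (d : nat).
Local Notation V := 'rV[R]_d.
Implicit Types (D Om : set V) (x y : V) (t : R).

(* The library norm on row vectors is the sup norm. *)
Definition enorm x : R := Num.sqrt (\sum_i x 0 i ^+ 2).

Definition tuple_rV (t : d.-tuple R) : V := \row_i tnth t i.

Definition integral_rV D (f : V -> R) : \bar R :=
  (\int[lebesgue_tuple R d]_(t in tuple_rV @^-1` D) (f (tuple_rV t))%:E)%E.

Definition partial (i : 'I_d) (f : V -> R) x : R := 'D_(delta_mx 0 i) f x.

Fixpoint Ck (k : nat) Om (f : V -> R) : Prop :=
  (forall x, Om x -> {for x, continuous f}) /\
  match k with
  | 0 => True
  | k'.+1 => forall i : 'I_d,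
      (forall x, Om x -> derivable f x (delta_mx 0 i)) /\ Ck k' Om (partial i f)
  end.

Definition Ck_rV k Om (F : V -> V) := forall i, Ck k Om (fun x => F x 0 i).

Definition Ck_mx k Om (F : V -> 'M[R]_d) :=
  forall i j, Ck k Om (fun x => F x i j).

Definition sym_posdef (M : 'M[R]_d) :=
  M^T = M /\ forall v : V, v != 0 -> 0 < (v *m M *m v^T) 0 0.

Definition divergence (F : V -> V) x : R :=
  \sum_i partial i (fun y => F y 0 i) x.

Definition row_divergence (M : V -> 'M[R]_d) x : V :=
  \row_i divergence (fun y => row i (M y)) x.

Definition relatively_compact Om D := compact (closure D) /\ closure D `<=` Om.

(* y is the value at time t of a solution of x' = b(x) in Om started at x. *)
Definition flow_rel (b : V -> V) Om t x y :=
  exists (g : R -> V) (s1 s2 : R),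
    [/\ s1 < 0 < s2, s1 < t < s2,
        (forall s, s1 < s < s2 -> Om (g s) /\ is_derive s (1 : R) g (b (g s))),
        g 0 = x & g t = y].

Definition flow_dom (b : V -> V) Om t : set V :=
  [set x | exists y, flow_rel b Om t x y].

(* Meaningful on flow_dom b Om t only; 0 is a default value elsewhere. *)
Definition flow (b : V -> V) Om t x : V := xget 0 (flow_rel b Om t x).

Definition positively_invariant (b : V -> V) Om := forall t, 0 <= t ->
  Om `<=` flow_dom b Om t /\ flow b Om t @` Om `<=` Om.

(* Together with compactness, equality for t >= 0 gives it for all t. *)
Definition flow_invariant (b : V -> V) Om (K : set V) := forall t, 0 <= t ->
  K `<=` flow_dom b Om t /\ flow b Om t @` K = K.

(* The suprema and infima are taken in [0, +oo], whence the added 0. *)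
Definition hdist (B C : set V) : \bar R :=
  ereal_sup (0%E |` [set ereal_inf [set (enorm (x - y))%:E | y in C] | x in B]).

Definition maximal_attractor (b : V -> V) Om (K : set V) :=
  [/\ compact K, K `<=` Om, flow_invariant b Om K &
      forall D, relatively_compact Om D ->
        hdist (flow b Om t @` D) K @[t --> +oo%R] --> 0%E].

Definition EP_solution (A : V -> 'M[R]_d) (b : V -> V) Om (eps : R)
    (u : V -> R) (lam : R) :=
  [/\ Ck 2 Om u,
      (forall x, Om x ->
        eps ^+ 2 / 2 * divergence (row_divergence (fun y => u y *: A y)) x
        - divergence (fun y => u y *: b y) x = - lam * u x),
      (forall x, Om x -> 0 < u x),
      integral_rV Om u = 1%E & 0 <= lam].

Definition tight Om (E : set R) (u : R -> V -> R) := forall del : R, 0 < del ->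
  exists K : set V, [/\ compact K, K `<=` Om &
    forall eps, E eps -> ((1 - del)%:E <= integral_rV K (u eps))%E].

Definition chain_transitive (b : V -> V) Om (K : set V) :=
  forall x y, K x -> K y -> forall eta T : R, 0 < eta -> 0 < T ->
  exists (n : nat) (xs : nat -> V) (ts : nat -> R),
    [/\ (0 < n)%N, xs 1%N = x, xs n.+1 = y &
      forall i, (1 <= i <= n)%N -> [/\ Om (xs i), T <= ts i &
        enorm (flow b Om (ts i) (xs i) - xs i.+1) < eta]].

End euclidean.

(* Main.v *)
(* If A is not chain-transitive, the points reachable from some x in A by chains with small
   jumps and long flow times form a neighbourhood of an attractor that misses some y in A.
   This gives a Lipschitz function W with W = 1 off a compact set, W(phi^t z) <= e^-t W(z)
   where W < 1, and, since Omega is connected, W(x0) = 1/2 at some x0 in A; mollifying W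
   gives a C^2 function S which is strictly decreasing along b between the levels 1/4 and 7/8.
   Testing (EP) against the cube of the positive part of 1 - exp(kappa (S - 7/8) / eps^2) and
   using lambda >= 0 shows that u_eps gives mass at most C exp(-c / eps^2) to
   {3/8 <= S <= 5/8}. Tightness bounds lambda_eps, and then u_eps(x0) is at most a power of
   1/eps times the mass of u_eps near x0. Hence u_eps(x0) is exponentially small in 1/eps^2,
   which contradicts eps^2 ln u_eps(x0) -> 0. *)
Require Import Defs.
From mathcomp Require Import all_boot all_order all_algebra.
From mathcomp Require Import all_classical all_reals all_analysis measurable_realfun.
From mathcomp Require Import ring lra.
Import Order.TTheory GRing.Theory Num.Theory numFieldNormedType.Exports.
Set Implicit Arguments.
Unset Strict Implicit.
Unset Printing Implicit Defensive.
Local Open Scope classical_set_scope.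
Local Open Scope ring_scope.

(** * Lebesgue measure on row vectors *)

(** Nothing is known of [u] near the boundary of Omega beyond its mass, so every test function must
    have compact support in Omega; hence chains are confined to a compact neighbourhood of the
    attractor, and the barrier vanishes from level 7/8 < 1 on. With k = kappa / eps^2, the order 1 /
    eps^2 is the steepest at which the second-order terms stay below the drift. In {S < 1/4} nothing
    is known about the drift, but there the slope of the barrier is at most of order k exp(-5k/8),
    against k exp(-k/2) on the levels 3/8 to 5/8; the quotient exp(-k/8) is the gain. The limit
    concerns u at single points while this bounds a mass, and ellipticity degenerates like eps^2, so
    the passage between them must cost no more than a power of 1/eps. Averages of u against an
    explicit kernel of width s^2 obey a differential inequality in s with rate of order 1 / eps^2;
    going from s near 0 up to s = eps^2 therefore loses only a bounded factor. Cubes of positive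
    parts recur because 3 is the least integer power for which they are of class C^2. *)

Section row_vector_norm.
Context {R : realType} {d : nat}.
Implicit Types x : 'rV[R]_d.

Lemma coord_norm_le x i : `|x 0 i| <= `|x|.
Proof.
rewrite [leRHS]/Num.Def.normr/= mx_normrE.
exact: (le_bigmax _ (fun ij : 'I_1 * 'I_d => `|x ij.1 ij.2|) (0, i)).
Qed.

Lemma rV_norm_le x e : 0 <= e -> (forall i, `|x 0 i| <= e) -> `|x| <= e.
Proof.
move=> e0 xe; rewrite [leLHS]/Num.Def.normr/= mx_normrE; apply: bigmax_le => //= -[i j] _.
by rewrite /= ord1.
Qed.

Lemma rV_norm_lt x e : 0 < e -> (forall i, `|x 0 i| < e) -> `|x| < e.
Proof.
move=> e0 xe; rewrite [ltLHS]/Num.Def.normr/= mx_normrE; apply: bigmax_lt => //= -[i j] _.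
by rewrite /= ord1.
Qed.

Lemma enorm_le_norm x : enorm x <= d%:R * `|x|.
Proof.
rewrite /enorm -[leRHS]ger0_norm ?mulr_ge0// -sqrtr_sqr ler_wsqrtr//.
rewrite exprMn (le_trans (y := \sum_(i < d) `|x| ^+ 2))//.
  by apply: ler_sum => i _; rewrite -real_normK ?num_real// lerXn2r ?nnegrE// coord_norm_le.
rewrite sumr_const card_ord -[leLHS]mulr_natl ler_wpM2r ?sqr_ge0//.
by rewrite -natrX ler_nat; case: (d) => // n; rewrite expnS expn1 leq_pmulr.
Qed.

Lemma norm_le_enorm x : `|x| <= enorm x.
Proof.
apply: rV_norm_le; first exact: sqrtr_ge0.
move=> i; rewrite -sqrtr_sqr ler_wsqrtr// (bigD1 i)//= lerDl sumr_ge0// => j _.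
exact: sqr_ge0.
Qed.

End row_vector_norm.

Section tuple_measure.
Context {R : realType} {d : nat}.
Local Notation V := 'rV[R]_d.
Local Notation T := (d.-tuple (measurableTypeR R)).
Local Notation toV := (@tuple_rV R d).

Lemma ball_rVP (x : V) e y : 0 < e -> ball x e y <-> forall i, `|x 0 i - y 0 i| < e.
Proof.
move=> e0; rewrite -ball_normE /=; split=> [xy i|xy].
  by rewrite (le_lt_trans _ xy)// (le_trans _ (coord_norm_le _ i))// !mxE.
by apply: rV_norm_lt => // i; rewrite !mxE.
Qed.

Lemma measurable_ball_preimage (x : V) e : measurable (toV @^-1` ball x e).
Proof.
have [e0|e0] := ltP 0 e; last first.
  rewrite (_ : _ @^-1` _ = set0)//; apply/seteqP; split => // t /=.
  by rewrite -ball_normE /= => /(le_lt_trans (normr_ge0 _)); rewrite ltNge e0.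
rewrite (_ : _ @^-1` _ = \bigcap_(i in [set: 'I_d])
    ((fun t : T => tnth t i) @^-1` (ball (x 0 i) e : set R))); last first.
  apply/seteqP; split => t /=.
    by move/(ball_rVP _ _ e0) => + i _; rewrite -ball_normE /= => /(_ i); rewrite mxE.
  move=> xt; apply/(ball_rVP _ _ e0) => i; have := xt i I.
  by rewrite -ball_normE /= mxE.
apply: fin_bigcap_measurable => [|i _]; first exact: finite_finset.
rewrite -[X in measurable X]setTI.
apply: measurable_tnth => //; exact: measurable_ball.
Qed.

(** Balls of the sup norm are boxes, and an open set is the union of the countably many boxes with
    rational centre and radius 1/(n+1) that it contains. This links the topology of row vectors with
    the product sigma-algebra on tuples. *)
Lemma measurable_open_preimage (U : set V) : open U -> measurable (toV @^-1` U).
Proof.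
move=> oU.
pose q (r : 'rV[rat]_d) : V := map_mx ratr r.
rewrite (_ : _ @^-1` _ = \bigcup_(rn in [set rn : 'rV[rat]_d * nat |
    ball (q rn.1) rn.2.+1%:R^-1 `<=` U]) (toV @^-1` ball (q rn.1) rn.2.+1%:R^-1)); last first.
  apply/seteqP; split => [t Ut|t [[r n] /= rU /rU//]].
  have /nbhs_ballP[e /= e0 eU] := open_nbhs_nbhs (conj oU Ut).
  have [n nP] : exists n, n.+1%:R^-1 < e / 2.
    have e20 : 0 < e / 2 by rewrite divr_gt0.
    exists (Num.truncn (e / 2)^-1); rewrite invf_plt ?posrE//.
    exact: truncnS_gt.
  have n0 : 0 < n.+1%:R^-1 :> R by rewrite invr_gt0.
  have /choice[r rP] : forall i, exists r : rat, `|ratr r - toV t 0 i| < n.+1%:R^-1.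
    move=> i; have [|r] := @rat_in_itvoo R (toV t 0 i - n.+1%:R^-1) (toV t 0 i + n.+1%:R^-1).
      by rewrite ltrD2l gtrN.
    by rewrite in_itv/= => rP; exists r; rewrite ltr_distl.
  have rt : ball (q (\row_i r i)) n.+1%:R^-1 (toV t).
    by apply/(ball_rVP _ _ n0) => i; rewrite !mxE; have := rP i; rewrite mxE.
  exists (\row_i r i, n) => //= y ry; apply: eU.
  apply: (@le_ball _ _ _ (n.+1%:R^-1 + n.+1%:R^-1)).
    by rewrite [leRHS]splitr lerD// ltW.
  by apply: ball_triangle ry; exact: ball_sym.
rewrite bigcup_mkcond; apply: countable_bigcupT_measurable => [|[r n]].
  exact: countableP.
by case: ifPn => // _; exact: measurable_ball_preimage.
Qed.

Lemma measurable_continuous_preimage (D : set V) (f : V -> R) : open D ->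
  (forall x, D x -> {for x, continuous f}) ->
  measurable_fun (toV @^-1` D) (f \o toV).
Proof.
move=> oD cf mD; apply: (measurability _ (RGenOInfty.measurableE R)) => //.
move=> _ [_ [a ->] <-]; rewrite (_ : _ `&` _ = toV @^-1` (D `&` f @^-1` `]a, +oo[))//.
apply: measurable_open_preimage; rewrite openE => x [Dx fx].
apply: filterI; first exact: (open_nbhs_nbhs (conj oD Dx)).
apply: (cf x Dx); apply: (open_nbhs_nbhs); split => //.
Qed.

Definition shiftt (a : V) (t : T) : T := [tuple (tnth t i + a 0 i : R) | i < d].

Lemma shifttE a t : toV (shiftt a t) = toV t + a.
Proof. by apply/rowP => i; rewrite !mxE tnth_mktuple. Qed.

Lemma measurable_shiftt a : measurable_fun setT (shiftt a).
Proof.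
apply/measurable_fun_tnthP => i.
rewrite (_ : _ \o _ = fun t : T => (tnth t i + a 0 i : R)); last first.
  by apply/funext => t; rewrite /= tnth_mktuple.
apply: (measurable_funD (f := fun t : T => (tnth t i : R))) => //.
exact: measurable_tnth.
Qed.

End tuple_measure.

(** By uniqueness of Lebesgue measure it is enough to look at half-open intervals. *)
Lemma lebesgue_measure_shift {R : realType} (a : R) (A : set (measurableTypeR R)) :
  measurable A ->
  lebesgue_measure ((fun x : R => x + a) @^-1` A) = lebesgue_measure A.
Proof.
have mf : measurable_fun [set: measurableTypeR R]
    (fun x : R => x + a : measurableTypeR R).
  by apply: measurable_funD => //; exact: measurable_id.
pose f := (fun x : R => x + a : measurableTypeR R).
pose mu : {measure set _ -> \bar R} := pushforward lebesgue_measure f.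
move=> mA; apply/esym; apply: (@lebesgue_measure_unique R (mu mf)) => // _ [[x y] _ <-] /=.
rewrite /mu /pushforward (_ : _ @^-1` _ = `]x - a, y - a]%classic).
  rewrite !lebesgue_measure_itv/= !lte_fin ltrD2r -!EFinB.
  by rewrite opprB addrA subrK.
apply/seteqP; split => z /=; rewrite /f in_itv/= in_itv/= ltrBlDr lerBrDr//.
Qed.

Section lebesgue_tuple_theory.
Context {R : realType}.
Local Notation MR := (measurableTypeR R).

Lemma lebesgue_tupleS n (A : set (n.+1.-tuple MR)) :
  lebesgue_tuple R n.+1 A =
  (@lebesgue_measure R \x lebesgue_tuple R n)%E (@cons_pair R n @^-1` A).
Proof. by []. Qed.

Lemma lebesgue_tuple_shift n (a : 'rV[R]_n) (A : set (n.-tuple MR)) :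
  measurable A -> lebesgue_tuple R n (shiftt a @^-1` A) = lebesgue_tuple R n A.
Proof.
elim: n a A => [|n IH] a A mA.
  congr (lebesgue_tuple R 0 _); apply/seteqP; split => t /=;
  by rewrite (_ : shiftt a t = t)//; apply: eq_from_tnth => -[].
rewrite !lebesgue_tupleS.
pose a' : 'rV[R]_n := \row_i a 0 (lift ord0 i).
pose sh (z : MR * n.-tuple MR) : MR * n.-tuple MR := (z.1 + a 0 0 : MR, shiftt a' z.2).
have msh : measurable_fun setT sh.
  apply/measurable_fun_pairP; split.
    apply: (measurable_funD (f := fun t : MR * n.-tuple MR => (t.1 : R))) => //.
    exact: measurable_fst.
  exact: (measurableT_comp (measurable_shiftt a') measurable_snd).
pose nu : {measure set (MR * n.-tuple MR) -> \bar R} :=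
  pushforward (@lebesgue_measure R \x lebesgue_tuple R n)%E sh.
have mB : measurable (@cons_pair R n @^-1` A).
  by rewrite -[X in measurable X]setTI; exact: measurable_cons_pair.
(* Uniqueness of the product measure leaves only rectangles, where one side is translated on the
   line and the other by the induction hypothesis. *)
rewrite [RHS](@product_measure_unique _ _ _ _ _ _ _ (nu msh)) => [|B C mB' mC|//].
  rewrite /nu /pushforward -comp_preimage; congr (_ (_ @^-1` A)).
  apply/funext => z /=; apply: eq_from_tnth => i.
  rewrite tnth_mktuple; case: (unliftP ord0 i) => [j ->|->].
    by rewrite !tnthS tnth_mktuple mxE.
  by rewrite !tnth0.
transitivity ((@lebesgue_measure R \x lebesgue_tuple R n)%E
  (((fun x : R => x + a 0 0) @^-1` B) `*` (shiftt a' @^-1` C))) => //.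
have mB1 : measurable ((fun x : R => x + a 0 0 : MR) @^-1` B).
  rewrite -[X in measurable X]setTI.
  by apply: (measurable_funD (f := fun x : MR => (x : R))).
have mC1 : measurable (shiftt a' @^-1` C).
  by rewrite -[X in measurable X]setTI; exact: measurable_shiftt.
rewrite product_measure1E//; congr (_ * _)%E; last exact: IH.
exact: lebesgue_measure_shift.
Qed.

Lemma lebesgue_tuple_box n (x : 'rV[R]_n) e : 0 < e ->
  lebesgue_tuple R n (@tuple_rV R n @^-1` ball x e) = ((2 * e) ^+ n)%:E.
Proof.
move=> e0; elim: n x => [|n IH] x.
  rewrite /= expr0 (_ : _ @^-1` _ = setT) ?diracE ?mem_setT//.
  by apply/seteqP; split => // t _; apply/ball_rVP => // -[].
rewrite lebesgue_tupleS.
pose x' : 'rV[R]_n := \row_i x 0 (lift ord0 i).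
rewrite (_ : _ @^-1` _ = (ball (x 0 0) e : set MR) `*` (@tuple_rV R n @^-1` ball x' e)).
  rewrite product_measure1E//.
  - have Lb : lebesgue_measure (ball (x 0 0) e : set MR) = (e *+ 2)%:E.
      by rewrite lebesgue_measure_ball// ltW.
    by rewrite IH [X in (X * _)%E]Lb -EFinM exprS mulr_natl.
  - exact: measurable_ball.
  - exact: measurable_ball_preimage.
apply/seteqP; split => [[r t] /= /(ball_rVP _ _ e0) H|[r t] /= [H1 /(ball_rVP _ _ e0) H2]].
  split; first by have := H 0; rewrite mxE tnth0 -ball_normE.
  by apply/(ball_rVP _ _ e0) => i; have := H (lift ord0 i); rewrite !mxE tnthS.
apply/(ball_rVP _ _ e0) => i; case: (unliftP ord0 i) => [j ->|->].
  by have := H2 j; rewrite !mxE tnthS.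
by rewrite mxE tnth0; move: H1; rewrite -ball_normE.
Qed.

End lebesgue_tuple_theory.

(** Restriction to a line turns directional derivatives into one-variable ones, so that the mean
    value theorem and the chain rule on R apply. The converse at s = 0 is [is_derive_of_line]. *)
Lemma line_is_derive {R : realType} {V W : normedModType R} (f : V -> W) (x v : V) (s : R) :
  derivable f (x + s *: v) v ->
  is_derive s (1 : R) (fun s => f (x + s *: v)) ('D_v f (x + s *: v)).
Proof.
move=> df.
have E : (fun h : R => h^-1 *: (((fun s => f (x + s *: v)) \o shift s) (h *: 1) - f (x + s *: v))) =
    (fun h => h^-1 *: ((f \o shift (x + s *: v)) (h *: v) - f (x + s *: v))).
  apply/funext => h /=; congr (_ *: (f _ - _)).
  by rewrite [h *: 1]mulr1 scalerDl addrCA.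
split; first by rewrite /derivable E.
by rewrite /derive E.
Qed.

Section integral_rV_theory.
Context {R : realType} {d : nat}.
Local Notation V := 'rV[R]_d.
Local Notation mu := (lebesgue_tuple R d).
Implicit Types F G : V -> R.

Definition intV F : R := \int[mu]_t F (tuple_rV t).

Definition bounded_support F := exists r, forall x, r <= `|x| -> F x = 0.

Lemma compact_closed_ball0 r : compact [set x : V | `|x| <= r].
Proof.
apply: bounded_closed_compact.
  by exists r; split; rewrite ?num_real// => x rx y /= /le_trans-> //; exact: ltW.
rewrite (_ : [set x | _] = (fun x : V => `|x|) @^-1` [set y | y <= r])//.
apply: closed_comp; last exact: closed_le.
by move=> x _; exact: norm_continuous.
Qed.

Lemma continuous_bounded_support_le F : continuous F -> bounded_support F ->
  exists M, 0 <= M /\ forall x, `|F x| <= M.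
Proof.
move=> cF [r rF].
have [M [_ MF]] : bounded_set (F @` [set x : V | `|x| <= r]).
  apply: compact_bounded; apply: continuous_compact; last exact: compact_closed_ball0.
  exact: continuous_subspaceT.
exists (`|M| + 1); split; first by rewrite addr_ge0.
move=> x; have [rx|xr] := leP r `|x|; first by rewrite rF// normr0 addr_ge0.
apply: MF; first by rewrite ltr_pwDr// ler_norm.
by exists x => //=; exact: ltW.
Qed.

Lemma ball0P (x : V) r : ball 0 r x <-> `|x| < r.
Proof. by rewrite -ball_normE /= sub0r normrN. Qed.

Lemma measurable_continuous F : continuous F -> measurable_fun setT (F \o @tuple_rV R d).
Proof.
move=> cF; have := @measurable_continuous_preimage R d setT F openT (fun x _ => cF x).
by rewrite preimage_setT.
Qed.

Lemma integrable_bounded_by F r M : measurable_fun setT (F \o @tuple_rV R d) ->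
  (forall x, r <= `|x| -> F x = 0) -> (forall x, `|F x| <= M) ->
  mu.-integrable setT (EFin \o (F \o @tuple_rV R d)).
Proof.
move=> mF rF MF; pose B := @tuple_rV R d @^-1` ball 0 (`|r| + 1).
have mB : measurable B by exact: measurable_ball_preimage.
rewrite (_ : EFin \o _ = (EFin \o (F \o @tuple_rV R d)) \_ B); last first.
  apply/funext => t; rewrite /patch; case: ifPn => //= /negP tB.
  rewrite rF// leNgt; apply/negP => tr; apply: tB; rewrite inE; apply/ball0P.
  by rewrite (lt_le_trans tr)// ler_wpDr// ler_norm.
apply: (iffLR (integrable_mkcond (mu := mu) (EFin \o (F \o @tuple_rV R d)) mB)); apply: measurable_bounded_integrable => //.
- suff: (lebesgue_tuple R d B < +oo)%E by [].
  by rewrite lebesgue_tuple_box ?ltry// ltr_wpDl.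
- exact: measurable_funS mF.
- by exists M; split; rewrite ?num_real// => y My t _ /=; rewrite (le_trans (MF _))// ltW.
Qed.

Lemma integrable_continuous F : continuous F -> bounded_support F ->
  mu.-integrable setT (EFin \o (F \o @tuple_rV R d)).
Proof.
move=> cF sF; have [M [_ MF]] := continuous_bounded_support_le cF sF.
case: sF => r rF; apply: (@integrable_bounded_by F r M) => //.
exact: measurable_continuous.
Qed.

Lemma intVD F G : continuous F -> bounded_support F -> continuous G -> bounded_support G ->
  intV (fun x => F x + G x) = intV F + intV G.
Proof. by move=> *; rewrite /intV RintegralD//; exact: integrable_continuous. Qed.

Lemma intVZ F k : continuous F -> bounded_support F ->
  intV (fun x => k * F x) = k * intV F.
Proof. by move=> *; rewrite /intV RintegralZl//; exact: integrable_continuous. Qed.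

Lemma le_intV F G : continuous F -> bounded_support F -> continuous G -> bounded_support G ->
  (forall x, F x <= G x) -> intV F <= intV G.
Proof. by move=> *; rewrite /intV le_Rintegral//; exact: integrable_continuous. Qed.

Lemma continuous_shiftr F (a : V) : continuous F -> continuous (fun x : V => F (x + a)).
Proof.
move=> cF x; apply: (continuous_comp (f := fun x : V => x + a)); last exact: cF.
by apply: continuousD; [exact: cvg_id|exact: cst_continuous].
Qed.

Lemma bounded_support_shiftr F (a : V) :
  bounded_support F -> bounded_support (fun x : V => F (x + a)).
Proof.
move=> [r rF]; exists (r + `|a|) => x xr; apply: rF.
have := ler_normB (x + a) a; rewrite addrK => /(le_trans xr).
by rewrite lerD2r.
Qed.

Lemma intV_shift F (a : V) : continuous F -> bounded_support F ->
  intV (fun x => F (x + a)) = intV F.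
Proof.
move=> cF sF; rewrite /intV /Rintegral; congr fine.
have iF := integrable_continuous cF sF.
have mF : measurable_fun setT (EFin \o (F \o @tuple_rV R d)).
  by apply/measurable_EFinP; exact: measurable_continuous.
transitivity (\int[pushforward mu (shiftt a)]_t (F (tuple_rV t))%:E)%E; last first.
  apply: eq_measure_integral; first exact: measurable_shiftt.
  by move=> mT A mA _; exact: lebesgue_tuple_shift.
rewrite (@integral_pushforward _ _ _ _ _ _ (measurable_shiftt a) mu setT)//.
  by apply: eq_integral => t _ /=; rewrite shifttE.
rewrite preimage_setT (_ : _ \o shiftt a = EFin \o ((fun x => F (x + a)) \o @tuple_rV R d)).
  apply: integrable_continuous; first exact: continuous_shiftr.
  exact: bounded_support_shiftr.
by apply/funext => t /=; rewrite shifttE.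
Qed.

Lemma bounded_support_derive F (v : V) : bounded_support F -> bounded_support ('D_v F).
Proof.
move=> sF.
  case: sF => r rF; exists (r + 1) => x xr.
  rewrite (@near_eq_derive _ _ _ F (cst 0)) ?derive_cst//.
  near=> y; rewrite rF//.
  have : `|x - y| < 1 by near: y; apply: cvgr_dist_lt.
  have := ler_normD (x - y) y; rewrite subrK => /(le_trans xr) H1 H2.
  by rewrite -(lerD2r 1) (le_trans H1)// addrC lerD2l ltW.
Unshelve. all: by end_near. Qed.

Lemma intV0 : intV (fun _ : V => 0 : R) = 0.
Proof. by rewrite /intV /Rintegral integral0_eq. Qed.

End integral_rV_theory.

(** * Lipschitz vector fields and their flow *)

Section cube_lipschitz.
Context {R : realType} {d : nat}.
Local Notation V := 'rV[R]_d.

Lemma partial_line_le (f : V -> R) (p : V) (i : 'I_d) (c M : R) :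
  (forall s, 0 <= s <= c \/ c <= s <= 0 ->
    derivable f (p + s *: delta_mx 0 i) (delta_mx 0 i) /\
    `|partial i f (p + s *: delta_mx 0 i)| <= M) ->
  `|f (p + c *: delta_mx 0 i) - f p| <= M * `|c|.
Proof.
move=> H; pose g (s : R) := f (p + s *: delta_mx 0 i).
have gd s : 0 <= s <= c \/ c <= s <= 0 ->
    is_derive s (1 : R) g (partial i f (p + s *: delta_mx 0 i)).
  by move=> /H[df _]; exact: line_is_derive.
have g0 : f p = g 0 by rewrite /g scale0r addr0.
rewrite g0 -/(g c); have [c0|c0] := leP 0 c.
  have [||e] := @MVT_segment R g (fun s => partial i f (p + s *: delta_mx 0 i)) 0 c c0.
  - by move=> s; rewrite in_itv/= => /andP[s0 sc]; apply: gd; left; rewrite !ltW.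
  - apply: derivable_within_continuous => s; rewrite in_itv/= => sc.
    by have [] := gd s (or_introl sc).
  rewrite in_itv/= => ec ->; rewrite subr0 normrM ler_wpM2r//.
  by have [] := H e (or_introl ec).
have [||e] := @MVT_segment R g (fun s => partial i f (p + s *: delta_mx 0 i)) c 0 (ltW c0).
- by move=> s; rewrite in_itv/= => /andP[s0 sc]; apply: gd; right; rewrite !ltW.
- apply: derivable_within_continuous => s; rewrite in_itv/= => sc.
  by have [] := gd s (or_intror sc).
rewrite in_itv/= distrC => ec ->; rewrite sub0r normrM normrN ler_wpM2r//.
by have [] := H e (or_intror ec).
Qed.

(** Class C^k is defined through partial derivatives, so the two points are joined by axis-parallel
    steps instead of a segment. The steps stay in the ball because it is a cube. *)
Lemma cube_lipschitz (f : V -> R) (z : V) (r M : R) : 0 <= M ->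
  (forall x, ball z r x -> forall i : 'I_d, derivable f x (delta_mx 0 i) /\
    `|partial i f x| <= M) ->
  forall x y, ball z r x -> ball z r y -> `|f x - f y| <= d%:R * M * `|x - y|.
Proof.
move=> M0 H x y zx zy.
have r0 : 0 < r by move: (zx); rewrite -ball_normE /=; exact: le_lt_trans.
(* The k-th corner of the path: the first k coordinates are already those of [x], the others still
   those of [y]. *)
pose h k : V := \row_i (if (i < k)%N then x 0 i else y 0 i).
have h0 : h 0%N = y by apply/rowP => i; rewrite mxE.
have hd : h d = x by apply/rowP => i; rewrite mxE ltn_ord.
have hS (k : 'I_d) : h k.+1 = h k + (x 0 k - y 0 k) *: delta_mx 0 k.
  apply/rowP => i; rewrite !mxE eqxx/= ltnS.
  have [->|ik] := eqVneq i k; first by rewrite leqnn ltnn mulr1 addrC subrK.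
  by rewrite mulr0 addr0 leq_eqVlt (negbTE (_ : _ != _)).
rewrite -[in f x]hd -[in f y]h0.
rewrite -(telescope_sumr (fun k => f (h k)) (leq0n d)) big_mkord.
rewrite (le_trans (ler_norm_sum _ _ _))//.
rewrite (le_trans (y := \sum_(i < d) M * `|x - y|))//; last first.
  by rewrite sumr_const card_ord -[leLHS]mulr_natl mulrA.
apply: ler_sum => k _; rewrite hS.
apply: (@le_trans _ _ (M * `|x 0 k - y 0 k|)); last first.
  by rewrite ler_wpM2l//; have := coord_norm_le (x - y) k; rewrite !mxE.
apply: partial_line_le => s sP; apply: H; apply/ball_rVP => // i.
move/(ball_rVP _ _ r0) : zx => /(_ i); move/(ball_rVP _ _ r0) : zy => /(_ i).
rewrite !mxE eqxx/=; have [->|ik] := eqVneq i k; last by case: ifP => _; rewrite mulr0 addr0.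
rewrite ltnn mulr1 !ltr_norml => /andP[a1 a2] /andP[b1 b2].
by case: sP => /andP[s1 s2]; apply/andP; split; lra.
Qed.

End cube_lipschitz.

Section local_lipschitz.
Context {R : realType} {d : nat}.
Local Notation V := 'rV[R]_d.

Definition lipschitz_near (W : normedModType R) (f : V -> W) (z : V) := exists r M,
  [/\ 0 < r, 0 <= M & forall x y, ball z r x -> ball z r y -> `|f x - f y| <= M * `|x - y|].

Lemma Ck1_lipschitz_near (Om : set V) (f : V -> R) : open Om -> Ck 1 Om f ->
  forall z, Om z -> lipschitz_near f z.
Proof.
move=> oO [cf pf] z Oz.
pose M := \sum_i `|partial i f z| + 1.
have M0 : 0 <= M by rewrite addr_ge0// sumr_ge0.
have : \forall x \near z, Om x /\ forall i : 'I_d, `|partial i f x| <= M.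
  apply: filterI; first exact: (open_nbhs_nbhs (conj oO Oz)).
  suff H (i : 'I_d) : nbhs z (fun x => `|partial i f x| <= M).
    exact: (@filter_forall _ _ (fun i x => `|partial i f x| <= M) _ _ H).
  have [_ [cp _]] := pf i.
  have /cvgr_norm_le : {for z, continuous (partial i f)} by exact: cp.
  apply; rewrite /M (bigD1 i)//= -addrA ltrDl ltr_wpDl// sumr_ge0//.
move=> /nbhs_ballP[r /= r0 rP]; exists r, (d%:R * M); split => //.
  by rewrite mulr_ge0.
apply: cube_lipschitz => // x /rP[Ox Mx] i; split => //.
by have [+ _] := pf i; apply.
Qed.

Lemma Ck_rV_lipschitz_near (Om : set V) (F : V -> V) : open Om -> Ck_rV 1 Om F ->
  forall z, Om z -> lipschitz_near F z.
Proof.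
move=> oO cF z Oz.
have /choice[r /choice[M rM]] : forall i : 'I_d, exists r M, [/\ 0 < r, 0 <= M &
    forall x y, ball z r x -> ball z r y -> `|F x 0 i - F y 0 i| <= M * `|x - y|].
  by move=> i; exact: (Ck1_lipschitz_near oO (cF i) Oz).
pose r0 := \big[Order.min/1]_i r i.
exists r0, (\sum_i M i); split.
- by apply: lt_bigmin => // i _; have [] := rM i.
- by apply: sumr_ge0 => i _; have [] := rM i.
move=> x y zx zy.
have Mge0 : 0 <= (\sum_i M i) by apply: sumr_ge0 => i _; have [] := rM i.
apply: rV_norm_le => [|i]; first by rewrite mulr_ge0.
rewrite !mxE; have [ri0 Mi0 /(_ x y)] := rM i.
have rr : r0 <= r i by exact: bigmin_le.
move=> /(_ (le_ball rr zx) (le_ball rr zy)) /le_trans; apply.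
rewrite ler_wpM2r// (bigD1 i)//= lerDl sumr_ge0// => j _.
by have [] := rM j.
Qed.

(** Monotonicity in the index lets the largest of finitely many local indices serve everywhere. All
    uniform radii, times and constants on compact sets are obtained in this way. *)
Lemma compact_uniform_nat (T : topologicalType) (K : set T) (P : nat -> T -> Prop) :
  compact K -> (forall m n z, (m <= n)%N -> P m z -> P n z) ->
  (forall z, K z -> exists n, \forall x \near z, P n x) ->
  exists n, forall z, K z -> P n z.
Proof.
move=> /compact_near_coveringP cK Pmono KP.
have [z Kz|n _ nP] := cK nat (nbhs \oo) P _; last by exists n => z; exact: (nP n (leqnn n)).
have [n zn] := KP z Kz; exists ([set x | P n x], [set m | (n <= m)%N]) => /=.
  by split => //; exists n.
by move=> [x m] [/= Px nm]; exact: Pmono nm Px.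
Qed.

Lemma ball_natS_sub (r : R) : 0 < r -> exists n, n.+1%:R^-1 < r.
Proof.
move=> r0; exists (Num.truncn r^-1); rewrite invf_plt ?posrE//; exact: truncnS_gt.
Qed.

(** One index n codes both constants: the radius 1/(n+1) and the Lipschitz constant n. The property
    is then monotone in n. *)
Lemma compact_lipschitz (K : set V) (W : normedModType R) (f : V -> W) : compact K ->
  (forall z, K z -> lipschitz_near f z) -> exists r M : R,
  [/\ 0 < r, 0 <= M & forall z, K z -> forall x y, ball z r x -> ball z r y ->
  `|f x - f y| <= M * `|x - y|].
Proof.
move=> cK Kf.
have [m n z mn H|z Kz|n nP] := @compact_uniform_nat V K (fun n z => forall x y,
    ball z n.+1%:R^-1 x -> ball z n.+1%:R^-1 y -> `|f x - f y| <= n%:R * `|x - y|) cK.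
- move=> x y zx zy; apply: (le_trans (H x y _ _)).
  + by apply: le_ball zx; rewrite lef_pV2 ?posrE// ler_nat.
  + by apply: le_ball zy; rewrite lef_pV2 ?posrE// ler_nat.
  + by rewrite ler_wpM2r// ler_nat.
- have [r [M [r0 M0 rM]]] := Kf z Kz.
  have r20 : 0 < r / 2 by rewrite divr_gt0.
  have [n nr] := ball_natS_sub r20.
  exists (maxn n (Num.truncn M).+1).
  near=> x => a b xa xb.
  have rP c : ball x (maxn n (Num.truncn M).+1).+1%:R^-1 c -> ball z r c.
    move=> xc; rewrite [r]splitr; apply: (@ball_triangle _ _ x).
      by near: x; exact: nbhsx_ballx.
    apply: le_ball xc; rewrite (le_trans _ (ltW nr))// lef_pV2 ?posrE// ler_nat.
    by rewrite ltnS leq_maxl.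
  apply: (le_trans (rM a b (rP _ xa) (rP _ xb))); rewrite ler_wpM2r//.
  by rewrite (le_trans (ltW (truncnS_gt M)))// ler_nat leq_maxr.
by exists n.+1%:R^-1, n%:R; split => // z Kz x y; exact: nP.
Unshelve. all: by end_near. Qed.

End local_lipschitz.

Section derive_helpers.
Context {R : realType}.

Lemma is_derive_sum_fun {V W : normedModType R} {n} (h : 'I_n -> V -> W) (x v : V) (dh : 'I_n -> W) :
  (forall i, is_derive x v (h i) (dh i)) ->
  is_derive x v (fun y => \sum_i h i y) (\sum_i dh i).
Proof.
move=> H; have -> : (fun y => \sum_i h i y) = \sum_i h i by rewrite fct_sumE.
by apply: is_derive_sum => i; exact: H.
Qed.

Lemma continuous_sum_fun {T : topologicalType} {n} (h : 'I_n -> T -> R) (x : T) :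
  (forall i, {for x, continuous (h i)}) -> {for x, continuous (fun y => \sum_i h i y)}.
Proof.
move=> H; have -> : (fun y => \sum_i h i y) = \sum_i h i by rewrite fct_sumE.
apply: (big_ind (fun f : T -> R => {for x, continuous f})).
  exact: cst_continuous.
by move=> f g cf cg; exact: cvgD cf cg.
by move=> i _; exact: H.
Qed.

Lemma is_derive_coord {V : normedModType R} {n} (f : V -> 'rV[R]_n) (x v : V) (df : 'rV[R]_n) i :
  is_derive x v f df -> is_derive x v (fun y => f y 0 i) (df 0 i).
Proof.
move=> [/[dup] /derivable_mxP H H' <-]; split; first exact: H.
by rewrite derive_mx// mxE.
Qed.

Lemma expR_scale_is_derive (k s : R) : is_derive s (1 : R) (fun t => expR (k * t)) (k * expR (k * s)).
Proof.
have H1 : is_derive s (1:R) (fun t : R => k * t) k.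
  by have := is_deriveZ k (is_derive_id s (1 : R)); rewrite [k *: 1]mulr1.
by apply: is_derive_eq (is_derive1_comp (is_derive_expR (k * s)) H1) _; rewrite mulrC.
Qed.

Lemma is_derive_continuous {W : normedModType R} (f : R -> W) (s : R) df :
  is_derive s (1 : R) f df -> {for s, continuous f}.
Proof. by move=> [/derivable1_diffP/differentiable_continuous]. Qed.

Lemma norm_mean_value {n} (v w : R -> 'rV[R]_n) (a b C : R) : a <= b -> 0 <= C ->
  (forall s, a <= s <= b -> {for s, continuous v}) ->
  (forall s, a < s < b -> is_derive s (1 : R) v (w s)) ->
  (forall s, a < s < b -> `|w s| <= C) -> `|v b - v a| <= C * (b - a).
Proof.
move=> ab C0 cv dv wC; apply: rV_norm_le => [|i]; first by rewrite mulr_ge0 ?subr_ge0.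
move: ab; rewrite le_eqVlt => /predU1P[->|ab]; first by rewrite !mxE subrr normr0 subrr mulr0.
have [||c] := @MVT R (fun s => v s 0 i) (fun s => w s 0 i) a b ab.
- by move=> s; rewrite in_itv/= => sab; apply: is_derive_coord; exact: dv.
- apply: continuous_in_subspaceT => s; rewrite inE/= in_itv/= => sab.
  apply: (@continuous_comp _ _ _ v (fun M : 'rV[R]_n => M 0 i)); first exact: cv.
  exact: coord_continuous.
rewrite in_itv/= => cab; rewrite !mxE => ->.
have ba0 : 0 <= b - a by rewrite subr_ge0 ltW.
rewrite normrM (ger0_norm ba0) ler_wpM2r//.
by rewrite (le_trans (coord_norm_le _ _))// wC.
Qed.

(** The sup norm is not differentiable, so the estimate is run on the sum of squares [phi], whose
    derivative is at most 2 n L phi. Returning to the sup norm costs the factor n in front. *)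
Lemma gronwall {n} (v w : R -> 'rV[R]_n) (L T : R) : 0 <= L -> 0 <= T ->
  (forall s, 0 <= s <= T -> {for s, continuous v}) ->
  (forall s, 0 < s < T -> is_derive s (1 : R) v (w s)) ->
  (forall s, 0 < s < T -> `|w s| <= L * `|v s|) ->
  `|v T| <= n%:R * expR (n%:R * L * T) * `|v 0|.
Proof.
move=> L0 T0 cv dv wv; pose k := 2 * n%:R * L.
pose phi s := \sum_(i < n) v s 0 i * v s 0 i.
pose psi s := phi s * expR (- k * s).
have dphi s : 0 < s < T -> is_derive s (1:R) phi (\sum_(i < n) (2 * (v s 0 i * w s 0 i))).
  move=> sT; apply: is_derive_sum_fun => i.
  have := is_derive_coord i (dv s sT) => H.
  apply: is_derive_eq (is_deriveM H H) _.
  by rewrite -mulr2n mulr_natl.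
have dpsi s : 0 < s < T -> is_derive s (1:R) psi
    (phi s * (- k * expR (- k * s)) + expR (- k * s) * (\sum_(i < n) (2 * (v s 0 i * w s 0 i)))).
  by move=> sT; exact: (is_deriveM (dphi s sT) (expR_scale_is_derive (-k) s)).
have phi_ge s : `|v s| ^+ 2 <= phi s.
  have [/eqP->|v0] := boolP (`|v s| == 0).
    by rewrite expr0n sumr_ge0// => i _; rewrite -expr2 sqr_ge0.
  have [i vi] : exists i, `|v s| = `|v s 0 i|.
    rewrite {1}/Num.Def.normr/=; have [|[i j] /= ->] := @mx_norm_neq0 R 1 n (v s).
      exact: v0.
    by exists j; rewrite ord1.
  rewrite vi /phi (bigD1 i)//= -expr2 real_normK ?num_real// lerDl sumr_ge0// => j _.
  by rewrite -expr2 sqr_ge0.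
have le1 : psi T <= psi 0.
  move: T0; rewrite le_eqVlt => /predU1P[<-//|T0].
  rewrite -subr_le0; have dpsi' s : s \in `]0, T[ -> is_derive s 1 psi _ := fun sT => dpsi s sT.
  have [|c] := @MVT R psi _ 0 T T0 dpsi'.
    apply: continuous_in_subspaceT => s; rewrite inE/= in_itv/= => sT.
    apply: (@cvgM _ _ (nbhs s)).
      apply: continuous_sum_fun => i.
      have cvi : {for s, continuous (fun s => v s 0 i)}.
        apply: (@continuous_comp _ _ _ v (fun M : 'rV[R]_n => M 0 i)); first exact: cv.
        exact: coord_continuous.
      exact: (cvgM cvi cvi).
    exact: (is_derive_continuous (expR_scale_is_derive (-k) s)).
  rewrite in_itv/= => cT ->; rewrite subr0 pmulr_lle0//.
  set S := \sum_(i < n) _; set e := expR _.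
  have -> : phi c * (- k * e) + e * S = e * (S - k * phi c) by ring.
  rewrite pmulr_rle0 ?expR_gt0// subr_le0.
  apply: (@le_trans _ _ (k * `|v c| ^+ 2)); last first.
    by rewrite ler_wpM2l// ?mulr_ge0.
  apply: (@le_trans _ _ (\sum_(i < n) (2 * (L * `|v c| ^+ 2)))); last first.
    by rewrite sumr_const card_ord -[leLHS]mulr_natl /k le_eqVlt; apply/orP; left; apply/eqP; ring.
  apply: ler_sum => i _; rewrite ler_wpM2l// (le_trans (ler_norm _))// normrM.
  rewrite expr2 mulrCA; apply: ler_pM => //; first exact: coord_norm_le.
  by rewrite (le_trans (coord_norm_le _ _))// wv.
have E0 : psi 0 <= n%:R * `|v 0| ^+ 2.
  rewrite /psi mulr0 expR0 mulr1 /phi (le_trans (y := \sum_(i < n) `|v 0| ^+ 2))//.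
    apply: ler_sum => i _; rewrite -expr2 -real_normK ?num_real// lerXn2r ?nnegrE//.
    exact: coord_norm_le.
  by rewrite sumr_const card_ord mulr_natl.
rewrite -(ler_pXn2r (n := 2)) ?nnegrE// ?mulr_ge0 ?expR_ge0//.
apply: (le_trans (phi_ge T)).
have -> : phi T = psi T * expR (k * T).
  by rewrite /psi -mulrA -expRD mulNr addNr expR0 mulr1.
apply: (@le_trans _ _ ((n%:R * `|v 0| ^+ 2) * expR (k * T))).
  by rewrite ler_wpM2r ?expR_ge0// (le_trans le1).
rewrite !exprMn -expRM_natl [leLHS]mulrAC ler_wpM2r ?sqr_ge0//.
have -> : k * T = 2 * (n%:R * L * T) by rewrite /k; ring.
rewrite ler_wpM2r ?expR_ge0//.
by rewrite -natrX ler_nat; case: (n) => // m; rewrite expnS expn1 leq_pmulr.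
Qed.

End derive_helpers.

Section flow_theory.
Context {R : realType} {d : nat}.
Local Notation V := 'rV[R]_d.
Variables (b : V -> V) (Om : set V).
Hypothesis oOm : open Om.
Hypothesis lipb : forall z, Om z -> lipschitz_near b z.
Implicit Types (g : R -> V) (s t T : R) (x y z : V).

Definition solution_on s1 s2 g :=
  forall s, s1 < s < s2 -> Om (g s) /\ is_derive s (1 : R) g (b (g s)).

Lemma solution_continuous s1 s2 g s : solution_on s1 s2 g -> s1 < s < s2 ->
  {for s, continuous g}.
Proof. by move=> sg ss; have [_ /is_derive_continuous] := sg s ss. Qed.

Lemma solution_compact s1 s2 g T : solution_on s1 s2 g -> s1 < 0 -> T < s2 ->
  compact (g @` `[0, T]) /\ g @` `[0, T] `<=` Om.
Proof.
move=> sg s10 Ts2; split.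
  apply: continuous_compact; last exact: segment_compact.
  apply: continuous_in_subspaceT => s; rewrite inE/= in_itv/= => /andP[s0 sT].
  apply: (solution_continuous sg); apply/andP; split.
    exact: lt_le_trans s0.
  exact: le_lt_trans Ts2.
move=> _ [s /= /[!in_itv]/= /andP[s0 sT] <-]; have [] // := sg s.
by rewrite (lt_le_trans s10)// (le_lt_trans sT).
Qed.

Lemma solution_gap s1 s2 g s1' s2' h (M : R) T : 0 <= M -> 0 <= T ->
  solution_on s1 s2 g -> s1 < 0 -> T < s2 ->
  solution_on s1' s2' h -> s1' < 0 -> T < s2' ->
  (forall s, 0 <= s < T -> `|b (g s) - b (h s)| <= M * `|g s - h s|) ->
  `|g T - h T| <= d%:R * expR (d%:R * M * T) * `|g 0 - h 0|.
Proof.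
move=> M0 T0 sg s10 Ts2 sh s10' Ts2' H.
have in1 s : 0 <= s <= T -> s1 < s < s2.
  by move=> /andP[a c]; rewrite (lt_le_trans s10)// (le_lt_trans c).
have in2 s : 0 <= s <= T -> s1' < s < s2'.
  by move=> /andP[a c]; rewrite (lt_le_trans s10')// (le_lt_trans c).
have := @gronwall R d (fun s => g s - h s) (fun s => b (g s) - b (h s)) M T M0 T0.
apply.
- move=> s sT; apply: (@cvgB _ _ _ (nbhs s)).
    exact: (solution_continuous sg (in1 _ sT)).
  exact: (solution_continuous sh (in2 _ sT)).
- move=> s /andP[s0 sT]; have sT' : 0 <= s <= T by rewrite !ltW.
  have [_ dg] := sg _ (in1 _ sT'); have [_ dh] := sh _ (in2 _ sT').
  exact: is_deriveB.
- by move=> s /andP[s0 sT]; apply: H; rewrite sT ltW.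
Qed.

(** A continuation argument. The Lipschitz bound holds only within [r] of the orbit of [g]; let [m]
    be the infimum of the times at which the gap reaches [r]. Before [m] the bound applies, so
    Gronwall keeps the gap below [r] at [m] as well, and by continuity shortly after, which
    contradicts the choice of [m]. *)
Lemma solution_stable s1 s2 g s1' s2' h (r M : R) T : 0 < r -> 0 <= M -> 0 <= T ->
  solution_on s1 s2 g -> s1 < 0 -> T < s2 ->
  solution_on s1' s2' h -> s1' < 0 -> T < s2' ->
  (forall z, (g @` `[0, T]) z -> forall x y, ball z r x -> ball z r y ->
     `|b x - b y| <= M * `|x - y|) ->
  d%:R * expR (d%:R * M * T) * `|g 0 - h 0| < r ->
  `|g 0 - h 0| < r ->
  forall s, 0 <= s <= T -> `|g s - h s| < r.
Proof.
move=> r0 M0 T0 sg s10 Ts2 sh s10' Ts2' Hb Hr Hr0 s sT; rewrite ltNge; apply/negP => rs.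
pose A := [set t | 0 <= t <= s /\ r <= `|g t - h t|].
have As : A s by split => //; case/andP: sT => -> _ /=.
have lbA : lbound A 0 by move=> t [/andP[]].
pose m := inf A.
have infA : has_inf A by split; [exists s|exists 0].
have m0 : 0 <= m by apply: lb_le_inf => //; exists s.
have ms : m <= s by apply: ge_inf => //; exists 0.
have mT : m <= T by case/andP: sT => _; apply: le_trans.
have in1 u : 0 <= u <= T -> s1 < u < s2.
  by move=> /andP[a c]; rewrite (lt_le_trans s10)// (le_lt_trans c).
have in2 u : 0 <= u <= T -> s1' < u < s2'.
  by move=> /andP[a c]; rewrite (lt_le_trans s10')// (le_lt_trans c).
have cgh u : 0 <= u <= T -> {for u, continuous (fun t => `|g t - h t|)}.
  move=> uT; apply: (@continuous_comp _ _ _ (fun t => g t - h t) (fun v : V => `|v|)).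
    apply: (@cvgB _ _ _ (nbhs u)); first exact: (solution_continuous sg (in1 _ uT)).
    exact: (solution_continuous sh (in2 _ uT)).
  exact: norm_continuous.
have before u : 0 <= u < m -> `|g u - h u| < r.
  move=> /andP[u0 um]; rewrite ltNge; apply/negP => ru.
  have : m <= u.
    apply: ge_inf; first by exists 0.
    by split => //; rewrite u0 (le_trans (ltW um)).
  by rewrite leNgt um.
have mTm : 0 <= m <= T by rewrite m0.
have gm : `|g m - h m| < r.
  apply: le_lt_trans Hr.
  apply: (@le_trans _ _ (d%:R * expR (d%:R * M * m) * `|g 0 - h 0|)).
    apply: (solution_gap M0 m0 sg s10 _ sh s10'); rewrite ?(le_lt_trans mT)//.
    move=> u um; have uT : 0 <= u <= T.
      by case/andP: um => -> /ltW /le_trans; apply.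
    apply: (Hb (g u)); first by exists u => //=; rewrite in_itv.
      exact: ballxx.
    by rewrite -ball_normE /=; exact: before.
  rewrite ler_wpM2r// ler_wpM2l// ler_expR ler_wpM2l// mulr_ge0//.
have /cvgr_lt/(_ _ gm) := cgh _ mTm.
move=> /nbhs_ballP[e /= e0 eP].
have [t At] : exists2 t, A t & t < m + e by apply: inf_adherent.
have mt : m <= t by apply: ge_inf => //; exists 0.
move=> tme; have : `|g t - h t| < r.
  by apply: eP; rewrite -ball_normE /= distrC ger0_norm ?subr_ge0// ltrBlDl.
by case: At => _ /le_lt_trans/[apply]; rewrite ltxx.
Qed.

(** The orbit of [g] on [0, T] is compact, hence has a neighbourhood with a single Lipschitz
    constant. Stability keeps [h] inside it, and Gronwall with zero initial gap concludes. *)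
Lemma solution_unique s1 s2 g s1' s2' h T : 0 <= T ->
  solution_on s1 s2 g -> s1 < 0 -> T < s2 ->
  solution_on s1' s2' h -> s1' < 0 -> T < s2' -> g 0 = h 0 -> g T = h T.
Proof.
move=> T0 sg s10 Ts2 sh s10' Ts2' gh0.
have [cK KOm] := solution_compact sg s10 Ts2.
have [r [M [r0 M0 Hb]]] := compact_lipschitz cK (fun z Kz => lipb (KOm z Kz)).
have E0 : `|g 0 - h 0| = 0 by rewrite gh0 subrr normr0.
have near := solution_stable r0 M0 T0 sg s10 Ts2 sh s10' Ts2' Hb.
apply/eqP; rewrite -subr_eq0 -normr_le0.
apply: (le_trans (solution_gap M0 T0 sg s10 Ts2 sh s10' Ts2' _)); last by rewrite E0 mulr0.
move=> s /andP[s0 sT]; have sT' : 0 <= s <= T by rewrite s0 ltW.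
apply: (Hb (g s)); first by exists s => //=; rewrite in_itv.
  exact: ballxx.
by rewrite -ball_normE /=; apply: near => //; rewrite E0 ?mulr0.
Qed.

Hypothesis pinv : positively_invariant b Om.
Local Notation Phi := (flow b Om).

(** [flow] chooses a solution separately for each time. Uniqueness identifies all these choices with
    one curve [g], defined on an open interval around [0, t]. *)
Lemma flow_solution t x : 0 <= t -> Om x -> exists s1 s2 g,
  [/\ solution_on s1 s2 g, s1 < 0, t < s2, g 0 = x &
      forall s, 0 <= s <= t -> Phi s x = g s].
Proof.
move=> t0 Ox; have [/(_ x Ox)[y [g [s1 [s2 [/andP[s10 s20] /andP[s1t ts2] sg g0 gt]]]]] _] := pinv t0.
exists s1, s2, g; split => // s /andP[s0 st].
have : flow_rel b Om s x (Phi s x).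
  apply: (@xgetPex _ 0 (flow_rel b Om s x)); exists (g s), g, s1, s2; split => //.
    by rewrite s10 s20.
  by rewrite (lt_le_trans s10)// (le_lt_trans st).
move=> [h [u1 [u2 [/andP[u10 u20] /andP[u1s su2] sh h0 <-]]]].
apply: (solution_unique s0 sh u10 su2 sg s10 (le_lt_trans st ts2)).
by rewrite h0.
Qed.

Lemma flow_in t x : 0 <= t -> Om x -> Om (Phi t x).
Proof. by move=> t0 Ox; have [_] := pinv t0; apply; exists x. Qed.

Lemma flow0 x : Om x -> Phi 0 x = x.
Proof.
move=> Ox; have [s1 [s2 [g [sg s10 s20 g0 gs]]]] := flow_solution (lexx 0) Ox.
by rewrite gs ?lexx.
Qed.

Lemma flowD s t x : 0 <= s -> 0 <= t -> Om x -> Phi (s + t) x = Phi s (Phi t x).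
Proof.
move=> s0 t0 Ox.
have [s1 [s2 [g [sg s10 s20 g0 gs]]]] := flow_solution (addr_ge0 s0 t0) Ox.
have -> : Phi (s + t) x = g (s + t) by rewrite gs// lexx addr_ge0.
have [u1 [u2 [h [sh u10 u20 h0 hs]]]] := flow_solution s0 (flow_in t0 Ox).
rewrite (hs s) ?s0 ?lexx//.
(* The equation is autonomous, so the time translate of [g] is the solution through [Phi t x]. *)
have sk : solution_on (s1 - t) (s2 - t) (fun v => g (v + t)).
  move=> v /andP[v1 v2]; have [] := sg (v + t).
    by rewrite -ltrBlDr v1 -ltrBrDr v2.
  move=> Og dg; split => //.
  have dt : is_derive v (1:R) (shift t) (1 : R) by exact: is_derive_shift.
  have [H <-] := dg.
  have E : (fun h0 : R => h0^-1 *: (((fun v => g (v + t)) \o shift v) (h0 *: 1) - g (v + t))) =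
    (fun h0 => h0^-1 *: ((g \o shift (v + t)) (h0 *: 1) - g (v + t))).
    by apply/funext => h1 /=; rewrite addrA.
  by split; rewrite /derivable/derive E.
apply/esym; apply: (solution_unique s0 sh u10 u20 sk _ _ _).
- by rewrite subr_lt0 (lt_le_trans s10).
- by rewrite ltrBrDr.
- by rewrite h0 add0r gs// t0 lerDr.
Qed.

Lemma flow_within_continuous T x : 0 <= T -> Om x ->
  {within `[0, T], continuous (Phi ^~ x)}.
Proof.
move=> T0 Ox; have [s1 [s2 [g [sg s10 s20 g0 gs]]]] := flow_solution T0 Ox.
apply: (@subspace_eq_continuous _ _ _ g).
  by move=> s; rewrite inE/= in_itv/= => sT; apply/esym; exact: gs.
apply: continuous_in_subspaceT => s; rewrite inE/= in_itv/= => /andP[s0 sT].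
by apply: (solution_continuous sg); rewrite (lt_le_trans s10)// (le_lt_trans sT).
Qed.

Lemma flow_lipschitz T z : 0 <= T -> Om z -> exists r M : R,
  [/\ 0 < r, 0 <= M, ball z r `<=` Om & forall x y, ball z r x -> ball z r y ->
   forall t, 0 <= t <= T -> `|Phi t x - Phi t y| <= M * `|x - y|].
Proof.
move=> T0 Oz; have [s1 [s2 [g [sg s10 Ts2 g0 gs]]]] := flow_solution T0 Oz.
have [cK KOm] := solution_compact sg s10 Ts2.
have [r [M [r0 M0 Hb]]] := compact_lipschitz cK (fun z Kz => lipb (KOm z Kz)).
have /nbhs_ballP[r1 /= r10 r1P] := open_nbhs_nbhs (conj oOm Oz).
pose C := d%:R * expR (d%:R * M * T).
have C0 : 0 <= C by rewrite mulr_ge0 ?expR_ge0.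
(* The second entry keeps the Gronwall bound below [r], so that orbits from the ball never leave the
   region where [b] is Lipschitz with constant [M]. *)
pose del := Order.min r1 (r / (C + 1)).
have C10 : 0 < C + 1 by rewrite ltr_wpDl.
have del0 : 0 < del by rewrite lt_min r10 divr_gt0.
have inO x : ball z del x -> Om x.
  by move=> zx; apply: r1P; apply: le_ball zx; rewrite ge_min lexx.
have key x : ball z del x -> exists u1 u2 h, [/\ solution_on u1 u2 h, u1 < 0, T < u2, h 0 = x &
   forall s, 0 <= s <= T -> Phi s x = h s /\ ball (g s) r (h s)].
  move=> zx; have [u1 [u2 [h [sh u10 u20 h0 hs]]]] := flow_solution T0 (inO _ zx).
  exists u1, u2, h; split => // s sT; split; first exact: hs.
  have zx' : `|g 0 - h 0| < r / (C + 1).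
    move: zx; rewrite g0 h0 -ball_normE /= => /lt_le_trans; apply.
    by rewrite ge_min lexx orbT.
  rewrite -ball_normE /=.
  apply: (solution_stable r0 M0 T0 sg s10 Ts2 sh u10 u20 Hb) => //.
    rewrite -/C (@le_lt_trans _ _ ((C + 1) * `|g 0 - h 0|))//.
      by rewrite ler_wpM2r// lerDl.
    by rewrite mulrC -ltr_pdivlMr.
  by rewrite (lt_le_trans zx')// ler_pdivrMr// mulrDr mulr1 lerDr mulr_ge0// ltW.
exists del, C; split => // x y /key[u1 [u2 [h [sh u10 u20 h0 hs]]]].
move=> /key[v1 [v2 [k [sk v10 v20 k0 ks]]]] t /andP[t0 tT].
have tT' : 0 <= t <= T by rewrite t0.
have [-> _] := hs _ tT'; have [-> _] := ks _ tT'; rewrite -h0 -k0.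
apply: (@le_trans _ _ (d%:R * expR (d%:R * M * t) * `|h 0 - k 0|)); last first.
  by rewrite ler_wpM2r// ler_wpM2l// ler_expR ler_wpM2l// mulr_ge0.
apply: (solution_gap M0 t0 sh u10 _ sk v10); rewrite ?(le_lt_trans tT)//.
move=> s /andP[s0 st]; have sT : 0 <= s <= T by rewrite s0 (le_trans (ltW st)).
apply: (Hb (g s)); first by exists s => //=; rewrite in_itv.
  by have [] := hs _ sT.
by have [] := ks _ sT.
Qed.

Lemma flow_short (K : set V) (e : R) : compact K -> K `<=` Om -> 0 < e ->
  exists2 tau : R, 0 < tau & forall y, K y -> forall s, 0 <= s <= tau -> `|Phi s y - y| <= e.
Proof.
move=> cK KO e0.
have [m n z mn H s|z Kz|n nP] := @compact_uniform_nat V K (fun n y => forall s,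
    0 <= s <= n.+1%:R^-1 -> `|Phi s y - y| <= e) cK.
- move=> /andP[s0 sn]; apply: H; rewrite s0 (le_trans sn)//.
  by rewrite lef_pV2 ?posrE// ler_nat.
- have [r [M [r0 M0 rO rM]]] := flow_lipschitz ler01 (KO z Kz).
  have [s1 [s2 [g [sg s10 s20 g0 gs]]]] := flow_solution ler01 (KO z Kz).
  have e30 : 0 < e / 3 by rewrite divr_gt0.
  have M10 : 0 < M + 1 by rewrite ltr_wpDl.
  have : {for 0, continuous g} by apply: (solution_continuous sg); rewrite s10 (lt_trans _ s20).
  move=> /cvgr_dist_le/(_ _ e30)/nbhs_ballP[t /= t0 tP].
  have [n nt] := @ball_natS_sub R (Order.min t 1) ltac:(by rewrite lt_min t0 ltr01).
  exists n; near=> y => s /andP[s0 sn].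
  have s1' : 0 <= s <= 1.
    by rewrite s0 (le_trans sn)// (le_trans (ltW nt))// ge_min lexx orbT.
  have zy : ball z r y by near: y; exact: nbhsx_ballx.
  have zye : `|z - y| <= e / 3 / (M + 1).
    by near: y; apply: cvgr_dist_le; rewrite ?divr_gt0//; exact: cvg_id.
  (* Three terms of size e/3: dependence on the starting point, motion of the centre [z], and the
     distance from [z] to [y]. *)
  have -> : Phi s y - y = (Phi s y - Phi s z) + (Phi s z - z) + (z - y).
    by rewrite !addrA !subrK.
  have -> : e = e / 3 + e / 3 + e / 3 by lra.
  apply: (le_trans (ler_normD _ _)); apply: lerD; last first.
    by rewrite (le_trans zye)// ler_pdivrMr// ler_peMr ?lerDr// ltW.
  apply: (le_trans (ler_normD _ _)); apply: lerD.
    rewrite distrC (le_trans (rM z y _ zy _ s1'))//; first exact: ballxx.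
    rewrite (@le_trans _ _ (M * (e / 3 / (M + 1))))//; first by rewrite ler_wpM2l.
    by rewrite mulrA ler_pdivrMr// mulrC ler_wpM2l ?lerDl// ltW.
  rewrite gs// -[in X in _ - X]g0 distrC; apply: tP.
  rewrite -ball_normE /= sub0r normrN ger0_norm//.
  by rewrite (le_lt_trans sn)// (lt_le_trans nt)// ge_min lexx.
exists n.+1%:R^-1 => //.
Unshelve. all: by end_near. Qed.

(** Mean value estimate for the difference between a straight motion and the orbit. It will convert
    decay along orbits into decay along a constant vector, which is what a directional derivative
    sees. *)
Lemma flow_euler y (w : V) (tau C : R) : Om y -> 0 <= tau -> 0 <= C ->
  (forall s, 0 <= s <= tau -> `|w - b (Phi s y)| <= C) ->
  `|y + tau *: w - Phi tau y| <= C * tau.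
Proof.
move=> Oy tau0 C0 H; have [s1 [s2 [g [sg s10 s20 g0 gs]]]] := flow_solution tau0 Oy.
have ins s : 0 <= s <= tau -> s1 < s < s2.
  by move=> /andP[a c]; rewrite (lt_le_trans s10)// (le_lt_trans c).
have := @norm_mean_value R d (fun s => (y + s *: w) - g s) (fun s => w - b (g s)) 0 tau C tau0 C0.
rewrite scale0r addr0 g0 subrr !subr0 -gs ?tau0 ?lexx//; apply.
- move=> s sT; apply: (@cvgB _ _ _ (nbhs s)).
    apply: cvgD; first exact: cvg_cst.
    by apply: cvgZr_tmp; exact: cvg_id.
  exact: (solution_continuous sg (ins _ sT)).
- move=> s /andP[a c]; have sT : 0 <= s <= tau by rewrite !ltW.
  have [_ dg] := sg _ (ins _ sT).
  have dw : is_derive s (1:R) (fun s => y + s *: w) w.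
    have [H1 H2] : is_derive (y + s *: w) w (@id V) w by exact: is_derive_id.
    by have := @line_is_derive R V V id y w s H1; rewrite H2.
  exact: is_deriveB dw dg.
- move=> s /andP[a c]; have sT : 0 <= s <= tau by rewrite !ltW.
  by rewrite -gs// H.
Qed.

End flow_theory.

(** * A Lipschitz Lyapunov function *)

Section reachability.
Context {R : realType} {d : nat}.
Local Notation V := 'rV[R]_d.
Variables (b : V -> V) (Om : set V).
Local Notation Phi := (flow b Om).

(** Endpoints of chains from [x] with at least one link. As in the definition of chain-transitivity,
    points at which a link starts must lie in [Om], while the last one is free; for [x] itself this
    is asked in [reach_chain]. *)
Inductive reach (x : V) (eta T : R) : V -> Prop :=
| reach_base w t : T <= t -> enorm (Phi t x - w) < eta -> reach x eta T w
| reach_step z w t : reach x eta T z -> Om z -> T <= t ->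
    enorm (Phi t z - w) < eta -> reach x eta T w.

Lemma reach_chain (x y : V) (eta T : R) : Om x -> reach x eta T y ->
  exists (n : nat) (xs : nat -> V) (ts : nat -> R),
    [/\ (0 < n)%N, xs 1%N = x, xs n.+1 = y &
      forall i, (1 <= i <= n)%N -> [/\ Om (xs i), T <= ts i &
        enorm (Phi (ts i) (xs i) - xs i.+1) < eta]].
Proof.
move=> Ox; elim=> [w t Tt xw|z w t _ [n [xs [ts [n0 xs1 xsn H]]]] Oz Tt zw].
  (* Chains are numbered from 1; the value at index 0 is never read. *)
  exists 1%N, (fun i => if (i <= 1)%N then x else w), (fun=> t); split => // i.
  by rewrite -eqn_leq => /eqP <-.
exists n.+1, (fun i => if (i <= n.+1)%N then xs i else w),
  (fun i => if (i <= n)%N then ts i else t); split => //.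
  by rewrite ltnn.
move=> i /andP[i1 iSn]; rewrite iSn ltnS; have [il|ni] := leqP i n.
  by apply: H; rewrite i1.
have -> : i = n.+1 by apply/eqP; rewrite eqn_leq iSn.
by rewrite xsn.
Qed.

Lemma reach_le (x y : V) (eta eta' T T' : R) : eta' <= eta -> T <= T' ->
  reach x eta' T' y -> reach x eta T y.
Proof.
move=> ee TT; elim=> [w t Tt xw|z w t _ IH Oz Tt zw].
  by apply: (@reach_base _ _ _ _ t); [exact: le_trans Tt|exact: lt_le_trans ee].
by apply: (@reach_step _ _ _ z _ t) => //; [exact: le_trans Tt|exact: lt_le_trans ee].
Qed.

End reachability.

Section distance_function.
Context {R : realType} {d : nat}.
Local Notation V := 'rV[R]_d.
Variables (P : set V) (eta : R).
Hypotheses (eta0 : 0 < eta) (P0 : P !=set0).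

Definition trunc_dist (z : V) : R :=
  Order.min 1 (inf [set `|z - p| | p in P] / eta).

Let hasinf z : has_inf [set `|z - p| | p in P].
Proof.
split; first by case: P0 => p Pp; exists `|z - p|, p.
by exists 0 => _ [p _ <-].
Qed.

Let inf_ge0 z : 0 <= inf [set `|z - p| | p in P].
Proof. by apply: lb_le_inf => [|_ [p _ <-]//]; case: (hasinf z). Qed.

Lemma trunc_dist_ge0 z : 0 <= trunc_dist z.
Proof. by rewrite le_min ler01 divr_ge0// ltW. Qed.

Lemma trunc_dist_le1 z : trunc_dist z <= 1.
Proof. by rewrite ge_min lexx. Qed.

Lemma min1_le (a c e : R) : 0 <= e -> a <= c + e -> Order.min 1 a <= Order.min 1 c + e.
Proof.
move=> e0 ace; case: (leP 1 c) => c1; first by rewrite ge_min lerDl e0.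
by rewrite ge_min ace orbT.
Qed.

Lemma trunc_dist_lip z w : trunc_dist z <= trunc_dist w + `|z - w| / eta.
Proof.
apply: min1_le; first by rewrite divr_ge0// ltW.
rewrite -mulrDl ler_pM2r ?invr_gt0// -lerBlDr.
apply: lb_le_inf => [|_ [p Pp <-]]; first by case: (hasinf w).
rewrite lerBlDr; apply: (@le_trans _ _ `|z - p|).
  by apply: ge_inf => //; [case: (hasinf z)|exists p].
by have := ler_normD (z - w) (w - p); rewrite addrA subrK [_ + `|w - p|]addrC.
Qed.

Lemma trunc_dist0 p : P p -> trunc_dist p = 0.
Proof.
move=> Pp; apply/eqP; rewrite eq_le trunc_dist_ge0 andbT /trunc_dist.
rewrite ge_min; apply/orP; right; rewrite pmulr_lle0 ?invr_gt0//.
by apply: ge_inf; [case: (hasinf p)|exists p => //; rewrite subrr normr0].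
Qed.

Lemma trunc_dist_lt1 z : trunc_dist z < 1 -> exists2 p, P p & `|z - p| < eta.
Proof.
rewrite /trunc_dist gt_min ltxx/= ltr_pdivrMr// mul1r => H.
by have [_ [p Pp <-] pe] := inf_lt (hasinf z).1 H; exists p.
Qed.

End distance_function.

Lemma hdist_lt_exists {R : realType} {d : nat} (B C : set 'rV[R]_d) (e : R) :
  (hdist B C < e%:E)%E -> forall x, B x -> exists2 y, C y & `|x - y| < e.
Proof.
move=> He x Bx.
have : (ereal_inf [set (enorm (x - y))%:E | y in C] < e%:E)%E.
  apply: le_lt_trans He; apply: ereal_sup_ubound; right; exists x => //.
move=> /ereal_inf_ltP[_ [y Cy <-]]; rewrite lte_fin => xy; exists y => //.
exact: le_lt_trans (norm_le_enorm _) xy.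
Qed.

Lemma hdist_cvg0 {R : realType} {d : nat} (B : R -> set 'rV[R]_d) (C : set 'rV[R]_d) (e : R) :
  0 < e -> hdist (B t) C @[t --> +oo%R] --> 0%E ->
  exists T : R, forall t, T <= t -> forall x, B t x -> exists2 y, C y & `|x - y| < e.
Proof.
move=> e0 /(_ [set y | (y < e%:E)%E]) H.
have /H : nbhs (0%E : \bar R) [set y | (y < e%:E)%E].
  apply: open_nbhs_nbhs; split; first exact: open_ereal_lt_ereal.
  by rewrite /= lte_fin.
move=> [T [_ TP]]; exists (T + 1) => t Tt x; apply: hdist_lt_exists.
by apply: TP; rewrite (lt_le_trans _ Tt)// ltrDl.
Qed.

Lemma unit_dist_le1 {R : realDomainType} (a c : R) :
  0 <= a <= 1 -> 0 <= c <= 1 -> `|a - c| <= 1.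
Proof.
move=> /andP[a0 a1] /andP[c0 c1]; rewrite ler_norml lerBlDr lerBrDr.
by rewrite (le_trans _ a0) ?(le_trans a1) ?lerDl// addrC subr_le0.
Qed.

Section lyapunov_function.
Context {R : realType} {d : nat}.
Local Notation V := 'rV[R]_d.
Variables (b : V -> V) (Om : set V).
Hypothesis oOm : open Om.
Hypothesis lipb : forall z, Om z -> lipschitz_near b z.
Hypothesis pinv : positively_invariant b Om.
Local Notation Phi := (flow b Om).

Variables (N K : set V) (eta T : R) (n0 : V).
Hypotheses (eta0 : 0 < eta) (T0 : 0 < T) (Nn0 : N n0).
Hypotheses (cK : compact K) (NK : N `<=` K) (KO : K `<=` Om).
Hypothesis Nstep : forall z w t, N z -> T <= t -> `|Phi t z - w| < eta -> N w.

(** The late images of [N]. By [Nstep] the [eta]-neighbourhood of [P] lies in [N], so the truncated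
    distance [G] vanishes on [P] and equals 1 off [N]. *)
Let P : set V := [set p | exists z t, [/\ N z, T <= t & p = Phi t z]].

Let P0 : P !=set0.
Proof. by exists (Phi T n0), n0, T; split. Qed.

Let G := trunc_dist P eta.

Let NO : N `<=` Om. Proof. exact: subset_trans KO. Qed.

Let G_lt1 z : G z < 1 -> N z.
Proof.
move=> /(trunc_dist_lt1 eta0 P0)[_ [w [t [Nw Tt ->]]]].
by rewrite distrC; exact: Nstep.
Qed.

Let G_notN z : ~ N z -> G z = 1.
Proof.
move=> Nz; apply/eqP; rewrite eq_le trunc_dist_le1/= leNgt; apply/negP => /G_lt1.
by [].
Qed.

Let G_late z t : N z -> T <= t -> G (Phi t z) = 0.
Proof. by move=> Nz Tt; apply: trunc_dist0 => //; exists z, t. Qed.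

Let A z := [set y | exists2 t, 0 <= t & y = Order.min 1 (expR t * G (Phi t z))].

(* [N] will be a chain-reachable set; the factor [expR t] makes [lyap] decay exponentially
   along orbits. *)
Definition lyap z : R := if `[< N z >] then sup (A z) else 1.

Let G_ge0 z : 0 <= G z. Proof. exact: trunc_dist_ge0. Qed.

Let hasA z : has_sup (A z).
Proof.
split; first by exists (Order.min 1 (expR 0 * G (Phi 0 z))), 0.
by exists 1 => _ [t _ ->]; rewrite ge_min lexx.
Qed.

Lemma lyap_notin z : ~ N z -> lyap z = 1.
Proof. by move=> Nz; rewrite /lyap asboolF. Qed.

Lemma lyap_ge z t : N z -> 0 <= t -> Order.min 1 (expR t * G (Phi t z)) <= lyap z.
Proof.
move=> Nz t0; rewrite /lyap asboolT//; apply: sup_ubound; first by case: (hasA z).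
by exists t.
Qed.

Lemma lyap_le z c : N z ->
  (forall t, 0 <= t -> Order.min 1 (expR t * G (Phi t z)) <= c) -> lyap z <= c.
Proof.
move=> Nz H; rewrite /lyap asboolT//; apply: ge_sup; first by case: (hasA z).
by move=> _ [t t0 ->]; exact: H.
Qed.

Lemma lyap_le1 z : lyap z <= 1.
Proof.
have [Nz|Nz] := pselect (N z); last by rewrite lyap_notin.
by apply: lyap_le => // t t0; rewrite ge_min lexx.
Qed.

Lemma lyap_ge0 z : 0 <= lyap z.
Proof.
have [Nz|Nz] := pselect (N z); last by rewrite lyap_notin.
by apply: le_trans (lyap_ge Nz (lexx 0)); rewrite le_min ler01 mulr_ge0// expR_ge0.
Qed.

Let G_le_lyap z : G z <= lyap z.
Proof.
have [Nz|Nz] := pselect (N z); last by rewrite lyap_notin// trunc_dist_le1.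
apply: le_trans (lyap_ge Nz (lexx 0)).
by rewrite expR0 mul1r (flow0 lipb pinv (NO Nz)) le_min lexx trunc_dist_le1.
Qed.

Lemma lyap_lt1 z : lyap z < 1 -> N z.
Proof. by move=> /(le_lt_trans (G_le_lyap z))/G_lt1. Qed.

(** Where [lyap z] < 1 the truncation at 1 is inactive, so exp(t) G(Phi t z) <= [lyap z] for all t
    >= 0. Replacing t by t + s and dividing by exp(s) gives the bound, and its case t = 0 shows that
    [Phi s z] is still in [N]. *)
Lemma lyap_decay z s : lyap z < 1 -> 0 <= s -> lyap (Phi s z) <= expR (- s) * lyap z.
Proof.
move=> Wz s0; have Nz := lyap_lt1 Wz.
have Gz t : 0 <= t -> expR t * G (Phi t z) <= lyap z.
  move=> t0; have := lyap_ge Nz t0; rewrite ge_min => /orP[|//].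
  by rewrite leNgt Wz.
have Gs t : 0 <= t -> expR t * G (Phi t (Phi s z)) <= expR (- s) * lyap z.
  move=> t0; rewrite -(flowD lipb pinv t0 s0 (NO Nz)).
  rewrite -(@ler_pM2l _ (expR s)) ?expR_gt0// !mulrA -!expRD subrr expR0 mul1r.
  by rewrite addrC Gz// addr_ge0.
have lts : expR (- s) * lyap z < 1.
  by rewrite (le_lt_trans _ Wz)// ler_piMl ?lyap_ge0// -expR0 ler_expR oppr_le0.
apply: lyap_le => [|t t0]; last by rewrite ge_min Gs ?orbT.
apply: G_lt1; apply: le_lt_trans lts.
have := Gs 0 (lexx 0); rewrite expR0 mul1r (flow0 lipb pinv)//.
exact: flow_in (NO Nz).
Qed.

(** From time [T] on the orbit stays in [P], where [G] vanishes. This supplies points of the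
    attractor below the level 1/2. *)
Lemma lyap_late z t : N z -> T <= t -> lyap (Phi t z) = 0.
Proof.
move=> Nz Tt; have t0 : 0 <= t by rewrite (le_trans (ltW T0)).
apply/eqP; rewrite eq_le lyap_ge0 andbT; apply: lyap_le.
  by apply: G_lt1; rewrite G_late.
move=> s s0; rewrite -(flowD lipb pinv s0 t0 (NO Nz)) G_late ?mulr0 ?ge_min ?lexx ?orbT//.
by rewrite (le_trans Tt)// lerDr.
Qed.

(** Only times below [T] contribute to the supremum, and on [0, T] the flow is uniformly Lipschitz
    in its starting point: this gives the first term of [C]. The term 1/eta handles [x] off [N] and
    [y] in [N], where G(x) = 1 is compared with G(y). *)
Lemma lyap_lipschitz_near z : Om z -> lipschitz_near lyap z.
Proof.
move=> Oz; have [r [M [r0 M0 rO rM]]] := flow_lipschitz oOm lipb pinv (ltW T0) Oz.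
pose C := expR T * M / eta + eta^-1.
have C1 : 0 <= expR T * M / eta by rewrite divr_ge0 ?mulr_ge0 ?expR_ge0// ltW.
have C2 : 0 <= eta^-1 by rewrite invr_ge0 ltW.
exists r, C; split => //; first by rewrite addr_ge0.
have key x y : ball z r x -> ball z r y -> lyap x <= lyap y + C * `|x - y|.
  move=> zx zy; have E0 : 0 <= C * `|x - y| by rewrite mulr_ge0// addr_ge0.
  have [Ny|Ny] := pselect (N y); last first.
    by rewrite (lyap_notin Ny) (le_trans (lyap_le1 x))// lerDl.
  have [Nx|Nx] := pselect (N x); last first.
    rewrite (lyap_notin Nx) -(G_notN Nx); apply: (le_trans (trunc_dist_lip eta0 P0 x y)).
    apply: lerD; first exact: G_le_lyap.
    by rewrite mulrC ler_wpM2r// /C lerDr.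
  apply: lyap_le => // t t0; have [Tt|tT] := leP T t.
    by rewrite G_late// mulr0 ge_min addr_ge0 ?lyap_ge0 ?orbT.
  apply: (le_trans _ (lerD (lyap_ge Ny t0) (lexx _))); apply: min1_le => //.
  apply: (@le_trans _ _ (expR t * (G (Phi t y) + `|Phi t x - Phi t y| / eta))).
    by rewrite ler_wpM2l ?expR_ge0//; exact: trunc_dist_lip.
  rewrite mulrDr lerD2l /C mulrDl.
  apply: (@le_trans _ _ (expR T * M / eta * `|x - y|)); last by rewrite lerDl mulr_ge0.
  have -> : expR T * M / eta * `|x - y| = expR T * (M * `|x - y| / eta).
    by rewrite -!mulrA [eta^-1 * _]mulrC.
  apply: ler_pM; rewrite ?expR_ge0 ?divr_ge0 ?(ltW eta0)//.
    by rewrite ler_expR ltW.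
  by rewrite ler_pM2r ?invr_gt0// rM// t0 ltW.
move=> x y zx zy; rewrite ler_norml; apply/andP; split.
  by rewrite lerNl opprB lerBlDl; rewrite -[`|_|]distrC; exact: key.
by rewrite lerBlDl key.
Qed.

(** Points at distance at least [r] are handled by the oscillation being at most 1, whence the term
    1/r; nearby points with one in [N] by compactness of [K]; and off [N] the function is
    constant. *)
Lemma lyap_lipschitz : exists M, 0 <= M /\ forall x y, `|lyap x - lyap y| <= M * `|x - y|.
Proof.
have [r [M [r0 M0 rM]]] := compact_lipschitz cK (fun z Kz => lyap_lipschitz_near (KO Kz)).
exists (M + r^-1); have ri0 : 0 <= r^-1 by rewrite invr_ge0 ltW.
split; first by rewrite addr_ge0.
have key x y : N x -> `|lyap x - lyap y| <= (M + r^-1) * `|x - y|.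
  move=> Nx; rewrite mulrDl; have [xy|xy] := ltP `|x - y| r.
    rewrite (le_trans (rM x (NK Nx) x y _ _)) ?lerDl ?mulr_ge0//; first exact: ballxx.
    by rewrite -ball_normE.
  apply: (@le_trans _ _ (r^-1 * `|x - y|)); last by rewrite lerDr mulr_ge0.
  apply: (@le_trans _ _ 1); last by rewrite mulrC ler_pdivlMr// mul1r.
  by apply: unit_dist_le1; rewrite lyap_ge0 lyap_le1.
move=> x y; have [Nx|Nx] := pselect (N x); first exact: key.
have [Ny|Ny] := pselect (N y); first by rewrite distrC -[`|x - y|]distrC; exact: key.
by rewrite !lyap_notin// subrr normr0 mulr_ge0// addr_ge0.
Qed.

End lyapunov_function.

Lemma lipschitz_near_continuous {R : realType} {d : nat} (W : normedModType R)
  (f : 'rV[R]_d -> W) (z : 'rV[R]_d) : lipschitz_near f z -> {for z, continuous f}.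
Proof.
move=> [r [M [r0 M0 H]]]; apply/(@cvgrPdist_le _ _ _ (nbhs z)) => e e0.
have e1 : 0 < e / (M + 1) by rewrite divr_gt0// ltr_wpDl.
apply/nbhs_ballP; exists (Order.min r (e / (M + 1))) => /=.
  by rewrite lt_min r0.
move=> y zy; have zyr : ball z r y by apply: le_ball zy; rewrite ge_min lexx.
rewrite (le_trans (H z y (ballxx _ r0) zyr))//.
apply: (@le_trans _ _ (M * (e / (M + 1)))).
  rewrite ler_wpM2l//; move: zy; rewrite -ball_normE /= => /ltW/le_trans; apply.
  by rewrite ge_min lexx orbT.
by rewrite mulrCA ger_pMr// ler_pdivrMr ?mul1r ?lerDl// ltr_wpDl.
Qed.

Lemma relatively_compact_ball {R : realType} {d : nat} (Om : set 'rV[R]_d) z :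
  open Om -> Om z -> exists2 r : R, 0 < r & relatively_compact Om (ball z r).
Proof.
move=> oO Oz; have /nbhs_ballP[r /= r0 rO] := open_nbhs_nbhs (conj oO Oz).
have r20 : 0 < r / 2 by rewrite divr_gt0.
exists (r / 2) => //; have sub : closure (ball z (r / 2)) `<=` ball z r.
  move=> y /(_ (ball y (r / 2)) (nbhsx_ballx _ _ r20))[x [zx yx]].
  by rewrite [r]splitr; apply: ball_triangle zx _; exact: ball_sym.
split; last exact: subset_trans rO.
apply: bounded_closed_compact; last exact: closed_closure.
exists (`|z| + r); split; rewrite ?num_real// => M Mr y /sub.
rewrite -ball_normE /= => zy; rewrite (le_trans _ (ltW Mr))//.
have -> : y = z - (z - y) by rewrite opprB addrC subrK.
by rewrite (le_trans (ler_normB _ _))// lerD2l ltW.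
Qed.

Lemma relatively_compact_nbhd {R : realType} {d : nat} (Om A : set 'rV[R]_d) :
  open Om -> compact A -> A `<=` Om -> exists2 r : R, 0 < r &
  relatively_compact Om [set z | exists2 a, A a & `|z - a| < r].
Proof.
move=> oO cA AO.
have [m n z mn H x zx|z Az|n nP] := @compact_uniform_nat _ A (fun n z =>
    ball z n.+1%:R^-1 `<=` Om) cA.
- by apply: H; apply: le_ball zx; rewrite lef_pV2 ?posrE// ler_nat.
- have /nbhs_ballP[r /= r0 rO] := open_nbhs_nbhs (conj oO (AO _ Az)).
  have r20 : 0 < r / 2 by rewrite divr_gt0.
  have [n nr] := ball_natS_sub r20; exists n; near=> y => x yx.
  apply: rO; rewrite [r]splitr; apply: (@ball_triangle _ _ y).
    by near: y; exact: nbhsx_ballx.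
  by apply: le_ball yx; exact: ltW.
pose r : R := n.+1%:R^-1 / 2; have r0 : 0 < r by rewrite divr_gt0.
exists r => //; pose D := [set z | exists2 a, A a & `|z - a| < r].
have sub : closure D `<=` [set z | exists2 a, A a & ball a n.+1%:R^-1 z].
  move=> y /(_ (ball y r) (nbhsx_ballx _ _ r0))[x [[a Aa xa] yx]]; exists a => //.
  rewrite [_^-1]splitr; apply: (@ball_triangle _ _ x); last exact: ball_sym.
  by apply: ball_sym; rewrite -ball_normE.
split; last by move=> y /sub[a /nP aO ay]; exact: aO.
apply: bounded_closed_compact; last exact: closed_closure.
have [M [_ AM]] := compact_bounded cA.
exists (`|M| + 1 + n.+1%:R^-1); split; rewrite ?num_real// => M' M'r y /sub[a Aa].
rewrite -ball_normE /= => ay; rewrite (le_trans _ (ltW M'r))//.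
have -> : y = a - (a - y) by rewrite opprB addrC subrK.
apply: (le_trans (ler_normB _ _)); apply: lerD; last exact: ltW.
by apply: AM => //; rewrite ltr_pwDr// ler_norm.
Unshelve. all: by end_near. Qed.

(** * Intermediate levels are attained on the attractor *)

Section level_point.
Context {R : realType} {d : nat}.
Local Notation V := 'rV[R]_d.
Variables (b : V -> V) (Om Att : set V).
Hypothesis oOm : open Om.
Hypothesis lipb : forall z, Om z -> lipschitz_near b z.
Hypothesis pinv : positively_invariant b Om.
Local Notation Phi := (flow b Om).
Hypothesis cOm : connected Om.
Hypothesis attr : maximal_attractor b Om Att.
Variables (W : V -> R) (M c : R).
Hypotheses (M0 : 0 <= M) (lipW : forall x y, `|W x - W y| <= M * `|x - y|).
Hypothesis decay : forall z s, Om z -> W z < c -> 0 <= s -> W (Phi s z) <= W z.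

(* The basins of [W < c] and of [W > c] would otherwise disconnect [Om]. *)
Lemma attractor_level (p q : V) : Att p -> Att q -> W p < c -> c < W q ->
  exists2 x, Att x & W x = c.
Proof.
case: attr => cA AO invA attrA Ap Aq Wp Wq; apply: contrapT => nex.
have cW : continuous W.
  by move=> x; apply: lipschitz_near_continuous; exists 1, M; split.
have cPhi t z : 0 <= t -> Om z -> {for z, continuous (fun x => W (Phi t x))}.
  move=> t0 Oz; apply: (@continuous_comp _ _ _ (Phi t) W); last exact: cW.
  have [r [L [r0 L0 rO rL]]] := flow_lipschitz oOm lipb pinv t0 Oz.
  apply: lipschitz_near_continuous; exists r, L; split => // x y zx zy.
  by apply: rL; rewrite ?t0 ?lexx.
(* If the level [c] is missed on the compact attractor, |W - c| has a positive minimum there, and by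
   the Lipschitz bound [c] is missed on a whole neighbourhood. *)
have [dl dl0 Adl] : exists2 dl, 0 < dl & forall a w, Att a -> `|w - a| < dl -> W w != c.
  have [] := @compact_EVT_min _ R (fun x => `|W x - c|) Att _ cA.
  - by exists p.
  - apply: continuous_subspaceT => x; apply: (@continuous_comp _ _ _ (fun x => W x - c) (fun y => `|y|)).
      by apply: (@cvgB _ _ _ (nbhs x)); [exact: cW|exact: cvg_cst].
    exact: norm_continuous.
  move=> a /[!inE] Aa amin; have ac : 0 < `|W a - c|.
    by rewrite normr_gt0 subr_eq0; apply/eqP => Wac; apply: nex; exists a.
  exists (`|W a - c| / (M + 1)); first by rewrite divr_gt0// ltr_wpDl.
  move=> a' w Aa' wa; apply/eqP => Wwc.
  have := amin a'; rewrite inE => /(_ Aa'); rewrite leNgt => /negP; apply.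
  rewrite -[X in `|W a' - X|]Wwc distrC (le_lt_trans (lipW _ _))//; move: wa; rewrite ltr_pdivlMr ?ltr_wpDl//.
  by apply: le_lt_trans; rewrite mulrC ler_wpM2l// lerDl.
have Phi_le z s t : Om z -> 0 <= s -> s <= t -> W (Phi s z) < c -> W (Phi t z) < c.
  move=> Oz s0 st Ws; have -> : t = (t - s) + s by rewrite subrK.
  have ts0 : 0 <= t - s by rewrite subr_ge0.
  rewrite (flowD lipb pinv ts0 s0 Oz) (le_lt_trans _ Ws)//.
  by apply: decay => //; exact: flow_in.
(* Orbits that get below [c]; once below, they stay there by [decay]. *)
pose B := [set z | Om z /\ exists2 t, 0 <= t & W (Phi t z) < c].
have oB : open B.
  rewrite openE => z [Oz [t t0 Wt]]; apply: filterI.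
    exact: (open_nbhs_nbhs (conj oOm Oz)).
  have /cvgr_lt/(_ _ Wt) := cPhi t z t0 Oz.
  by apply: filterS => y Wy; exists t.
(* A small ball around [z] is attracted uniformly: after a time [T] its orbits stay so close to the
   attractor that they cannot meet the level [c]. Near [z] they are above [c] at time [T] by
   continuity, and the intermediate value theorem keeps them above afterwards; before [T] they
   cannot be below, since they would still be below at [T]. *)
have oB' : open (Om `\` B).
  rewrite openE => z [Oz nBz].
  have Wz t : 0 <= t -> c <= W (Phi t z).
    by move=> t0; rewrite leNgt; apply/negP => Wt; apply: nBz; split => //; exists t.
  have [r r0 rD] := relatively_compact_ball oOm Oz.
  have [T1 T1P] := hdist_cvg0 dl0 (attrA _ rD).
  pose T := Order.max T1 0; have T0 : 0 <= T by rewrite le_max lexx orbT.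
  have late t y : T <= t -> ball z r y -> W (Phi t y) != c.
    move=> Tt zy; have T1t : T1 <= t by rewrite (le_trans _ Tt)// le_max lexx.
    have [|a Aa ya] := T1P t T1t (Phi t y); first by exists y.
    exact: Adl Aa ya.
  have WT : c < W (Phi T z).
    by rewrite lt_neqAle Wz// andbT eq_sym; apply: late; [exact: lexx|exact: ballxx].
  have /cvgr_gt/(_ _ WT) := cPhi T z T0 Oz => nWT.
  have nO := open_nbhs_nbhs (conj oOm Oz).
  near=> y.
  have Oy : Om y by near: y.
  have zy : ball z r y by near: y; exact: nbhsx_ballx.
  have Wy : c < W (Phi T y) by near: y.
  split => // -[_ [t t0 Wt]].
  have [tT|Tt] := leP t T.
    by have := Phi_le y t T Oy t0 tT Wt; rewrite ltNge (ltW Wy).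
  have [||u] := @IVT R (fun s => W (Phi s y)) T t c (ltW Tt).
  - apply: (@continuous_subspaceW _ _ _ `[0, t]).
      by move=> s /=; rewrite !in_itv/= => /andP[Ts ->]; rewrite (le_trans T0).
    move=> s; apply: continuous_comp; last exact: cW.
    exact: (flow_within_continuous lipb pinv t0 Oy).
  - by rewrite ge_min le_max (ltW Wt) (ltW Wy) orbT.
  rewrite in_itv/= => /andP[Tu _] Wu.
  by have := late u y Tu zy; rewrite Wu eqxx.
have BO : B = Om.
  apply: cOm.
  - by exists p; split; [exact: AO|exists 0 => //; rewrite (flow0 lipb pinv)//; exact: AO].
  - by exists B => //; apply/seteqP; split => [z [Oz]|z []].
  - exists (~` (Om `\` B)); first by apply: open_closedC.
    apply/seteqP; split => [z Bz|z [Oz nn]]; first by split; [case: Bz|case].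
    by apply: contrapT => nB; apply: nn.
have [m n z mn H Oz|z Az|n nP] := @compact_uniform_nat _ Att (fun n z => Om z -> W (Phi n%:R z) < c) cA.
- by apply: Phi_le (H Oz) => //; rewrite ler_nat.
- have Oz := AO z Az; have [_ [t t0 Wt]] : B z by rewrite BO.
  exists (Num.truncn t).+1.
  have W1 : W (Phi (Num.truncn t).+1%:R z) < c.
    by apply: Phi_le Wt => //; rewrite ltW// truncnS_gt.
  have /cvgr_lt/(_ _ W1) := cPhi (Num.truncn t).+1%:R z (ler0n _ _) Oz.
  by apply: filterS => y Wy _.
(* After one common time [n] the whole attractor is below [c], but invariance makes [q] an image at
   that time. *)
have [_ E] := invA n%:R (ler0n _ _).
have : (Phi n%:R @` Att) q by rewrite E.
move=> [a Aa aq]; have := nP a Aa (AO a Aa); rewrite aq ltNge (ltW Wq).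
by [].
Unshelve. all: by end_near. Qed.

End level_point.

Lemma lyapunov_of_not_chain_transitive {R : realType} {d : nat} (Om Att : set 'rV[R]_d)
    (b : 'rV[R]_d -> 'rV[R]_d) : open Om ->
  (forall z, Om z -> lipschitz_near b z) -> positively_invariant b Om ->
  connected Om -> maximal_attractor b Om Att -> ~ chain_transitive b Om Att ->
  exists (W : 'rV[R]_d -> R) (M : R) (K : set 'rV[R]_d) (x0 : 'rV[R]_d),
  [/\ 0 <= M /\ (forall x y, `|W x - W y| <= M * `|x - y|), (forall z, 0 <= W z <= 1),
      [/\ compact K, K `<=` Om & forall z, W z < 1 -> K z],
      (forall z s, W z < 1 -> 0 <= s -> W (flow b Om s z) <= expR (- s) * W z) &
      Att x0 /\ W x0 = 2^-1].
Proof.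
move=> oOm lipb pinv cOm attr nCT; apply: contrapT => nW; apply: nCT.
move=> x y Ax Ay eta T eta0 T0; apply: contrapT => nchain; apply: nW.
have [cA AO invA attrA] := attr.
have [r r0 rD] := relatively_compact_nbhd oOm cA AO.
set D := [set z | _] in rD.
have r20 : 0 < r / 2 by rewrite divr_gt0.
have [T1 T1P] := hdist_cvg0 r20 (attrA _ rD).
(* After time [T1] the neighbourhood [D] of radius [r] is within r/2 of the attractor, and jumps are
   shorter than r/2, so chains never leave [D]. Shrinking the jumps and lengthening the times keeps
   [y] unreachable. *)
pose T' := Order.max (Order.max T T1) 1; pose eta' := Order.min eta (r / 2).
have T'0 : 0 < T' by rewrite lt_max ltr01 orbT.
have eta'0 : 0 < eta' by rewrite lt_min eta0.
pose N := reach b Om x eta' T'.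
have Ny : ~ N y.
  move=> Ny; apply: nchain; apply: (reach_chain (AO _ Ax)).
  apply: reach_le Ny; first by rewrite ge_min lexx.
  by rewrite !le_max lexx.
have AD : Att `<=` D by move=> a Aa; exists a => //; rewrite subrr normr0.
have stepD z t w : D z -> T' <= t -> enorm (flow b Om t z - w) < eta' -> D w.
  move=> Dz Tt zw; have T1t : T1 <= t by rewrite (le_trans _ Tt)// !le_max lexx orbT.
  have [|a Aa za] := T1P t T1t (flow b Om t z); first by exists z.
  exists a => //; have := ler_normD (w - flow b Om t z) (flow b Om t z - a).
  rewrite addrA subrK => /le_lt_trans; apply; rewrite [r]splitr ltrD// distrC.
  by rewrite (le_lt_trans (norm_le_enorm _))// (lt_le_trans zw)// ge_min lexx orbT.
have ND : N `<=` D.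
  move=> w; elim=> [{}w t Tt xw|z {}w t _ Dz _ Tt zw]; last exact: stepD zw.
  by apply: (stepD x t) => //; exact: AD.
pose K := closure D; have [cK KO] : compact K /\ K `<=` Om by exact: rD.
have NK : N `<=` K by apply: subset_trans ND _; exact: subset_closure.
(* Passes from the Euclidean norm of the chains to the sup norm, using [enorm_le_norm]. *)
pose e2 := eta' / d.+1%:R; have e20 : 0 < e2 by rewrite divr_gt0.
have Nstep z w t : N z -> T' <= t -> `|flow b Om t z - w| < e2 -> N w.
  move=> Nz Tt zw; apply: (@reach_step _ _ _ _ _ _ _ z w t) => //; first exact/KO/NK.
  rewrite (le_lt_trans (enorm_le_norm _))//; move: zw; rewrite ltr_pdivlMr//.
  by apply: le_lt_trans; rewrite mulrC ler_wpM2l// ler_nat.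
have T'00 := ltW T'0.
have invT a : Att a -> Att (flow b Om T' a).
  by move=> Aa; have [_ <-] := invA T' T'00; exists a.
(* The image of [x] is reached by one exact link, so [N] is nonempty and meets the attractor. *)
pose n0 := flow b Om T' x.
have Nn0 : N n0.
  apply: (@reach_base _ _ _ _ _ _ _ _ T') => //; rewrite subrr.
  by rewrite (le_lt_trans (enorm_le_norm _))// normr0 mulr0.
pose W := lyap b Om N e2 T'.
have W01 z : 0 <= W z <= 1.
  by rewrite /W lyap_le1 andbT; exact: (@lyap_ge0 _ _ _ _ _ _ _ n0).
have [M [M0 lipW]] := lyap_lipschitz oOm lipb pinv e20 T'0 Nn0 cK NK KO Nstep.
have decay z s : W z < 1 -> 0 <= s -> W (flow b Om s z) <= expR (- s) * W z.
  exact: (@lyap_decay _ _ b Om lipb pinv N K e2 T' n0).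
have Wp : W (flow b Om T' n0) = 0.
  exact: (@lyap_late _ _ b Om lipb pinv N K e2 T' n0).
(* [W] is 0 at [flow b Om T' n0] and 1 at [y], both in the attractor, so the level 1/2 lies strictly
   between. *)
have Wy : W y = 1 by exact: lyap_notin.
have h1 : (2^-1 : R) < 1 by rewrite invf_lt1 ?ltr1n.
have [|||||x0 Ax0 Wx0] := @attractor_level R d b Om Att oOm lipb pinv cOm attr W M 2^-1 M0 lipW _
   (flow b Om T' n0) y.
- move=> z s Oz Wz s0; have Wz1 : W z < 1 by exact: lt_trans h1.
  rewrite (le_trans (decay z s Wz1 s0))// ler_piMl//; first by have /andP[] := W01 z.
  by rewrite -expR0 ler_expR oppr_le0.
- exact/invT/invT.
- exact: Ay.
- by rewrite Wp invr_gt0.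
- by rewrite Wy.
exists W, M, K, x0; split => //; split => // z Wz.
exact: NK (@lyap_lt1 _ _ b Om lipb pinv N K e2 T' n0 e20 Nn0 NK KO Nstep z Wz).
Qed.

(** * Test functions and the weak form of (EP) *)

Section Ck_calculus.
Context {R : realType} {d : nat}.
Local Notation V := 'rV[R]_d.
Implicit Types (Om : set V) (f g : V -> R) (k : nat).

Lemma Ck_continuous k Om f x : Ck k Om f -> Om x -> {for x, continuous f}.
Proof. by case: k => [|k] [cf _]; exact: cf. Qed.

Lemma Ck_derivable k Om f x i : Ck k.+1 Om f -> Om x -> derivable f x (delta_mx 0 i).
Proof. by move=> [_ pf] Ox; have [+ _] := pf i; apply. Qed.

Lemma Ck_partial k Om f i : Ck k.+1 Om f -> Ck k Om (partial i f).
Proof. by move=> [_ pf]; have [] := pf i. Qed.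

Lemma CkS k Om f : Ck k.+1 Om f -> Ck k Om f.
Proof.
elim: k f => [|k IH] f [cf pf]; first by split.
split => // i; have [df cdf] := pf i; split => //.
exact: IH.
Qed.

Lemma Ck_le k l Om f : (k <= l)%N -> Ck l Om f -> Ck k Om f.
Proof.
by move=> /subnK <-; elim: (l - k)%N => // n IH; rewrite addSn => /CkS.
Qed.

Lemma Ck_subset k Om Om' f : Om' `<=` Om -> Ck k Om f -> Ck k Om' f.
Proof.
move=> s; elim: k f => [|k IH] f [cf pf]; split => //; try by move=> x /s; exact: cf.
move=> i; have [df cdf] := pf i; split; first by move=> x /s; exact: df.
exact: IH.
Qed.

Lemma near_eq_Ck0 f g x : (\near x, f x = g x) -> {for x, continuous f} ->
  {for x, continuous g}.
Proof.
move=> fg cf; have E := nbhs_singleton fg.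
suff : g y @[y --> x] --> f x by rewrite E.
apply/(@cvgrPdist_le _ _ _ (nbhs x)) => e e0.
have H := (@cvgrPdist_le _ _ _ (nbhs x) _ _ _).1 cf e e0.
near=> y; have <- : f y = g y by near: y; exact: fg.
by near: y; exact: H.
Unshelve. all: by end_near.
Qed.

Lemma Ck_ext k Om f g : open Om -> (forall x, Om x -> f x = g x) ->
  Ck k Om f -> Ck k Om g.
Proof.
move=> oO; elim: k f g => [|k IH] f g fg [cf pf].
  split => // x Ox; apply: near_eq_Ck0 (cf _ Ox).
  by apply: filterS (open_nbhs_nbhs (conj oO Ox)) => y; exact: fg.
have nfg x : Om x -> \near x, f x = g x.
  by move=> Ox; apply: filterS (open_nbhs_nbhs (conj oO Ox)) => y; exact: fg.
split => [x Ox|i]; first exact: near_eq_Ck0 (nfg _ Ox) (cf _ Ox).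
have [df cdf] := pf i; split => [x Ox|].
  exact: (near_eq_derivable (nfg x Ox) (df x Ox)).
apply: (IH (partial i f)) => // x Ox; rewrite /partial.
exact: near_eq_derive (nfg x Ox).
Qed.

Lemma Ck_cst k Om (c : R) : Ck k Om (fun=> c).
Proof.
elim: k c => [|k IH] c; split => //; try by move=> x _; exact: cst_continuous.
move=> i; split; first by move=> x _; exact: derivable_cst.
rewrite (_ : partial i _ = fun=> 0); first exact: IH.
by apply/funext => x; rewrite /partial derive_cst.
Qed.

Lemma partialD i f g x : derivable f x (delta_mx 0 i) -> derivable g x (delta_mx 0 i) ->
  partial i (fun y => f y + g y) x = partial i f x + partial i g x.
Proof. by move=> df dg; rewrite /partial -deriveD. Qed.

Lemma partialM i f g x : derivable f x (delta_mx 0 i) -> derivable g x (delta_mx 0 i) ->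
  partial i (fun y => f y * g y) x = f x * partial i g x + partial i f x * g x.
Proof.
move=> df dg; rewrite /partial (_ : (fun y => f y * g y) = f * g)//.
by rewrite (deriveM df dg); congr (_ + _); exact: mulrC.
Qed.

Lemma CkD k Om f g : open Om -> Ck k Om f -> Ck k Om g -> Ck k Om (fun x => f x + g x).
Proof.
move=> oO; elim: k f g => [|k IH] f g [cf pf] [cg pg]; split => //;
  try by move=> x Ox; exact: (cvgD (cf x Ox) (cg x Ox)).
move=> i; have [df cdf] := pf i; have [dg cdg] := pg i; split => [x Ox|].
  exact: derivableD (df x Ox) (dg x Ox).
apply: (Ck_ext oO _ (IH _ _ cdf cdg)) => x Ox.
by rewrite partialD//; [exact: df|exact: dg].
Qed.

Lemma CkM k Om f g : open Om -> Ck k Om f -> Ck k Om g -> Ck k Om (fun x => f x * g x).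
Proof.
move=> oO; elim: k f g => [|k IH] f g Cf Cg.
  by split => // x Ox; exact: (cvgM (Ck_continuous Cf Ox) (Ck_continuous Cg Ox)).
split => [x Ox|i]; first exact: (cvgM (Ck_continuous Cf Ox) (Ck_continuous Cg Ox)).
split => [x Ox|]; first by apply: derivableM; [exact: Ck_derivable Cf Ox|exact: Ck_derivable Cg Ox].
have C1 := IH _ _ (CkS Cf) (Ck_partial i Cg).
have C2 := IH _ _ (Ck_partial i Cf) (CkS Cg).
apply: (Ck_ext oO _ (CkD oO C1 C2)) => x Ox.
by rewrite partialM//; [exact: Ck_derivable Cf Ox|exact: Ck_derivable Cg Ox].
Qed.

Lemma Ck_sum k Om n (f : 'I_n -> V -> R) : open Om -> (forall i, Ck k Om (f i)) ->
  Ck k Om (fun x => \sum_i f i x).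
Proof.
move=> oO Cf; elim: n f Cf => [|n IH] f Cf.
  by apply: (Ck_ext oO _ (Ck_cst k Om 0)) => x _; rewrite big_ord0.
apply: (Ck_ext oO _ (CkD oO (IH (fun i => f (lift ord0 i)) (fun i => Cf _)) (Cf ord0))) => x _.
by rewrite big_ord_recl addrC.
Qed.

Lemma Ck_coord k Om i : Ck k Om (fun x : V => x 0 i).
Proof.
have D x (j : 'I_d) : is_derive x (delta_mx 0 j : V) (fun x : V => x 0 i) ((delta_mx 0 j : V) 0 i).
  exact: is_derive_coord.
case: k => [|k]; split => //; try by move=> x _; exact: coord_continuous.
move=> j; split => [x _|]; first by have [] := D x j.
have -> : partial j (fun x : V => x 0 i) = fun=> (delta_mx 0 j : V) 0 i.
  by apply/funext => x; rewrite /partial; have [_ ->] := D x j.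
exact: Ck_cst.
Qed.

Lemma is_derive_of_line (V' : normedModType R) (f : V' -> R) (x v : V') (D : R) :
  is_derive (0 : R) (1 : R) (fun s => f (x + s *: v)) D -> is_derive x v f D.
Proof.
move=> [h1 h2].
have E : (fun h : R => h^-1 *: (((fun s => f (x + s *: v)) \o shift 0) (h *: 1) - f (x + 0 *: v))) =
  (fun h : R => h^-1 *: ((f \o shift x) (h *: v) - f x)).
  apply/funext => h /=; congr (_ *: (f _ - f _)); last by rewrite scale0r addr0.
  by rewrite [h *: 1]mulr1 addr0 addrC.
by split; [move: h1; rewrite /derivable E|move: h2; rewrite /derive E].
Qed.

(** Only a directional derivative of [g] is available, so the one-variable chain rule is applied
    along the line through [x]. *)
Lemma comp_is_derive (V' : normedModType R) (F : R -> R) (g : V' -> R) (x v : V') (dF dg : R) :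
  is_derive (g x) (1 : R) F dF -> is_derive x v g dg ->
  is_derive x v (fun y => F (g y)) (dF * dg).
Proof.
move=> dF1 [dg1 <-]; have hg : is_derive (0 : R) (1 : R) (fun s => g (x + s *: v)) ('D_v g x).
  by have := @line_is_derive R V' R g x v 0; rewrite scale0r addr0; apply.
have hF : is_derive ((fun s : R => g (x + s *: v)) 0) (1 : R) F dF.
  by rewrite scale0r addr0.
exact: is_derive_of_line (is_derive1_comp hF hg).
Qed.

(** [F] lists the successive derivatives of the outer function; the induction passes from [F] to the
    list shifted by one. Derivatives are demanded only at values of [g], which suits functions
    defined on a half-line. *)
Lemma Ck_comp k Om (F : nat -> R -> R) g : open Om ->
  (forall n x, Om x -> {for g x, continuous (F n)}) ->
  (forall n x, (n < k)%N -> Om x -> is_derive (g x) (1 : R) (F n) (F n.+1 (g x))) ->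
  Ck k Om g -> Ck k Om (fun x => F 0%N (g x)).
Proof.
move=> oO; elim: k F g => [|k IH] F g cF dF Cg.
  by split => // x Ox; apply: (continuous_comp (Ck_continuous Cg Ox)); exact: cF.
split => [x Ox|i]; first by apply: (continuous_comp (Ck_continuous Cg Ox)); exact: cF.
have D x : Om x -> is_derive x (delta_mx 0 i) (fun y => F 0%N (g y)) (F 1%N (g x) * partial i g x).
  move=> Ox; apply: comp_is_derive; first exact: dF.
  by apply: derivableP; exact: Ck_derivable Cg Ox.
split => [x /D[]//|].
have C1 : Ck k Om (fun x => F 1%N (g x)).
  by apply: (IH (fun n => F n.+1)) => [n x Ox|n x nk Ox|]; [exact: cF|exact: dF|exact: CkS].
apply: (Ck_ext oO _ (CkM oO C1 (Ck_partial i Cg))) => x Ox.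
by rewrite /partial; have [_ ->] := D x Ox.
Qed.

End Ck_calculus.

Opaque Ck.

Section positive_part_powers.
Context {R : realType}.

(** Only y = 0 is delicate: there the difference quotient is at most |h|^(k+1), which tends to 0
    because the power is at least 2. *)
Lemma is_derive_max0X (k : nat) (y : R) :
  is_derive y (1 : R) (fun x => Order.max x 0 ^+ k.+2) (k.+2%:R * Order.max y 0 ^+ k.+1).
Proof.
have [y0|y0|->] := ltgtP y 0.
- have E : \near y, (fun=> 0 : R) y = Order.max y 0 ^+ k.+2.
    near=> z; rewrite (max_r (_ : z <= 0)) ?expr0n//; apply: ltW.
    by near: z; exact: lt_nbhsl.
  rewrite expr0n mulr0.
  exact: (near_eq_is_derive E (is_derive_cst 0 y 1)).
- have E : \near y, y ^+ k.+2 = Order.max y 0 ^+ k.+2.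
    near=> z; rewrite (max_l (_ : 0 <= z))//; apply: ltW.
    by near: z; exact: lt_nbhsr.
  have H : is_derive y (1 : R) (fun x : R => x ^+ k.+2) (k.+2%:R * y ^+ k.+1).
    split; first exact: exprn_derivable.
    by rewrite exp_derive scaler_nat mulr_natl [_ *: 1]mulr1.
  exact: (near_eq_is_derive E H).
- rewrite expr0n mulr0.
  have C : (fun h : R => h^-1 *: (((fun x : R => Order.max x 0 ^+ k.+2) \o shift 0) (h *: 1) -
      Order.max 0 0 ^+ k.+2)) @ 0^' --> (0 : R).
    apply/cvgrPdist_le => e e0; near=> h.
    have h0 : h != 0 by near: h; exact: nbhs_dnbhs_neq.
    have he : `|h| <= Order.min e 1.
      by near: h; apply: dnbhs0_le; rewrite lt_min e0 ltr01.
    rewrite /= maxxx expr0n subr0 addr0 [h *: 1]mulr1 sub0r normrN normrZ normfV.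
    rewrite ler_pdivrMl ?normr_gt0// normrX.
    have m0 : `|Order.max h 0| <= `|h|.
      by case: (leP h 0) => _; rewrite ?normr0.
    rewrite exprS ler_pM// exprS.
    apply: (@le_trans _ _ (`|h| * 1)).
      apply: ler_pM => //; rewrite ?exprn_ge0// exprn_ile1//.
      by rewrite (le_trans m0)// (le_trans he)// ge_min lexx orbT.
    by rewrite mulr1 (le_trans he)// ge_min lexx.
  by split; [apply/cvg_ex; exists 0|exact: cvg_lim C].
Unshelve. all: by end_near. Qed.

(* [pos_cube 0] is of class C^2, with first two derivatives [pos_cube 1] and [pos_cube 2]. *)
Definition pos_cube (n : nat) (y : R) : R :=
  match n with
  | 0 => Order.max y 0 ^+ 3
  | 1 => 3 * Order.max y 0 ^+ 2
  | _ => 6 * Order.max y 0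
  end.

Lemma continuous_max0 : continuous (fun y : R => Order.max y 0).
Proof.
move=> y; apply: (@continuous_max _ _ (fun y : R => y) (fun=> 0 : R)).
  exact: cvg_id.
exact: cst_continuous.
Qed.

Lemma pos_cube_continuous n : continuous (pos_cube n).
Proof.
have c k : continuous (fun y : R => Order.max y 0 ^+ k).
  by move=> y; apply: (@continuous_comp _ _ _ (fun y : R => Order.max y 0) (fun y => y ^+ k));
    [exact: continuous_max0|exact: exprn_continuous].
case: n => [|[|n]] y; first exact: c.
  by apply: (@cvgM _ _ (nbhs y)); [exact: cvg_cst|exact: c].
by apply: (@cvgM _ _ (nbhs y)); [exact: cvg_cst|exact: continuous_max0].
Qed.

Lemma pos_cube_is_derive n y : (n < 2)%N ->
  is_derive y (1 : R) (pos_cube n) (pos_cube n.+1 y).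
Proof.
case: n => [|[|//]] _; first exact: is_derive_max0X.
have H := is_deriveZ 3 (is_derive_max0X 0 y).
have -> : pos_cube 2 y = 3 *: (2%:R * Order.max y 0 ^+ 1).
  by rewrite /pos_cube expr1 /GRing.scale/= mulrA -natrM.
exact: H.
Qed.

Lemma pos_cube0 n y : y <= 0 -> pos_cube n y = 0.
Proof. by move=> y0; case: n => [|[|n]] /=; rewrite max_r// ?expr0n ?mulr0. Qed.

Lemma pos_cube_ge0 n y : 0 <= pos_cube n y.
Proof.
have m0 : 0 <= Order.max y 0 by rewrite le_max lexx orbT.
by case: n => [|[|n]] /=; rewrite ?mulr_ge0 ?exprn_ge0.
Qed.

Lemma Ck_pos_cube {d} (Om : set 'rV[R]_d) (g : 'rV[R]_d -> R) k : (k <= 2)%N -> open Om ->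
  Ck k Om g -> Ck k Om (fun x => pos_cube 0 (g x)).
Proof.
move=> k2 oO; apply: Ck_comp => // n y; first by move=> _; exact: pos_cube_continuous.
by move=> nk _; apply: pos_cube_is_derive; exact: leq_trans nk k2.
Qed.

End positive_part_powers.

Section C1_directional.
Context {R : realType} {d : nat}.
Local Notation V := 'rV[R]_d.

(** Subtracting the linear part [L] at [x] leaves a function [g] whose partial derivatives are small
    near [x]. By [cube_lipschitz] its increments are of smaller order than the step, so only the
    derivative of [L] remains. *)
Lemma Ck1_is_derive (D : set V) (f : V -> R) x (v : V) : open D -> D x -> Ck 1 D f ->
  is_derive x v f (\sum_i v 0 i * partial i f x).
Proof.
move=> oD Dx Cf; pose L (y : V) := \sum_i partial i f x * y 0 i.
pose g (y : V) := f y + (- 1) * L y.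
have CL : Ck 1 D (fun y => (-1) * L y).
  exact: (CkM oD (Ck_cst 1 D (-1)) (Ck_sum oD (fun i => CkM oD (Ck_cst 1 D _) (Ck_coord 1 D i)))).
have Cg : Ck 1 D g := CkD oD Cf CL.
have dL (w : V) y : is_derive y w L (\sum_i partial i f x * w 0 i).
  apply: is_derive_sum_fun => i.
  have H := is_deriveZ (partial i f x) (is_derive_coord i (is_derive_id y w)).
  exact: H.
have pL i y : partial i L y = partial i f x.
  rewrite /partial; have [_ ->] := dL (delta_mx 0 i) y.
  rewrite (bigD1 i)//= big1 ?addr0; first by rewrite mxE !eqxx mulr1.
  by move=> j ji; rewrite mxE/= (negbTE ji) mulr0.
have pg i y : D y -> partial i g y = partial i f y - partial i f x.
  move=> Dy; rewrite /g partialD; first last.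
  - exact: Ck_derivable CL Dy.
  - exact: Ck_derivable Cf Dy.
  congr (_ + _); rewrite partialM; first last.
  - by have [] := dL (delta_mx 0 i) y.
  - exact: derivable_cst.
  by rewrite pL /partial derive_cst mul0r addr0 mulN1r.
have small e : 0 < e -> exists2 r : R, 0 < r & ball x r `<=` D /\
    forall y, ball x r y -> forall i, `|partial i g y| <= e.
  move=> e0; have : \forall y \near x, D y /\ forall i : 'I_d, `|partial i f x - partial i f y| <= e.
    apply: filterI; first exact: (open_nbhs_nbhs (conj oD Dx)).
    suff H (i : 'I_d) : nbhs x (fun y => `|partial i f x - partial i f y| <= e).
      exact: (@filter_forall _ _ (fun i y => `|partial i f x - partial i f y| <= e) _ _ H).
    have cp := Ck_continuous (Ck_partial i Cf) Dx.
    exact: (@cvgrPdist_le _ _ _ (nbhs x) _ _ _).1 cp e e0.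
  move=> /nbhs_ballP[r /= r0 rP]; exists r => //; split; first by move=> y /rP[].
  by move=> y /rP[Dy H] i; rewrite pg// distrC.
have C : (fun h : R => h^-1 *: ((f \o shift x) (h *: v) - f x)) @ 0^' --> \sum_i v 0 i * partial i f x.
  apply/cvgrPdist_le => e e0.
  pose e' := e / (d%:R * `|v| + 1).
  have dv : 0 <= d%:R * `|v| by rewrite mulr_ge0.
  have e'0 : 0 < e' by rewrite divr_gt0// ltr_wpDl.
  have [r r0 [rD rP]] := small e' e'0.
  near=> h; have h0 : h != 0 by near: h; exact: nbhs_dnbhs_neq.
  have hv : ball x r (h *: v + x).
    rewrite -ball_normE /= opprD addrCA subrr addr0 normrN normrZ.
    have : `|h| < r / (`|v| + 1) by near: h; apply: dnbhs0_lt; rewrite divr_gt0// ltr_wpDl.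
    rewrite ltr_pdivlMr ?ltr_wpDl// => /(le_lt_trans _); apply.
    by rewrite ler_wpM2l// lerDl.
  have Lh : L (h *: v + x) = h * (\sum_i v 0 i * partial i f x) + L x.
    rewrite /L mulr_sumr -big_split/=; apply: eq_bigr => i _.
    by rewrite !mxE mulrDr; congr (_ + _); rewrite mulrCA; congr (_ * _); rewrite mulrC.
  have Hg y : ball x r y -> forall i : 'I_d, derivable g y (delta_mx 0 i) /\ `|partial i g y| <= e'.
    by move=> xy i; split; [exact: Ck_derivable Cg (rD _ xy)|exact: rP].
  have H := cube_lipschitz (ltW e'0) Hg hv (ballxx x r0).
  have E : \sum_i v 0 i * partial i f x - h^-1 *: (f (h *: v + x) - f x) =
      - h^-1 * (g (h *: v + x) - g x).
    by rewrite /g Lh /GRing.scale/=; field.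
  rewrite /= E normrM normrN normfV ler_pdivrMl ?normr_gt0// (le_trans H)//.
  rewrite addrK normrZ /e'; have -> : d%:R * (e / (d%:R * `|v| + 1)) * (`|h| * `|v|) =
    `|h| * (e * ((d%:R * `|v|) / (d%:R * `|v| + 1))) by ring.
  rewrite ler_wpM2l// ger_pMr// ler_pdivrMr ?mul1r ?lerDl// ltr_wpDl//.
by split; [apply/cvg_ex; eexists; exact: C|exact: cvg_lim C].
Unshelve. all: by end_near. Qed.

End C1_directional.

Lemma Rintegral_is_derive {R : realType} d (T : measurableType d)
    (mu : {measure set T -> \bar R}) (B : set T) (f f' : R -> T -> R) (G : T -> R) (a u v : R) :
  measurable B -> u < a < v ->
  (forall s, u < s < v -> mu.-integrable B (EFin \o f s)) ->
  (forall s y, u < s < v -> B y -> is_derive s (1 : R) (f ^~ y) (f' s y)) ->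
  (forall y, 0 <= G y) -> mu.-integrable B (EFin \o G) ->
  (forall s y, u < s < v -> B y -> `|f' s y| <= G y) ->
  is_derive a (1 : R) (fun s => \int[mu]_(y in B) f s y) (\int[mu]_(y in B) f' a y).
Proof.
move=> mB auv intf df G0 intG fG.
have I s : `]u, v[%classic s <-> u < s < v by rewrite /= in_itv.
have E s y : u < s < v -> B y -> partial1of2 f s y = f' s y.
  by move=> suv By; rewrite partial1of2E; have [_ ->] := df s y suv By.
have H := @cvg_differentiation_under_integral R d T mu f B mB a u v (proj2 (I a) auv)
  (fun s Is => intf s (proj1 (I s) Is)) (fun s y Is By => let: DeriveDef h _ := df s y (proj1 (I s) Is) By in h)
  G G0 intG.
have {H} C : (fun h : R => h^-1 *: (((fun s => \int[mu]_(y in B) f s y) \o shift a) (h *: 1) -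
    \int[mu]_(y in B) f a y)) @ 0^' --> \int[mu]_(y in B) f' a y.
  have -> : \int[mu]_(y in B) f' a y = \int[mu]_(y in B) partial1of2 f a y.
    by apply: eq_Rintegral => y /[!inE] By; rewrite E.
  under eq_fun do rewrite /= [_ *: 1]mulr1.
  by apply: H => s y /I suv By; rewrite E// fG.
by split; [apply/cvg_ex; eexists; exact: C|exact: cvg_lim C].
Qed.

(** * Smoothing a Lipschitz function *)

Section mollification.
Context {R : realType} {d : nat}.
Local Notation V := 'rV[R]_d.
Local Notation mu := (lebesgue_tuple R d).
Implicit Types K : V -> R.

Lemma bounded_support_norm K : bounded_support K -> bounded_support (fun x => `|K x|).
Proof. by move=> [r rK]; exists r => x xr; rewrite rK// normr0. Qed.

Variables (Z : V -> R) (M : R).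
Hypotheses (M0 : 0 <= M) (lipZ : forall x y, `|Z x - Z y| <= M * `|x - y|).
Hypothesis Z01 : forall x, 0 <= Z x <= 1.

(** Written with [K (y - x)] so that all derivatives fall on the kernel, [Z] being only Lipschitz;
    each of them brings a minus sign. The form in [convE] moves [x] into [Z] instead and serves for
    comparisons. *)
Definition conv K (x : V) : R := intV (fun y => Z y * K (y - x)).

Let cZ : continuous Z.
Proof. by move=> z; apply: lipschitz_near_continuous; exists 1, M; split. Qed.

Let c1 K (a : V) : continuous K -> continuous (fun y : V => Z (y + a) * K y).
Proof.
move=> cK y; have h := @continuous_shiftr R d Z a cZ y; exact: (cvgM h (cK y)).
Qed.

Let s1 K (a : V) : bounded_support K -> bounded_support (fun y : V => Z (y + a) * K y).
Proof. by move=> [r rK]; exists r => y yr; rewrite rK// mulr0. Qed.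

Lemma convE K x : continuous K -> bounded_support K ->
  conv K x = intV (fun y => Z (y + x) * K y).
Proof.
move=> cK sK; rewrite -(@intV_shift R d _ (- x) (@c1 K x cK) (@s1 K x sK)).
by congr intV; apply/funext => y; rewrite subrK.
Qed.

Let cK0 (c : R) K : continuous K -> continuous (fun y => c * K y).
Proof. by move=> cK y; apply: (@cvgM _ _ (nbhs y)); [exact: cvg_cst|exact: cK]. Qed.

Let sK0 (c : R) K : bounded_support K -> bounded_support (fun y => c * K y).
Proof. by move=> [r rK]; exists r => y yr; rewrite rK// mulr0. Qed.

Lemma le_conv_shift K (c : R) x x' : continuous K -> bounded_support K -> (forall y, 0 <= K y) ->
  (forall y, K y != 0 -> Z (y + x) <= Z (y + x') + c) -> conv K x <= conv K x' + c * intV K.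
Proof.
move=> cK sK K0 H; rewrite !convE// -intVZ// -intVD//; try by [exact: c1|exact: s1|exact: cK0|exact: sK0].
apply: le_intV; try by [exact: c1|exact: s1].
- by move=> y; exact: (cvgD (@c1 K x' cK y) (@cK0 c K cK y)).
- by case: sK => r rK; exists r => y yr; rewrite rK// !mulr0 addr0.
- move=> y; have [->|Ky] := eqVneq (K y) 0; first by rewrite !mulr0 addr0.
  by rewrite -mulrDl ler_wpM2r// H.
Qed.

Lemma le_conv K (c : R) x : continuous K -> bounded_support K -> (forall y, 0 <= K y) ->
  (forall y, K y != 0 -> Z (y + x) <= c) -> conv K x <= c * intV K.
Proof.
move=> cK sK K0 H; rewrite convE// -intVZ//; apply: le_intV; try by [exact: c1|exact: s1|exact: cK0|exact: sK0].
move=> y; have [->|Ky] := eqVneq (K y) 0; first by rewrite !mulr0.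
by rewrite ler_wpM2r// H.
Qed.

Lemma ge_conv K (c : R) x : continuous K -> bounded_support K -> (forall y, 0 <= K y) ->
  (forall y, K y != 0 -> c <= Z (y + x)) -> c * intV K <= conv K x.
Proof.
move=> cK sK K0 H; rewrite convE// -intVZ//; apply: le_intV; try by [exact: c1|exact: s1|exact: cK0|exact: sK0].
move=> y; have [->|Ky] := eqVneq (K y) 0; first by rewrite !mulr0.
by rewrite ler_wpM2r// H.
Qed.

Lemma conv_continuous K : continuous K -> bounded_support K -> continuous (conv K).
Proof.
move=> cK sK x.
have cN : continuous (fun y => `|K y|).
  by move=> y; apply: (@cvg_norm _ _ _ (nbhs y)); exact: cK.
have sN := bounded_support_norm sK.
pose L := M * intV (fun y => `|K y|).
have I0 : 0 <= intV (fun y => `|K y|).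
  rewrite -(@intV0 R d); apply: le_intV => //; first by move=> y; exact: cst_continuous.
  by exists 0.
suff H x1 x2 : conv K x1 <= conv K x2 + L * `|x1 - x2|.
  apply: lipschitz_near_continuous; exists 1, L; split => //; first exact: mulr_ge0.
  move=> x1 x2 _ _; rewrite ler_norml; apply/andP; split; last first.
    by rewrite lerBlDl.
  by rewrite lerNl opprB lerBlDl distrC.
rewrite !convE// mulrAC -intVZ// -intVD//; try by [exact: c1|exact: s1|exact: cK0|exact: sK0].
apply: le_intV; try by [exact: c1|exact: s1].
- by move=> y; exact: (cvgD (@c1 K x2 cK y) (@cK0 (M * `|x1 - x2|) _ cN y)).
- by case: sK => r rK; exists r => y yr; rewrite rK// normr0 !mulr0 addr0.
move=> y; rewrite -lerBlDl -mulrBl (le_trans (ler_norm _))// normrM ler_wpM2r//.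
by rewrite (le_trans (lipZ _ _))// opprD addrACA subrr add0r.
Qed.

Lemma conv_is_derive K x (v : V) : continuous K -> bounded_support K ->
  (forall y, derivable K y v) -> continuous ('D_v K) ->
  is_derive x v (conv K) (- conv ('D_v K) x).
Proof.
move=> cK sK dK cdK; have sdK := bounded_support_derive v sK.
have [N [N0 NP]] := continuous_bounded_support_le cdK sdK.
have [r rK] := sdK.
(* Contains the supports of all translates by [x + s *: v] with |s| < 1, so a constant on [B]
   dominates the derivatives under the integral. *)
pose B := @tuple_rV R d @^-1` ball 0 (`|r| + `|v| + `|x| + 1).
have mB : measurable B by exact: measurable_ball_preimage.
pose f (s : R) (t : d.-tuple (measurableTypeR R)) := Z (tuple_rV t) * K (tuple_rV t - (x + s *: v)).
pose f' (s : R) (t : d.-tuple (measurableTypeR R)) := - (Z (tuple_rV t) * 'D_v K (tuple_rV t - (x + s *: v))).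
pose G (t : d.-tuple (measurableTypeR R)) := N * \1_B t.
have I0 : - 1 < (0 : R) < 1 by rewrite oppr_lt0 ltr01.
have intf (s : R) : - 1 < s < 1 -> mu.-integrable setT (EFin \o f s).
  move=> _; apply: (@integrable_continuous _ _ (fun y => Z y * K (y - (x + s *: v)))).
    move=> y; have h := @continuous_shiftr R d K (- (x + s *: v)) cK y.
    by apply: (@cvgM _ _ (nbhs y)); [exact: cZ|exact: h].
  have [r' hr'] := bounded_support_shiftr (- (x + s *: v)) sK.
  by exists r' => y /hr' ->; rewrite mulr0.
have df (s : R) t : - 1 < s < 1 -> setT t -> is_derive s (1 : R) (f ^~ t) (f' s t).
  move=> _ _; pose w := tuple_rV t - x.
  have E : (fun s => K (w + (- s) *: v)) = (fun s => K (tuple_rV t - (x + s *: v))).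
    by apply/funext => s'; rewrite scaleNr /w opprD addrA.
  have H : is_derive (- s) (1 : R) (fun s => K (w + s *: v)) ('D_v K (w + (- s) *: v)).
    exact: line_is_derive.
  have H2 : is_derive s (1 : R) (fun s : R => K (w + (- s) *: v)) ('D_v K (w + (- s) *: v) * (- 1)).
    have HN := is_deriveN (is_derive_id s (1 : R)).
    exact: (@comp_is_derive R R (fun s => K (w + s *: v)) (fun s : R => - s) s 1 _ _ H HN).
  rewrite E in H2; have H3 := is_deriveZ (Z (tuple_rV t)) H2.
  rewrite /f' -mulrN1 -mulrA (_ : tuple_rV t - (x + s *: v) = w + (- s) *: v); last first.
    by rewrite scaleNr /w opprD addrA.
  exact: H3.
have G0 t : 0 <= G t by rewrite mulr_ge0.
have intG : mu.-integrable setT (EFin \o G).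
  rewrite (_ : _ \o _ = (EFin \o cst N) \_ B); last first.
    apply/funext => t; rewrite /= /patch /G indicE.
    by case: ifP => _; rewrite ?mulr1 ?mulr0.
  apply: (iffLR (integrable_mkcond (mu := mu) (EFin \o cst N) mB)).
  apply: measurable_bounded_integrable => //; last exact: bounded_cst.
  suff: (lebesgue_tuple R d B < +oo)%E by [].
  by rewrite lebesgue_tuple_box ?ltry// ltr_wpDl// !addr_ge0.
have fG (s : R) t : - 1 < s < 1 -> setT t -> `|f' s t| <= G t.
  move=> /andP[s1' s2] _; rewrite /f' /G normrN normrM indicE.
  have Z1 : `|Z (tuple_rV t)| <= 1 by have /andP[a b] := Z01 (tuple_rV t); rewrite ger0_norm.
  have [_|/negP tB] := boolP (t \in B).
    by rewrite mulr1 -[N]mul1r ler_pM.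
  rewrite rK ?normr0 ?mulr0// leNgt; apply/negP => tr; apply: tB; rewrite inE; apply/ball0P.
  have := ler_normD (tuple_rV t - (x + s *: v)) (x + s *: v); rewrite subrK => /le_lt_trans-> //.
  rewrite -!addrA ltr_leD//; first by rewrite (lt_le_trans tr)// ler_norm.
  rewrite (le_trans (ler_normD _ _))// addrCA lerD2l ler_wpDr//.
  rewrite normrZ -{2}[`|v|]mul1r ler_wpM2r// ler_norml; apply/andP; split; exact: ltW.
have := Rintegral_is_derive measurableT I0 intf df G0 intG fG.
have -> : \int[mu]_y f' 0 y = - conv ('D_v K) x.
  rewrite /conv -mulN1r -intVZ.
  - by apply: eq_Rintegral => t _; rewrite /f' scale0r addr0 mulN1r.
  - move=> y; have h := @continuous_shiftr R d _ (- x) cdK y.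
    by apply: (@cvgM _ _ (nbhs y)); [exact: cZ|exact: h].
  - have [r' hr'] := bounded_support_shiftr (- x) sdK.
    by exists r' => y /hr' ->; rewrite mulr0.
exact: is_derive_of_line.
Qed.

Lemma conv_Ck n K : Ck n setT K -> bounded_support K -> Ck n setT (conv K).
Proof.
elim: n K => [|n IH] K CK sK.
  by split => // x _; apply: conv_continuous => // y; exact: Ck_continuous CK _.
have cK : continuous K by move=> y; exact: Ck_continuous CK _.
split => [x _|i]; first exact: conv_continuous.
have Cp := Ck_partial i CK.
have D x : is_derive x (delta_mx 0 i : V) (conv K) (- conv (partial i K) x).
  apply: conv_is_derive => //; first by move=> y; exact: Ck_derivable CK _.
  by move=> y; exact: Ck_continuous Cp _.
split => [x _|]; first by have [] := D x.
have C1 := IH _ Cp (bounded_support_derive _ sK).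
apply: (Ck_ext openT _ (CkM openT (Ck_cst n setT (- 1)) C1)) => x _.
by rewrite mulN1r /partial; have [_ ->] := D x.
Qed.

End mollification.

(** The mollification of the constant 1 is the constant [intV F]; its derivative is 0 on the one
    hand and minus the integral of the derivative of [F] on the other. *)
Lemma intV_derive {R : realType} {d : nat} (F : 'rV[R]_d -> R) (v : 'rV[R]_d) :
  continuous F -> bounded_support F ->
  (forall x, derivable F x v) -> continuous ('D_v F) -> intV ('D_v F) = 0.
Proof.
move=> cF sF dF cdF; pose Z (x : 'rV[R]_d) : R := 1.
have lipZ x y : `|Z x - Z y| <= 0 * `|x - y| by rewrite subrr normr0 mul0r.
have Z01 x : 0 <= Z x <= 1 by rewrite ler01 lexx.
have [_] := conv_is_derive (lexx 0) lipZ Z01 0 cF sF dF cdF.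
have -> : conv Z F = cst (intV F).
  apply/funext => x; rewrite (convE (lexx 0) lipZ)//.
  by congr intV; apply/funext => y; rewrite mul1r.
rewrite derive_cst => /esym/eqP; rewrite oppr_eq0 => /eqP <-.
by congr intV; apply/funext => y; rewrite mul1r subr0.
Qed.

Section weak_formulation.
Context {R : realType} {d : nat}.
Local Notation V := 'rV[R]_d.
Implicit Types (Om K : set V) (f g : V -> R) (k : nat).

Lemma Ck_setU k (D E : set V) f : Ck k D f -> Ck k E f -> Ck k (D `|` E) f.
Proof.
elim: k f => [|k IH] f [c1 p1] [c2 p2]; split => //;
  try by move=> x [/c1|/c2].
move=> i; have [d1 C1] := p1 i; have [d2 C2] := p2 i; split; first by move=> x [/d1|/d2].
exact: IH.
Qed.

Definition test_fun k K f := Ck k setT f /\ forall x, ~ K x -> f x = 0.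

Lemma near_off_compact K f x : compact K -> (forall y, ~ K y -> f y = 0) -> ~ K x ->
  \near x, f x = 0.
Proof.
move=> cK f0 Kx.
have oK : open (~` K) by apply: closed_openC; apply: compact_closed => //; exact: norm_hausdorff.
by apply: filterS (open_nbhs_nbhs (conj oK Kx)) => y; exact: f0.
Qed.

Lemma test_fun_partial k K f i : compact K -> test_fun k.+1 K f ->
  test_fun k K (partial i f).
Proof.
move=> cK [Cf f0]; split; first exact: Ck_partial.
move=> x Kx; rewrite /partial.
rewrite (@near_eq_derive _ _ _ f (cst 0)) ?derive_cst//.
exact: near_off_compact cK f0 Kx.
Qed.

Lemma test_funS k K f : test_fun k.+1 K f -> test_fun k K f.
Proof. by move=> [/CkS]. Qed.

(** [Om] and the complement of [K] are two open sets covering the space. On the first both factors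
    are smooth, on the second the product is 0 whatever values [g] takes there. *)
Lemma Ck_extend k Om K g f : open Om -> compact K -> K `<=` Om ->
  Ck k Om g -> test_fun k K f -> test_fun k K (fun x => g x * f x).
Proof.
move=> oO cK KO Cg [Cf f0]; split; last by move=> x Kx; rewrite f0// mulr0.
have oK : open (~` K) by apply: closed_openC; apply: compact_closed => //; exact: norm_hausdorff.
have C1 : Ck k Om (fun x => g x * f x).
  by apply: CkM => //; apply: (Ck_subset _ Cf).
have C2 : Ck k (~` K) (fun x => g x * f x).
  by apply: (Ck_ext oK _ (Ck_cst k _ 0)) => x Kx; rewrite f0// mulr0.
apply: Ck_subset (Ck_setU C1 C2) => x _.
by have [Kx|Kx] := pselect (K x); [left; exact: KO|right].
Qed.

Lemma compact_bounded_support K f : compact K -> (forall x, ~ K x -> f x = 0) ->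
  bounded_support f.
Proof.
move=> cK f0; have [M [_ KM]] := compact_bounded cK.
exists (`|M| + 2) => x xM; apply: f0 => Kx.
have := KM (`|M| + 1) _ x Kx; rewrite ltr_pwDr// ?ler_norm// => /(_ isT) xM1.
have := le_trans xM xM1; rewrite lerD2l; rewrite leNgt ltr1n//.
Qed.

Lemma test_fun_continuous k K f : test_fun k K f -> continuous f.
Proof. by move=> [Cf _] x; exact: Ck_continuous Cf _. Qed.

Lemma test_fun_support k K f : compact K -> test_fun k K f -> bounded_support f.
Proof. by move=> cK [_]; exact: compact_bounded_support. Qed.

(** The product of [g] and [f], zero off [K], is of class C^1 on the whole space, so the integral of
    its derivative vanishes and there is no boundary term. *)
Lemma intV_parts_on Om K g f i : open Om -> compact K -> K `<=` Om ->
  Ck 1 Om g -> test_fun 1 K f ->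
  intV (fun x => partial i g x * f x) = - intV (fun x => g x * partial i f x).
Proof.
move=> oO cK KO Cg tf.
have tp := test_fun_partial i cK tf.
have th := Ck_extend oO cK KO Cg tf.
have t1 : test_fun 0 K (fun x => partial i g x * f x).
  exact: (Ck_extend oO cK KO (Ck_partial i Cg) (test_funS tf)).
have t2 : test_fun 0 K (fun x => g x * partial i f x).
  exact: (Ck_extend oO cK KO (CkS Cg) tp).
apply/eqP; rewrite -addr_eq0 -intVD.
- apply/eqP; rewrite -(@intV_derive _ _ (fun x => g x * f x) (delta_mx 0 i)).
  + congr intV; apply/funext => x; rewrite -/(partial i _ x).
    have [Kx|Kx] := pselect (K x).
      rewrite partialM; first by rewrite addrC.
        exact: Ck_derivable Cg (KO _ Kx).
      by case: tf => Cf _; exact: Ck_derivable Cf _.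
    have [_ ->//] := t1; have [_ ->//] := t2.
    by have [_ ->//] := test_fun_partial i cK th; rewrite addr0.
  + exact: test_fun_continuous th.
  + exact: test_fun_support cK th.
  + by move=> x; case: th => Ch _; exact: Ck_derivable Ch _.
  + exact: test_fun_continuous (test_fun_partial i cK th).
- exact: test_fun_continuous t1.
- exact: test_fun_support cK t1.
- exact: test_fun_continuous t2.
- exact: test_fun_support cK t2.
Qed.

Lemma test_funD k K f g : test_fun k K f -> test_fun k K g -> test_fun k K (fun x => f x + g x).
Proof.
move=> [Cf f0] [Cg g0]; split; first exact: (CkD openT Cf Cg).
by move=> x Kx; rewrite f0// g0// addr0.
Qed.

Lemma test_fun_sum k K n (f : 'I_n -> V -> R) : (forall i, test_fun k K (f i)) ->
  test_fun k K (fun x => \sum_i f i x).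
Proof.
move=> tf; split; first by apply: (Ck_sum openT) => i; case: (tf i).
by move=> x Kx; rewrite big1// => i _; have [_ ->] := tf i.
Qed.

Lemma test_funZ k K (c : R) f : test_fun k K f -> test_fun k K (fun x => c * f x).
Proof.
move=> [Cf f0]; split; first exact: (CkM openT (Ck_cst k _ c) Cf).
by move=> x Kx; rewrite f0// mulr0.
Qed.

Lemma test_funM k K f g : Ck k setT g -> test_fun k K f -> test_fun k K (fun x => g x * f x).
Proof.
move=> Cg [Cf f0]; split; first exact: (CkM openT Cg Cf).
by move=> x Kx; rewrite f0// mulr0.
Qed.

Lemma intV_testD K f g : compact K -> test_fun 0 K f -> test_fun 0 K g ->
  intV (fun x => f x + g x) = intV f + intV g.
Proof.
move=> cK tf tg; apply: intVD; try by [exact: test_fun_continuous tf|exact: test_fun_continuous tg].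
- exact: test_fun_support cK tf.
- exact: test_fun_support cK tg.
Qed.

Lemma intV_testZ K (c : R) f : compact K -> test_fun 0 K f ->
  intV (fun x => c * f x) = c * intV f.
Proof. by move=> cK tf; rewrite intVZ//; [exact: test_fun_continuous tf|exact: test_fun_support cK tf]. Qed.

Lemma intV_test_sum K n (F : 'I_n -> V -> R) : compact K -> (forall i, test_fun 0 K (F i)) ->
  intV (fun x => \sum_i F i x) = \sum_i intV (F i).
Proof.
move=> cK; elim: n F => [|n IH] F tF.
  rewrite big_ord0 -[RHS](@intV0 R d); congr intV; apply/funext => x; exact: big_ord0.
rewrite big_ord_recl -IH// -(intV_testD cK (tF _) (test_fun_sum (fun i => tF _))).
by congr intV; apply/funext => x; rewrite big_ord_recl.
Qed.

(* The adjoint of the operator in (EP). *)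
Definition generator (A : V -> 'M[R]_d) (b : V -> V) (eps : R) f x : R :=
  eps ^+ 2 / 2 * (\sum_i \sum_j A x i j * partial j (partial i f) x)
  + \sum_i b x 0 i * partial i f x.

(** Two integrations by parts for the diffusion term and one for the drift move all derivatives to
    the compactly supported [f]. *)
Lemma weak_form (A : V -> 'M[R]_d) (b : V -> V) Om (eps : R) u (lam : R) K f :
  open Om -> Ck_mx 2 Om A -> Ck_rV 1 Om b -> EP_solution A b Om eps u lam ->
  compact K -> K `<=` Om -> test_fun 2 K f ->
  intV (fun x => u x * (generator A b eps f x + lam * f x)) = 0.
Proof.
move=> oO CA Cb [Cu EP u0 _ _] cK KO tf.
pose m i j x := u x * A x i j; pose w i x := u x * b x 0 i.
(* The components of the row-wise divergence of A u. *)
pose Q i x := \sum_j partial j (m i j) x.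
have Cm i j : Ck 2 Om (m i j) by exact: CkM oO Cu (CA i j).
have Cw i : Ck 1 Om (w i) by exact: CkM oO (CkS Cu) (Cb i).
have CQ i : Ck 1 Om (Q i) by exact: (Ck_sum oO (fun j => Ck_partial j (Cm i j))).
have tf1 := test_funS tf; have tf0 := test_funS tf1.
have tp i := test_fun_partial i cK tf.
have tpp i j := test_fun_partial j cK (tp i).
have EP' x : Om x -> eps ^+ 2 / 2 * \sum_i partial i (Q i) x - \sum_i partial i (w i) x = - lam * u x.
  move=> /EP <-; congr (_ * _ - _).
    apply: eq_bigr => i _; congr (partial i _ x); apply/funext => y.
    rewrite /Q mxE; apply: eq_bigr => j _; congr (partial j _ y).
    by apply/funext => z; rewrite !mxE.
  by apply: eq_bigr => i _; congr (partial i _ x); apply/funext => y; rewrite mxE.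
have ext g k t : Ck k Om g -> test_fun k K t -> test_fun k K (fun x => g x * t x).
  exact: Ck_extend.
have tm i j := ext _ _ _ (CkS (CkS (Cm i j))) (tpp i j).
have tw i := ext _ _ _ (CkS (Cw i)) (test_funS (tp i)).
have tQf i := ext _ _ _ (Ck_partial i (CQ i)) tf0.
have twf i := ext _ _ _ (Ck_partial i (Cw i)) tf0.
have tu := ext _ _ _ (CkS (CkS Cu)) tf0.
have t1 := test_fun_sum (fun i => test_fun_sum (tm i)); have t2 := test_fun_sum tw.
have s1 := test_fun_sum tQf; have s2 := test_fun_sum twf.
have e1 : intV (fun x => \sum_i partial i (Q i) x * f x) =
    intV (fun x => \sum_i \sum_j m i j x * partial j (partial i f) x).
  rewrite (intV_test_sum cK tQf) (intV_test_sum cK (fun i => test_fun_sum (tm i))).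
  apply: eq_bigr => i _; rewrite (intV_parts_on i oO cK KO (CQ i) tf1) (intV_test_sum cK (tm i)).
  have -> : (fun x => Q i x * partial i f x) = fun x => \sum_j partial j (m i j) x * partial i f x.
    by apply/funext => x; rewrite mulr_suml.
  rewrite (intV_test_sum cK (fun j => ext _ _ _ (CkS (Ck_partial j (Cm i j))) (test_funS (tp i)))).
  rewrite -sumrN; apply: eq_bigr => j _.
  by rewrite (intV_parts_on j oO cK KO (CkS (Cm i j)) (tp i)) opprK.
have e2 : intV (fun x => \sum_i w i x * partial i f x) =
    - intV (fun x => \sum_i partial i (w i) x * f x).
  rewrite (intV_test_sum cK twf) (intV_test_sum cK tw) -sumrN; apply: eq_bigr => i _.
  by rewrite (intV_parts_on i oO cK KO (Cw i) tf1) opprK.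
transitivity ((eps ^+ 2 / 2) * intV (fun x => \sum_i \sum_j m i j x * partial j (partial i f) x)
   + intV (fun x => \sum_i w i x * partial i f x) + lam * intV (fun x => u x * f x)).
  rewrite -(intV_testZ _ cK t1) -(intV_testZ _ cK tu) -(intV_testD cK (test_funZ _ t1) t2).
  rewrite -(intV_testD cK (test_funD (test_funZ _ t1) t2) (test_funZ _ tu)).
  congr intV; apply/funext => x; rewrite /generator !mulrDr; congr (_ + _ + _).
  - rewrite mulrCA; congr (_ * _); rewrite mulr_sumr; apply: eq_bigr => i _.
    by rewrite mulr_sumr; apply: eq_bigr => j _; rewrite mulrA.
  - by rewrite mulr_sumr; apply: eq_bigr => i _; rewrite mulrA.
  - by rewrite mulrCA.
rewrite -e1 e2 -mulN1r -(intV_testZ _ cK s1) -(intV_testZ _ cK s2) -(intV_testZ _ cK tu).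
rewrite -(intV_testD cK (test_funZ _ s1) (test_funZ _ s2)).
rewrite -(intV_testD cK (test_funD (test_funZ _ s1) (test_funZ _ s2)) (test_funZ _ tu)).
rewrite -[RHS](@intV0 R d); apply: (f_equal intV); apply/funext => x.
have [Kx|Kx] := pselect (K x); last first.
  case: tf => _ ->//; rewrite !mulr0 addr0.
  by rewrite !big1 ?mulr0 ?addr0// => i _; rewrite mulr0.
rewrite -!mulr_suml mulrA mulN1r -mulNr -mulrDl (EP' x (KO _ Kx)).
by rewrite !mulNr -mulrA addNr.
Qed.

End weak_formulation.

Section density_functional.
Context {R : realType} {d : nat}.
Local Notation V := 'rV[R]_d.
Local Notation mu := (lebesgue_tuple R d).
Local Notation toV := (@tuple_rV R d).
Local Notation pre D := (toV @^-1` D : set (d.-tuple (measurableTypeR R))).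
Variables (Om : set V) (u : V -> R).
Hypotheses (oOm : open Om) (cu : forall x, Om x -> {for x, continuous u}).
Hypothesis u0 : forall x, Om x -> 0 < u x.
Hypothesis u1 : integral_rV Om u = 1%E.
Implicit Types f g : V -> R.

(* Test functions bounded on [Om], so that integrability against [u] is automatic. *)
Definition admissible (f : V -> R) := (forall x, Om x -> {for x, continuous f}) /\
  exists M, forall x, Om x -> `|f x| <= M.

Definition expect f : R := \int[mu]_(t in toV @^-1` Om) (u (toV t) * f (toV t)).

Let mOm : measurable (pre Om).
Proof. exact: measurable_open_preimage. Qed.

Let intu : mu.-integrable (toV @^-1` Om) (EFin \o (u \o toV)).
Proof.
apply/integrableP; split.
  by apply/measurable_EFinP; exact: measurable_continuous_preimage.
have -> : (\int[mu]_(x in toV @^-1` Om) `|(EFin \o (u \o toV)) x|)%E = integral_rV Om u.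
  by apply: eq_integral => t /[!inE] /= Ot; rewrite ger0_norm// ltW// u0.
by rewrite u1 ltry.
Qed.

Lemma expect_integrable f : admissible f ->
  mu.-integrable (toV @^-1` Om) (EFin \o (fun t => u (toV t) * f (toV t))).
Proof.
move=> [cf [M MP]].
rewrite (_ : EFin \o _ = ((EFin \o (u \o toV)) \* (EFin \o (f \o toV)))%E); last first.
  by apply/funext => t; rewrite /= EFinM.
apply: (integrableMl mOm intu); first exact: measurable_continuous_preimage.
exists M; split; rewrite ?num_real// => M' MM' t Ot /=.
by rewrite (le_trans (MP _ Ot))// ltW.
Qed.

Lemma admissible_cst (k : R) : admissible (fun=> k).
Proof. by split => [x _|]; [exact: cst_continuous|exists `|k|]. Qed.

Lemma admissibleD f g : admissible f -> admissible g -> admissible (fun x => f x + g x).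
Proof.
move=> [cf [M MP]] [cg [N NP]]; split => [x Ox|]; first exact: (cvgD (cf x Ox) (cg x Ox)).
by exists (M + N) => x Ox; rewrite (le_trans (ler_normD _ _))// lerD// ?MP ?NP.
Qed.

Lemma admissibleM f g : admissible f -> admissible g -> admissible (fun x => f x * g x).
Proof.
move=> [cf [M MP]] [cg [N NP]]; split => [x Ox|]; first exact: (cvgM (cf x Ox) (cg x Ox)).
by exists (M * N) => x Ox; rewrite normrM ler_pM// ?MP ?NP.
Qed.

Lemma expectD f g : admissible f -> admissible g ->
  expect (fun x => f x + g x) = expect f + expect g.
Proof.
move=> af ag; rewrite /expect -RintegralD//; try exact: expect_integrable.
by apply: eq_Rintegral => t _; rewrite mulrDr.
Qed.

Lemma expectZ k f : admissible f -> expect (fun x => k * f x) = k * expect f.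
Proof.
move=> af; rewrite /expect -RintegralZl//; last exact: expect_integrable.
by apply: eq_Rintegral => t _; rewrite mulrCA.
Qed.

Lemma le_expect f g : admissible f -> admissible g -> (forall x, Om x -> f x <= g x) ->
  expect f <= expect g.
Proof.
move=> af ag fg; apply: le_Rintegral => //; try exact: expect_integrable.
by move=> t Ot; rewrite ler_wpM2l ?fg// ltW// u0.
Qed.

Lemma expect1 : expect (fun=> 1) = 1.
Proof.
have -> : expect (fun=> 1) = fine (integral_rV Om u).
  by congr fine; apply: eq_integral => t _; rewrite mulr1.
by rewrite u1.
Qed.

Lemma expect_cst k : expect (fun=> k) = k.
Proof.
have := expectZ k (admissible_cst 1); rewrite expect1 mulr1 => E.
by rewrite -[RHS]E; congr expect; apply/funext => x; rewrite mulr1.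
Qed.

(** A Chebyshev bound: the integrand is nonnegative on [Om] and at least [c] on [B]. *)
Lemma expect_ge_on f (B : set V) (c : R) : admissible f -> (forall x, Om x -> 0 <= f x) ->
  measurable (pre B) -> B `<=` Om -> (forall x, B x -> c <= u x * f x) -> 0 <= c ->
  (c%:E * mu (toV @^-1` B) <= (expect f)%:E)%E.
Proof.
move=> af f0 mB BO cB c0; have intf := expect_integrable af.
rewrite /expect /Rintegral fineK; last exact: integrable_fin_num intf.
apply: (@le_trans _ _ (\int[mu]_(t in toV @^-1` B) (u (toV t) * f (toV t))%:E)%E).
  rewrite -integral_cst//; apply: ge0_le_integral => //.
  - by have /integrableP[+ _] := integrableS mOm mB (fun t (Bt : pre B t) => BO _ Bt) intf.
  - by move=> t Bt; rewrite lee_fin cB.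
apply: ge0_subset_integral => //.
- by have /integrableP[+ _] := intf.
- by move=> t Ot; rewrite lee_fin mulr_ge0// ?f0// ltW// u0.
- by move=> t; exact: BO.
Qed.

Lemma expect_ge_box f z (r c : R) : admissible f -> (forall x, Om x -> 0 <= f x) ->
  0 < r -> ball z r `<=` Om -> 0 <= c -> (forall x, ball z r x -> c <= u x * f x) ->
  c * (2 * r) ^+ d <= expect f.
Proof.
move=> af f0 r0 zO c0 H; rewrite -lee_fin EFinM -(lebesgue_tuple_box z r0).
by apply: expect_ge_on => //; exact: measurable_ball_preimage.
Qed.

Lemma expect_ge_compact f K (c del : R) : admissible f -> (forall x, Om x -> 0 <= f x) ->
  compact K -> K `<=` Om -> 0 <= c -> (forall x, K x -> c <= f x) ->
  (del%:E <= integral_rV K u)%E -> c * del <= expect f.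
Proof.
move=> af f0 cK KO c0 H dK; have intf := expect_integrable af.
have mK : measurable (pre K).
  rewrite -[K]setCK preimage_setC; apply: measurableC.
  apply: (measurable_open_preimage (U := ~` K)).
  by apply: closed_openC; apply: compact_closed => //; exact: norm_hausdorff.
have KOt t : (toV @^-1` K) t -> (toV @^-1` Om) t by exact: KO.
have iK := integrableS mOm mK KOt intu.
rewrite -lee_fin /expect /Rintegral fineK; last exact: integrable_fin_num intf.
apply: (@le_trans _ _ (c%:E * integral_rV K u)%E).
  by rewrite EFinM lee_wpmul2l.
apply: (@le_trans _ _ (\int[mu]_(t in toV @^-1` K) (u (toV t) * f (toV t))%:E)%E).
  rewrite /integral_rV -integralZl//; apply: ge0_le_integral => //.
  - by move=> t Kt; rewrite -EFinM lee_fin mulr_ge0// ltW// u0//; exact: KO.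
  - by have /integrableP[+ _] := integrableZl mK c iK.
  - by have /integrableP[+ _] := integrableS mOm mK KOt intf.
  - move=> t Kt; rewrite -EFinM lee_fin mulrC ler_wpM2l ?H//.
    by rewrite ltW// u0//; exact: KO.
apply: ge0_subset_integral => //.
- by have /integrableP[+ _] := intf.
- by move=> t Ot; rewrite lee_fin mulr_ge0// ?f0// ltW// u0.
Qed.

Lemma expect_intV f : (forall x, ~ Om x -> f x = 0) -> expect f = intV (fun x => u x * f x).
Proof.
move=> f0; rewrite /expect Rintegral_mkcond; apply: eq_Rintegral => t _.
rewrite /patch; case: ifPn => // /negP nO; rewrite f0 ?mulr0// => Ot.
by apply: nO; rewrite inE.
Qed.

Lemma test_fun_admissible k K f : compact K -> test_fun k K f -> admissible f.
Proof.
move=> cK tf; have cf := test_fun_continuous tf; split; first by move=> x _; exact: cf.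
have [M [_ MP]] := continuous_bounded_support_le cf (test_fun_support cK tf).
by exists M.
Qed.

End density_functional.

(** * A smooth Lyapunov function *)

Section bump_function.
Context {R : realType} {d : nat}.
Local Notation V := 'rV[R]_d.
Local Notation mu := (lebesgue_tuple R d).

Lemma intV_ge_box (F : V -> R) z (r c : R) : continuous F -> bounded_support F ->
  (forall x, 0 <= F x) -> 0 < r -> 0 <= c -> (forall x, ball z r x -> c <= F x) ->
  c * (2 * r) ^+ d <= intV F.
Proof.
move=> cF sF F0 r0 c0 H; have intF := integrable_continuous cF sF.
pose B : set (d.-tuple (measurableTypeR R)) := @tuple_rV R d @^-1` ball z r.
have mB : measurable B by exact: measurable_ball_preimage.
have mF := measurable_continuous cF.
have -> : c * (2 * r) ^+ d = fine (c%:E * mu B)%E.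
  suff -> : mu B = ((2 * r) ^+ d)%:E by [].
  exact: lebesgue_tuple_box.
rewrite /intV /Rintegral fine_le//.
- suff -> : mu B = ((2 * r) ^+ d)%:E by [].
  exact: lebesgue_tuple_box.
- exact: integrable_fin_num intF.
apply: (@le_trans _ _ (\int[mu]_(t in B) (F (tuple_rV t))%:E)%E).
  rewrite -integral_cst//; apply: ge0_le_integral => //.
  - by apply/measurable_EFinP; exact: measurable_funS mF.
  - by move=> t Bt; rewrite lee_fin H.
apply: ge0_subset_integral => //.
- exact/measurable_EFinP.
- by move=> t _; rewrite lee_fin F0.
Qed.

(** The Euclidean square norm is polynomial, and the cubed positive part gives class C^2. The
    support lies in the sup-norm ball of radius h. *)
Definition bump (h : R) (x : V) : R := pos_cube 0 (h ^+ 2 - \sum_i x 0 i ^+ 2).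

Lemma bump_ge0 h x : 0 <= bump h x.
Proof. exact: pos_cube_ge0. Qed.

Lemma bump_neq0 h x : 0 < h -> bump h x != 0 -> `|x| < h.
Proof.
move=> h0 bx; apply: rV_norm_lt => // i.
rewrite ltNge; apply: contra bx => hi; apply/eqP/pos_cube0.
rewrite subr_le0 (@le_trans _ _ (x 0 i ^+ 2))//.
  by rewrite -[x 0 i ^+ 2]real_normK ?num_real// lerXn2r ?nnegrE// ltW.
rewrite (bigD1 i)//= lerDl.
by apply: sumr_ge0 => j _; exact: sqr_ge0.
Qed.

Lemma bump_support h : 0 < h -> bounded_support (bump h).
Proof.
move=> h0; exists h => x; apply: contraTeq => /(bump_neq0 h0).
by rewrite ltNge.
Qed.

Lemma bump_Ck h : Ck 2 setT (bump h).
Proof.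
apply: Ck_pos_cube => //; first exact: openT.
apply: (CkD openT (Ck_cst 2 _ _)).
have C := @Ck_sum R d 2 setT d (fun i x => x 0 i * x 0 i) openT
  (fun i => CkM openT (Ck_coord 2 _ i) (Ck_coord 2 _ i)).
apply: (Ck_ext openT _ (CkM openT (Ck_cst 2 _ (- 1)) C)) => x _.
by rewrite mulN1r; congr (- _); apply: eq_bigr => i _; rewrite expr2.
Qed.

Lemma bump_intV_gt0 h : 0 < h -> 0 < intV (bump h).
Proof.
move=> h0; pose r := h / (d%:R + 2).
have D0 : 0 < d%:R + 2 :> R by rewrite ltr_wpDl.
have r0 : 0 < r by rewrite divr_gt0.
have c0 : 0 < (h ^+ 2 / 2) ^+ 3 by rewrite exprn_gt0// divr_gt0// exprn_gt0.
apply: (@lt_le_trans _ _ ((h ^+ 2 / 2) ^+ 3 * (2 * r) ^+ d)).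
  by rewrite mulr_gt0// exprn_gt0// mulr_gt0.
apply: (@intV_ge_box _ 0) => //.
- by move=> x; exact: Ck_continuous (bump_Ck h) _.
- exact: bump_support.
- exact: bump_ge0.
- exact: ltW.
move=> x /ball0P xr; rewrite /bump /pos_cube lerXn2r ?nnegrE ?le_max ?lexx ?orbT//.
  by rewrite divr_ge0// sqr_ge0.
apply/orP; left; rewrite lerBrDr -lerBrDl.
have -> : h ^+ 2 - h ^+ 2 / 2 = h ^+ 2 / 2 by field.
apply: (@le_trans _ _ (\sum_(i < d) r ^+ 2)).
  apply: ler_sum => i _; rewrite -[x 0 i ^+ 2]real_normK ?num_real// lerXn2r ?nnegrE ?(ltW r0)//.
  by rewrite (le_trans (coord_norm_le x i))// ltW.
rewrite sumr_const card_ord (_ : r ^+ 2 *+ d = h ^+ 2 * (d%:R / (d%:R + 2) ^+ 2)); last first.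
  by rewrite /r expr_div_n -mulr_natl mulrCA.
rewrite ler_wpM2l ?sqr_ge0//.
rewrite ler_pdivrMr ?exprn_gt0//.
have d0 : 0 <= d%:R :> R by [].
nra.
Qed.

End bump_function.

Lemma is_derive_le {R : realType} {d : nat} (f : 'rV[R]_d -> R) (x v : 'rV[R]_d) (D c tau : R) :
  is_derive x v f D -> 0 < tau ->
  (forall s, 0 < s < tau -> f (x + s *: v) <= f x + s * c) -> D <= c.
Proof.
move=> [df <-] tau0 H; rewrite leNgt; apply/negP => cD.
have e0 : 0 < 'D_v f x - c by rewrite subr_gt0.
have Hn : \forall s \near dnbhs (0 : R), `|'D_v f x - s^-1 *: ((f \o shift x) (s *: v) - f x)| < 'D_v f x - c.
  exact: (@cvgrPdist_lt _ _ _ (dnbhs (0 : R)) _ _ _).1 df _ e0.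
have /nbhs_ballP[r /= r0 rP] : \forall s \near nbhs (0 : R), s != 0 ->
    `|'D_v f x - s^-1 *: ((f \o shift x) (s *: v) - f x)| < 'D_v f x - c by [].
have m0 : 0 < Order.min r tau by rewrite lt_min r0.
pose s := Order.min r tau / 2; have s0 : 0 < s by rewrite divr_gt0.
have sm : s < Order.min r tau by rewrite gtr_pMr// invf_lt1// ltr1n.
have : ball 0 r s.
  by rewrite -ball_normE /= sub0r normrN gtr0_norm// (lt_le_trans sm)// ge_min lexx.
move=> /rP/(_ (lt0r_neq0 s0)); rewrite -/('D_v f x) /= ltNge => /negP; apply.
have /H : 0 < s < tau by rewrite s0 (lt_le_trans sm)// ge_min lexx orbT.
rewrite addrC -lerBlDl => fs.
rewrite (le_trans _ (ler_norm _))// lerB// /GRing.scale/= ler_pdivrMl//.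
Qed.

Section mollify.
Context {R : realType} {d : nat}.
Local Notation V := 'rV[R]_d.
Variables (Z : V -> R) (M h : R).
Hypotheses (M0 : 0 <= M) (lipZ : forall x y, `|Z x - Z y| <= M * `|x - y|).
Hypotheses (Z01 : forall x, 0 <= Z x <= 1) (h0 : 0 < h).

Definition mollify (x : V) : R := (intV (@bump R d h))^-1 * conv Z (bump h) x.

Let cb : continuous (@bump R d h).
Proof. by move=> x; exact: Ck_continuous (bump_Ck h) _. Qed.

Let sb : bounded_support (@bump R d h) := bump_support h0.

Let I0 : 0 < intV (@bump R d h) := bump_intV_gt0 h0.

Lemma mollify_Ck : Ck 2 setT mollify.
Proof.
apply: (CkM openT (Ck_cst 2 _ _)).
exact: (conv_Ck M0 lipZ Z01 (bump_Ck h) sb).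
Qed.

Lemma mollify_le c x : (forall y, `|y| < h -> Z (y + x) <= c) -> mollify x <= c.
Proof.
move=> H; rewrite /mollify ler_pdivrMl// mulrC (le_conv M0 lipZ)//; first exact: bump_ge0.
by move=> y /(bump_neq0 h0); exact: H.
Qed.

Lemma mollify_ge c x : (forall y, `|y| < h -> c <= Z (y + x)) -> c <= mollify x.
Proof.
move=> H; rewrite /mollify ler_pdivlMl// mulrC (ge_conv M0 lipZ)//; first exact: bump_ge0.
by move=> y /(bump_neq0 h0); exact: H.
Qed.

Lemma mollify_shift c x x' : (forall y, `|y| < h -> Z (y + x) <= Z (y + x') + c) ->
  mollify x <= mollify x' + c.
Proof.
move=> H; rewrite /mollify ler_pdivrMl// mulrDr mulrA divff ?gt_eqF// mul1r.
rewrite [_ * c]mulrC (le_conv_shift M0 lipZ)//; first exact: bump_ge0.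
by move=> y /(bump_neq0 h0); exact: H.
Qed.

End mollify.

Lemma expRN_le {R : realType} (t : R) : 0 <= t <= 1 -> expR (- t) <= 1 - t / 2.
Proof.
move=> /andP[t0 t1]; rewrite expRN; apply: (@le_trans _ _ (1 + t)^-1).
  by rewrite lef_pV2 ?posrE ?expR_gt0 ?expR_ge1Dx// ltr_pwDl.
rewrite invf_ple ?posrE; last 2 first.
- by rewrite ltr_pwDl.
- by lra.
rewrite -[leLHS]mul1r ler_pdivrMr; last by lra.
by nra.
Qed.

(** The function 1 - W has compact support, so it is the one mollified, and S = 1 off a compact set.
    Averaging preserves the decay: at each translate y + x the constant vector b(x) replaces the
    orbit at a cost of a small multiple of s, since all the points involved are close to x. *)
Lemma smooth_lyapunov {R : realType} {d : nat} (Om : set 'rV[R]_d) (b : 'rV[R]_d -> 'rV[R]_d)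
    (W : 'rV[R]_d -> R) (M : R) (K : set 'rV[R]_d) (x0 : 'rV[R]_d) :
  open Om -> (forall z, Om z -> lipschitz_near b z) -> positively_invariant b Om ->
  0 <= M -> (forall x y, `|W x - W y| <= M * `|x - y|) -> (forall z, 0 <= W z <= 1) ->
  compact K -> K `<=` Om -> (forall z, W z < 1 -> K z) ->
  (forall z s, W z < 1 -> 0 <= s -> W (flow b Om s z) <= expR (- s) * W z) ->
  W x0 = 2^-1 ->
  exists (S : 'rV[R]_d -> R) (K' : set 'rV[R]_d),
  [/\ Ck 2 setT S, (forall x, 0 <= S x <= 1),
      [/\ compact K', K' `<=` Om & forall x, ~ K' x -> S x = 1],
      (forall x, 4^-1 <= S x <= 7 / 8 -> \sum_i b x 0 i * partial i S x <= - 16^-1) &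
      `|S x0 - 2^-1| <= 16^-1].
Proof.
move=> oOm lipb pinv M0 lipW W01 cK KO KW decW Wx0.
have [rho [Mb [rho0 Mb0 lipK]]] := compact_lipschitz cK (fun z Kz => lipb z (KO z Kz)).
have [r r0 rD] := relatively_compact_nbhd oOm cK KO.
set D := [set z | _] in rD; case: rD => cD DO.
(* [h1] keeps [W] within 1/32 on balls of radius [h], hence |S - W| <= 1/32; [h2] bounds by s/32 the
   cost of replacing orbits by straight lines. The other two entries of [h] keep points where [b]
   has Lipschitz constant [Mb] and keep the support of 1 - S in [closure D]. *)
pose h1 : R := (32 * (M + 1))^-1; pose h2 : R := (64 * (M * Mb + 1))^-1.
pose h : R := Order.min (Order.min h1 h2) (Order.min (rho / 3) r).
have MM0 : 0 <= M * Mb by exact: mulr_ge0.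
have h10 : 0 < h1 by rewrite invr_gt0 mulr_gt0// ltr_wpDl.
have h20 : 0 < h2 by rewrite invr_gt0 mulr_gt0// ltr_wpDl.
have h0 : 0 < h by rewrite !lt_min h10 h20 r0 divr_gt0.
have hh1 : h <= h1 by rewrite !ge_min lexx.
have hh2 : h <= h2 by rewrite !ge_min lexx orbT.
have hrho : h <= rho / 3 by rewrite !ge_min lexx !orbT.
have hr : h <= r by rewrite !ge_min lexx !orbT.
have Mh : M * h <= 32^-1.
  apply: (@le_trans _ _ ((M + 1) * h1)); first by apply: ler_pM => //; rewrite ?(ltW h0)// lerDl.
  by rewrite /h1 invfM mulrCA divff ?mulr1// gt_eqF// ltr_wpDl.
have MMh : M * (Mb * (2 * h)) <= 32^-1.
  have -> : M * (Mb * (2 * h)) = 2 * (M * Mb * h) by ring.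
  have : M * Mb * h <= (M * Mb + 1) * h2.
    by apply: ler_pM => //; rewrite ?(ltW h0)// lerDl.
  rewrite /h2 invfM mulrCA divff ?mulr1 ?gt_eqF ?ltr_wpDl// => H; lra.
pose Z x := 1 - W x; pose S (x : 'rV[R]_d) := 1 + (- 1) * mollify Z h x.
have lipZ x y : `|Z x - Z y| <= M * `|x - y|.
  have -> : Z x - Z y = - (W x - W y) by rewrite /Z; ring.
  by rewrite normrN.
have Z01 x : 0 <= Z x <= 1 by have := W01 x; rewrite /Z; lra.
have CS : Ck 2 setT S.
  apply: (CkD openT (Ck_cst 2 _ 1)); apply: (CkM openT (Ck_cst 2 _ (- 1))).
  exact: (mollify_Ck M0 lipZ Z01 h0).
have nearW x p : `|p - x| <= h -> `|W p - W x| <= 32^-1.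
  by move=> px; rewrite (le_trans (lipW _ _))// (le_trans _ Mh)// ler_wpM2l.
have SW x : `|S x - W x| <= 32^-1.
  have nW y : `|y| < h -> `|W (y + x) - W x| <= 32^-1.
    by move=> yh; apply: nearW; rewrite addrK ltW.
  have H1 : mollify Z h x <= 1 - W x + 32^-1.
    apply: (mollify_le M0 lipZ) => // y /nW; rewrite ler_norml /Z => /andP[? ?]; lra.
  have H2 : 1 - W x - 32^-1 <= mollify Z h x.
    apply: (mollify_ge M0 lipZ) => // y /nW; rewrite ler_norml /Z => /andP[? ?]; lra.
  by rewrite ler_norml /S; apply/andP; split; lra.
exists S, (closure D); split => //.
- move=> x; have H1 : mollify Z h x <= 1.
    by apply: (mollify_le M0 lipZ) => // y _; have /andP[] := Z01 (y + x).
  have H2 : 0 <= mollify Z h x.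
    by apply: (mollify_ge M0 lipZ) => // y _; have /andP[] := Z01 (y + x).
  by rewrite /S; lra.
- split => // x Dx; rewrite /S.
  have Z0 y : `|y| < h -> Z (y + x) = 0.
    move=> yh; have := W01 (y + x); rewrite /Z => /andP[_]; rewrite le_eqVlt => /orP[/eqP ->|W1].
      by rewrite subrr.
    exfalso; apply: Dx; apply: subset_closure; exists (y + x); first exact: KW.
    by rewrite opprD addrCA subrr addr0 normrN (lt_le_trans yh).
  have H1 : mollify Z h x <= 0 by apply: (mollify_le M0 lipZ) => // y /Z0 ->.
  have H2 : 0 <= mollify Z h x by apply: (mollify_ge M0 lipZ) => // y /Z0 ->.
  by lra.
- move=> x /andP[Sx1 Sx2].
  (* The margin 1/32 on both sides leaves 3/16 <= W <= 15/16 at all points within [h] of [x]. *)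
  have Wx : 3 / 16 + 32^-1 <= W x /\ W x <= 15 / 16 - 32^-1.
    have := SW x; rewrite ler_norml => /andP[]; clear - Sx1 Sx2 => ? ?; split; lra.
  have Kx : K x by apply: KW; case: Wx => _; clear => ?; lra.
  have [tau tau0 short] := flow_short oOm lipb pinv cK KO h0.
  have m0 : 0 < Order.min tau 1 by rewrite lt_min tau0 ltr01.
  have dS := Ck1_is_derive (b x) openT I (CkS CS).
  apply: (is_derive_le (dS x) m0) => s /andP[s0]; rewrite lt_min => /andP[stau s1].
  rewrite /S -addrA lerD2l !mulN1r lerNl opprD opprK mulrN opprK.
  rewrite -lerBrDr; apply: (mollify_shift M0 lipZ) => // y yh.
  have yW : `|W (y + x) - W x| <= 32^-1 by apply: nearW; rewrite addrK ltW.
  have Wp : 3 / 16 <= W (y + x) /\ W (y + x) < 1.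
    move: yW; rewrite ler_norml => /andP[]; clear - Wx; case: Wx => ? ? ? ?; split; lra.
  have Kp := KW _ Wp.2; have Op := KO _ Kp.
  have C0 : 0 <= Mb * (2 * h) by rewrite !mulr_ge0// ltW.
  (* The factor 2h: the translation [y] and the motion along the orbit each contribute less than or
     equal to h. *)
  have euler : `|(y + x) + s *: b x - flow b Om s (y + x)| <= Mb * (2 * h) * s.
    apply: (flow_euler lipb pinv Op (ltW s0) C0) => s' /andP[s'0 s's].
    have sh : `|flow b Om s' (y + x) - (y + x)| <= h.
      by apply: short => //; rewrite s'0 (le_trans s's)// ltW.
    have xs : `|x - flow b Om s' (y + x)| <= 2 * h.
      have -> : x - flow b Om s' (y + x) = - (flow b Om s' (y + x) - (y + x)) - y.
        by rewrite opprB addrAC [y + x]addrC addrK.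
      by rewrite (le_trans (ler_normB _ _))// normrN mulr_natl mulr2n lerD// ltW.
    rewrite (le_trans (lipK x Kx _ _ (ballxx _ rho0) _))//; last by rewrite ler_wpM2l.
    rewrite -ball_normE /= (le_lt_trans xs)//; move: hrho rho0; clear => ? ?; lra.
  have W1 := decW _ _ Wp.2 (ltW s0).
  have W2 := lipW ((y + x) + s *: b x) (flow b Om s (y + x)).
  have W3 : M * `|(y + x) + s *: b x - flow b Om s (y + x)| <= 32^-1 * s.
    apply: (@le_trans _ _ (M * (Mb * (2 * h) * s))); first by rewrite ler_wpM2l.
    by rewrite mulrA ler_wpM2r// ltW.
  have E1 : expR (- s) <= 1 - s / 2 by apply: expRN_le; rewrite !ltW.
  have W4 : expR (- s) * W (y + x) <= (1 - s / 2) * W (y + x) by rewrite ler_wpM2r//; move: Wp.1; clear => ?; lra.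
  have W5 : s * (3 / 16) <= s * W (y + x) by rewrite ler_wpM2l ?(ltW s0)//; exact: Wp.1.
  have W6 : W ((y + x) + s *: b x) - W (flow b Om s (y + x)) <= 32^-1 * s.
    exact: le_trans (ler_norm _) (le_trans W2 W3).
  (* The decay removes at least (s/2)(3/16) and the straightening adds at most s/32, which leaves a
     loss of s/16. *)
  rewrite /Z addrA; move: W1 W4 W5 W6; set w := W (y + x).
  set w1 := W (flow _ _ _ _); set w2 := W (_ + s *: _); clear => *.
  lra.
- by rewrite -Wx0 (le_trans (SW x0))// lef_pV2 ?posrE// ler_nat.
Qed.

(** * Mass near a level of the Lyapunov function *)

Section generator_theory.
Context {R : realType} {d : nat}.
Local Notation V := 'rV[R]_d.
Implicit Types (Om K : set V) (f g h : V -> R) (A : V -> 'M[R]_d) (b : V -> V).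

Lemma partial_comp (F F' : R -> R) h x i : is_derive (h x) (1 : R) F (F' (h x)) ->
  derivable h x (delta_mx 0 i) ->
  is_derive x (delta_mx 0 i) (fun y => F (h y)) (F' (h x) * partial i h x).
Proof. by move=> dF dh; apply: comp_is_derive => //; exact: derivableP. Qed.

Definition second_order A (f : V -> R) x : R := \sum_i \sum_j A x i j * partial j (partial i f) x.
Definition gradient_form A (f : V -> R) x : R := \sum_i \sum_j A x i j * (partial i f x * partial j f x).
Definition transport b (f : V -> R) x : R := \sum_i b x 0 i * partial i f x.

Lemma generatorE A b eps f x :
  generator A b eps f x = eps ^+ 2 / 2 * second_order A f x + transport b f x.
Proof. by []. Qed.

Section composition.
Variables (D : set V) (F F' F'' : R -> R) (h : V -> R).
Hypotheses (oD : open D) (Ch : Ck 2 D h).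
Hypothesis dF : forall x, D x -> is_derive (h x) (1 : R) F (F' (h x)).
Hypothesis dF' : forall x, D x -> is_derive (h x) (1 : R) F' (F'' (h x)).

Lemma partial_compE x i : D x -> partial i (fun y => F (h y)) x = F' (h x) * partial i h x.
Proof.
move=> Dx; have [_ ] := partial_comp (dF Dx) (Ck_derivable (i:=i) (CkS Ch) Dx).
exact.
Qed.

Lemma partial2_compE x i j : D x -> partial j (partial i (fun y => F (h y))) x =
  F'' (h x) * (partial i h x * partial j h x) + F' (h x) * partial j (partial i h) x.
Proof.
move=> Dx; transitivity (partial j (fun y => F' (h y) * partial i h y) x).
  apply: near_eq_derive.
  by apply: filterS (open_nbhs_nbhs (conj oD Dx)) => y Dy; exact: partial_compE.
have [d1 e1] := partial_comp (dF' Dx) (Ck_derivable (i:=j) (CkS Ch) Dx).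
have d2 := Ck_derivable (i:=j) (Ck_partial i Ch) Dx.
rewrite (partialM d1 d2) addrC [partial j (fun y => F' (h y)) x]e1.
by rewrite -mulrA [partial j h x * partial i h x]mulrC.
Qed.

Lemma second_order_comp A x : D x -> second_order A (fun y => F (h y)) x =
  F'' (h x) * gradient_form A h x + F' (h x) * second_order A h x.
Proof.
move=> Dx; rewrite /second_order /gradient_form !mulr_sumr -big_split/=; apply: eq_bigr => i _.
rewrite !mulr_sumr -big_split/=; apply: eq_bigr => j _.
by rewrite partial2_compE// mulrDr; congr (_ + _); exact: mulrCA.
Qed.

Lemma transport_comp b x : D x -> transport b (fun y => F (h y)) x = F' (h x) * transport b h x.
Proof.
move=> Dx; rewrite /transport mulr_sumr; apply: eq_bigr => i _.
by rewrite partial_compE// mulrCA.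
Qed.

End composition.

Section on_open.
Variables (Om K : set V) (A : V -> 'M[R]_d) (b : V -> V) (f : V -> R).
Hypotheses (oOm : open Om) (cK : compact K) (KO : K `<=` Om).
Hypotheses (CA : Ck_mx 0 Om A) (Cb : Ck_rV 0 Om b) (tf : test_fun 2 K f).

Let t1 i : test_fun 1 K (partial i f) := test_fun_partial i cK tf.

Lemma second_order_test_fun : test_fun 0 K (second_order A f).
Proof.
apply: test_fun_sum => i; apply: test_fun_sum => j.
exact: (Ck_extend oOm cK KO (CA i j) (test_fun_partial j cK (t1 i))).
Qed.

Lemma gradient_form_test_fun : test_fun 0 K (gradient_form A f).
Proof.
apply: test_fun_sum => i; apply: test_fun_sum => j.
apply: (Ck_extend oOm cK KO (CA i j)).
exact: (test_funM (CkS (t1 i).1) (test_funS (t1 j))).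
Qed.

Lemma transport_test_fun : test_fun 0 K (transport b f).
Proof.
apply: test_fun_sum => i.
exact: (Ck_extend oOm cK KO (Cb i) (test_funS (t1 i))).
Qed.

Lemma generator_test_fun eps : test_fun 0 K (generator A b eps f).
Proof.
apply: (test_funD (test_funZ (eps ^+ 2 / 2) second_order_test_fun) transport_test_fun).
Qed.

End on_open.

Lemma weak_expect A b Om (eps : R) u (lam : R) K f :
  open Om -> Ck_mx 2 Om A -> Ck_rV 1 Om b -> EP_solution A b Om eps u lam ->
  compact K -> K `<=` Om -> test_fun 2 K f ->
  expect Om u (generator A b eps f) = - lam * expect Om u f.
Proof.
move=> oO CA Cb sol cK KO tf; have [Cu _ u0 u1 _] := sol.
have cu x : Om x -> {for x, continuous u} by move=> Ox; exact: Ck_continuous Cu Ox.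
have CA0 : Ck_mx 0 Om A by move=> i j; exact: CkS (CkS (CA i j)).
have Cb0 : Ck_rV 0 Om b by move=> i; exact: CkS (Cb i).
have tL := generator_test_fun oO cK KO CA0 Cb0 tf eps.
have aL := test_fun_admissible Om cK tL; have af := test_fun_admissible Om cK tf.
have H := weak_form oO CA Cb sol cK KO tf.
have alf : admissible Om (fun x => lam * f x).
  exact: (test_fun_admissible Om cK (test_funZ lam tf)).
rewrite -(@expect_intV _ _ Om) in H; last first.
  by move=> x Ox; rewrite tL.2 ?tf.2 ?mulr0 ?addr0// => /KO.
have E1 := expectD oO cu u0 u1 aL alf.
have E2 := expectZ oO cu u0 u1 lam af.
by move: H; rewrite E1 E2 => /eqP; rewrite addr_eq0 => /eqP ->; rewrite mulNr.
Qed.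

End generator_theory.

Lemma test_fun_bounded {R : realType} {d : nat} k K (f : 'rV[R]_d -> R) :
  compact K -> test_fun k K f -> exists M : R, 0 <= M /\ forall x, `|f x| <= M.
Proof.
move=> cK tf; apply: continuous_bounded_support_le (test_fun_support cK tf).
exact: test_fun_continuous tf.
Qed.

(** One minus a truncated distance of slope 1/e is mollified at radius e/2, so it loses at most 1/2
    on [K]. *)
Lemma cutoff {R : realType} {d : nat} (Om K : set 'rV[R]_d) : open Om -> compact K -> K `<=` Om ->
  exists (f : 'rV[R]_d -> R) (K' : set 'rV[R]_d), [/\ compact K' /\ K' `<=` Om,
    test_fun 2 K' f, forall x, 0 <= f x & forall x, K x -> 2^-1 <= f x].
Proof.
move=> oOm cK KO; have [K0|/eqP/set0P K0] := pselect (K = set0).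
  exists (fun=> 0), set0; split => //; last by rewrite K0.
  - by split; [exact: compact0|].
  - by split; [exact: Ck_cst|].
have [r r0 [cD DO]] := relatively_compact_nbhd oOm cK KO.
set D := [set z | _] in cD DO.
pose e := r / 2; have e0 : 0 < e by rewrite divr_gt0.
pose Z x := 1 - trunc_dist K e x; pose h := e / 2; have h0 : 0 < h by rewrite divr_gt0.
have M0 : 0 <= e^-1 by rewrite invr_ge0 ltW.
have lipZ x y : `|Z x - Z y| <= e^-1 * `|x - y|.
  have -> : Z x - Z y = trunc_dist K e y - trunc_dist K e x by rewrite /Z; ring.
  have H1 := trunc_dist_lip e0 K0 x y; have H2 := trunc_dist_lip e0 K0 y x.
  rewrite distrC in H2; rewrite mulrC ler_norml.
  by apply/andP; split; [rewrite lerNl opprB lerBlDl|rewrite lerBlDl].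
have Z01 x : 0 <= Z x <= 1.
  by have := trunc_dist_ge0 e0 K0 x; have := trunc_dist_le1 K e x; rewrite /Z => ? ?; lra.
exists (mollify Z h), (closure D); split => //.
- split; first exact: (mollify_Ck M0 lipZ Z01 h0).
  have nearK x y : `|y| < h -> trunc_dist K e (y + x) < 1 -> D x.
    move=> yh /(trunc_dist_lt1 e0 K0)[p Kp pe]; exists p => //.
    have -> : x - p = (y + x - p) - y by rewrite addrAC [y + x]addrC addrK.
    rewrite (le_lt_trans (ler_normB _ _))// (@lt_le_trans _ _ (e + h)) ?ltrD//.
    by move: r0; rewrite /h /e; clear => ?; lra.
  move=> x Dx; have Z0 y : `|y| < h -> Z (y + x) = 0.
    move=> yh; apply/eqP; rewrite subr_eq0 eq_le trunc_dist_le1// andbT leNgt.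
    by apply/negP => /(nearK _ _ yh) ?; apply: Dx; exact: subset_closure.
  apply/eqP; rewrite eq_le; apply/andP; split.
    by apply: (mollify_le M0 lipZ) => // y /Z0 ->.
  by apply: (mollify_ge M0 lipZ) => // y /Z0 ->.
- by move=> x; apply: (mollify_ge M0 lipZ) => // y _; have /andP[] := Z01 (y + x).
- move=> x Kx; apply: (mollify_ge M0 lipZ) => // y yh.
  have := trunc_dist_lip e0 K0 (y + x) x; rewrite (trunc_dist0 e0 K0 Kx) add0r addrK => H.
  rewrite /Z lerBrDr -lerBrDl (le_trans H)// ler_pdivrMr// (le_trans (ltW yh))//.
  by rewrite le_eqVlt /h; apply/orP; left; apply/eqP; field.
Qed.

Section eigenvalue_bound.
Context {R : realType} {d : nat}.
Local Notation V := 'rV[R]_d.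
Variables (Om : set V) (A : V -> 'M[R]_d) (b : V -> V).
Hypotheses (oOm : open Om) (CA : Ck_mx 2 Om A) (Cb : Ck_rV 1 Om b).

Let CA0 : Ck_mx 0 Om A.
Proof. by move=> i j; exact: CkS (CkS (CA i j)). Qed.

Let Cb0 : Ck_rV 0 Om b.
Proof. by move=> i; exact: CkS (Cb i). Qed.

(** Test with a cut-off [f] that is at least 1/2 on [K]: its expectation is at least 1/4, while the
    expectation of its generator is at least -(M1 + M2) and equals -lam times that of [f]. Hence the
    factor 4. *)
Lemma eigenvalue_le K : compact K -> K `<=` Om -> exists C : R, 0 <= C /\
  forall (eps : R) u lam, 0 < eps <= 1 -> EP_solution A b Om eps u lam ->
    ((1 - 2^-1)%:E <= integral_rV K u)%E -> lam <= C.
Proof.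
move=> cK KO; have [f [K' [[cK' KO'] tf f0 fK]]] := cutoff oOm cK KO.
have [M2 [M20 M2P]] := test_fun_bounded cK' (second_order_test_fun oOm cK' KO' CA0 tf).
have [M1 [M10 M1P]] := test_fun_bounded cK' (transport_test_fun oOm cK' KO' Cb0 tf).
exists (4 * (M1 + M2)); split; first by rewrite mulr_ge0// addr_ge0.
move=> eps u lam /andP[e0 e1] sol mK; have [Cu _ u0 u1 l0] := sol.
have cu x : Om x -> {for x, continuous u} by move=> Ox; exact: Ck_continuous Cu Ox.
have E := weak_expect oOm CA Cb sol cK' KO' tf.
have tL := generator_test_fun oOm cK' KO' CA0 Cb0 tf eps.
have aL := test_fun_admissible Om cK' tL; have af := test_fun_admissible Om cK' tf.
have H1 : - (M1 + M2) <= expect Om u (generator A b eps f).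
  rewrite -(expect_cst oOm cu u0 u1 (- (M1 + M2))).
  apply: (le_expect oOm cu u0 u1 (admissible_cst Om _) aL) => x _; rewrite generatorE.
  have := M2P x; have := M1P x; rewrite !ler_norml => /andP[a1 _] /andP[a2 _].
  rewrite opprD addrC lerD//.
  have ee : eps ^+ 2 / 2 <= 1.
    by rewrite ler_pdivrMr// mul1r (le_trans (exprn_ile1 2 (ltW e0) e1))// ler1n.
  apply: (@le_trans _ _ (eps ^+ 2 / 2 * - M2)); last by rewrite ler_wpM2l// divr_ge0// sqr_ge0.
  by rewrite mulrN lerN2 -[leRHS]mul1r ler_wpM2r.
have H2 : 2^-1 * (1 - 2^-1) <= expect Om u f.
  apply: (expect_ge_compact oOm cu u0 u1 af _ cK KO) => //.
have : lam * 4^-1 <= M1 + M2.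
  apply: (@le_trans _ _ (lam * expect Om u f)).
    by rewrite ler_wpM2l// (le_trans _ H2)// le_eqVlt; apply/orP; left; apply/eqP; field.
  by move: H1; rewrite E mulNr lerN2.
by rewrite ler_pdivrMr// mulrC.
Qed.

End eigenvalue_bound.

Lemma quad_formE {R : realType} {d : nat} (M : 'M[R]_d) (v w : 'rV[R]_d) :
  (v *m M *m w^T) 0 0 = \sum_i \sum_j M i j * (v 0 i * w 0 j).
Proof.
rewrite mxE exchange_big/=; apply: eq_bigr => j _.
rewrite !mxE mulr_suml; apply: eq_bigr => i _.
by rewrite -mulrA mulrCA.
Qed.

Lemma gradient_form_ge0 {R : realType} {d : nat} (A : 'rV[R]_d -> 'M[R]_d) (f : 'rV[R]_d -> R) x :
  sym_posdef (A x) -> 0 <= gradient_form A f x.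
Proof.
move=> [_ pd]; pose v : 'rV[R]_d := \row_i partial i f x.
have <- : (v *m A x *m v^T) 0 0 = gradient_form A f x.
  by rewrite quad_formE; apply: eq_bigr => i _; apply: eq_bigr => j _; rewrite !mxE.
have [->|v0] := eqVneq v 0; first by rewrite mul0mx mul0mx mxE.
exact: ltW (pd v v0).
Qed.

Section exponential_barrier.
Context {R : realType}.
Implicit Types k y : R.

Let Y k y : R := expR (k * (y - 7 / 8)).

(* [barrier k 1] and [barrier k 2] are the first two derivatives of [barrier k 0]. *)
Definition barrier k (n : nat) y : R :=
  match n with
  | 0 => pos_cube 0 (1 - expR (k * (y - 7 / 8)))
  | 1 => pos_cube 1 (1 - expR (k * (y - 7 / 8))) * - (k * expR (k * (y - 7 / 8)))
  | _ => pos_cube 2 (1 - expR (k * (y - 7 / 8))) * (k * expR (k * (y - 7 / 8))) ^+ 2 +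
         pos_cube 1 (1 - expR (k * (y - 7 / 8))) * - (k ^+ 2 * expR (k * (y - 7 / 8)))
  end.

Let Y_is_derive k y : is_derive y (1 : R) (Y k) (k * Y k y).
Proof.
have H1 : is_derive y (1 : R) (fun y => k * (y - 7 / 8)) k.
  have H := is_deriveZ k (is_deriveB (is_derive_id y (1 : R)) (is_derive_cst (7 / 8 : R) y (1 : R))).
  by rewrite subr0 [_ *: 1]mulr1 in H.
have H2 := @comp_is_derive R R expR (fun y => k * (y - 7 / 8)) y 1 _ _ (is_derive_expR _) H1.
by rewrite mulrC; exact: H2.
Qed.

Let g_is_derive k y : is_derive y (1 : R) (fun y => 1 - Y k y) (- (k * Y k y)).
Proof.
have H := is_deriveB (is_derive_cst (1 : R) y (1 : R)) (Y_is_derive k y).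
by rewrite sub0r in H; exact: H.
Qed.

Let pc_is_derive n k y : (n < 2)%N -> is_derive y (1 : R) (fun y => pos_cube n (1 - Y k y))
  (pos_cube n.+1 (1 - Y k y) * - (k * Y k y)).
Proof.
move=> n2.
exact: (@comp_is_derive R R (pos_cube n) (fun y => 1 - Y k y) y 1 _ _ (pos_cube_is_derive _ n2) (g_is_derive k y)).
Qed.

Lemma barrier_is_derive k n y : (n < 2)%N ->
  is_derive y (1 : R) (barrier k n) (barrier k n.+1 y).
Proof.
case: n => [|[|//]] _; first exact: (@pc_is_derive 0).
have H1 := @pc_is_derive 1 k y isT.
have H2 := is_deriveZ (- k) (Y_is_derive k y).
have H := is_deriveM H1 H2.
have -> : barrier k 2 y = pos_cube 1 (1 - Y k y) *: (- k *: (k * Y k y)) +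
   (- k *: Y k y) *: (pos_cube 2 (1 - Y k y) * - (k * Y k y)).
  by rewrite /barrier /GRing.scale/= -/(Y k y); ring.
suff -> : barrier k 1 = (fun y => pos_cube 1 (1 - Y k y)) * (fun y => - k *: Y k y) by exact: H.
apply/funext => z; change (barrier k 1 z = pos_cube 1 (1 - Y k z) * (- k * Y k z)).
by rewrite mulNr.
Qed.

Lemma barrier_continuous k n : continuous (barrier k n).
Proof.
have cY : continuous (Y k) by move=> y; exact: is_derive_continuous (Y_is_derive k y).
have cg m : continuous (fun y => pos_cube m (1 - Y k y)).
  move=> y; apply: (@continuous_comp _ _ _ (fun y => 1 - Y k y)); last exact: pos_cube_continuous.
  exact: is_derive_continuous (g_is_derive k y).
have cZ (c : R) : continuous (fun y => c * Y k y).
  by move=> y; apply: (@cvgM _ _ (nbhs y)); [exact: cvg_cst|exact: cY].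
case: n => [|[|n]] y; first exact: cg.
  apply: (@cvgM _ _ (nbhs y)); first exact: cg.
  by apply: (@cvgN _ _ _ (nbhs y)); exact: cZ.
apply: (@cvgD _ _ _ (nbhs y)); apply: (@cvgM _ _ (nbhs y)); try exact: cg.
  by rewrite /=; apply: (@cvgM _ _ (nbhs y)); exact: cZ.
by apply: (@cvgN _ _ _ (nbhs y)); exact: cZ.
Qed.

(* [e], [Q], [P], [B] stand for eps^2/2, a(DS,DS), a:D^2S and b.DS. *)
Lemma barrier_generator_ge k (e Q P B C4 y m : R) : 4 <= k -> 0 <= e -> 0 <= Q ->
  (4^-1 <= y <= 7 / 8 -> e * k * Q + e * P + B <= - 32^-1) ->
  e * k * Q + e * P + B <= C4 -> 0 <= C4 ->
  0 <= m <= 1 -> (m != 0 -> 3 / 8 <= y <= 5 / 8) ->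
  3 / 128 * k * expR (k * (- (1 / 2))) * m - 3 * k * C4 * expR (k * (- (5 / 8))) <=
  e * (barrier k 2 y * Q + barrier k 1 y * P) + barrier k 1 y * B.
Proof.
move=> k4 e0 Q0 E1 E2 C40 /andP[m0 m1] my.
have k0 : 0 < k by lra.
have Y0 : 0 < Y k y := expR_gt0 _.
set E := e * k * Q + e * P + B in E1 E2.
pose t1 := pos_cube 1 (1 - Y k y); pose t2 := pos_cube 2 (1 - Y k y).
have t10 : 0 <= t1 := pos_cube_ge0 _ _.
have t20 : 0 <= t2 := pos_cube_ge0 _ _.
(* The term with [t2] is nonnegative and is dropped; what remains has the sign of -E. *)
have -> : e * (barrier k 2 y * Q + barrier k 1 y * P) + barrier k 1 y * B =
   e * t2 * (k * Y k y) ^+ 2 * Q - t1 * (k * Y k y) * E.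
  by rewrite /barrier -/(Y k y) -/t1 -/t2 /E; ring.
apply: (@le_trans _ _ (- (t1 * (k * Y k y) * E))); last first.
  rewrite lerDr; apply: mulr_ge0 => //; apply: mulr_ge0; last exact: sqr_ge0.
  exact: mulr_ge0.
have kY0 : 0 <= k * Y k y by rewrite mulr_ge0// ltW.
have tkY0 : 0 <= t1 * (k * Y k y) by rewrite mulr_ge0.
have err0 : 0 <= 3 * k * C4 * expR (k * (- (5 / 8))) by rewrite !mulr_ge0 ?expR_ge0// ltW.
(* From 7/8 on the positive part vanishes. *)
have [y78|y78] := leP (7 / 8) y.
  have -> : t1 = 0.
    rewrite /t1 pos_cube0// subr_le0 -expR0 ler_expR mulr_ge0 ?(ltW k0)//.
    by rewrite subr_ge0.
  have -> : m = 0 by apply/eqP; apply: contraT => /my /andP[_ y58]; lra.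
  by rewrite !mul0r oppr0 mulr0 sub0r oppr_le0.
(* Below 1/4 the sign of [E] is unknown, but the slope of the barrier is at most 3 k exp(-5k/8). *)
have [y14|y14] := ltP y 4^-1.
  have -> : m = 0 by apply/eqP; apply: contraT => /my /andP[y38 _]; lra.
  rewrite mulr0 sub0r lerN2.
  have YY : Y k y <= expR (k * (- (5 / 8))).
    by rewrite ler_expR ler_wpM2l ?(ltW k0)//; lra.
  have t13 : t1 <= 3.
    rewrite /t1 /pos_cube -[leRHS]mulr1 ler_wpM2l// exprn_ile1//; first by rewrite le_max lexx orbT.
    by rewrite ge_max ler01 andbT gerBl ltW.
  apply: (@le_trans _ _ (t1 * (k * Y k y) * C4)); first by rewrite ler_wpM2l.
  rewrite [leRHS](_ : _ = 3 * (k * expR (k * (- (5 / 8)))) * C4); last by ring.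
  rewrite ler_wpM2r// ler_pM// ler_wpM2l// ltW//.
have {}E1 : E <= - 32^-1 by apply: E1; rewrite y14 ltW.
apply: (@le_trans _ _ (t1 * (k * Y k y) * 32^-1)); last first.
  by rewrite -mulrN ler_wpM2l// lerNr.
apply: (@le_trans _ _ (3 / 128 * k * expR (k * (- (1 / 2))) * m)); first by rewrite gerBl.
have [->|mn0] := eqVneq m 0; first by rewrite mulr0 mulr_ge0.
have /andP[y38 y58] := my mn0.
have Y1 : expR (k * (- (1 / 2))) <= Y k y.
  by rewrite ler_expR ler_wpM2l ?(ltW k0)//; lra.
(* Here k >= 4 enters: for y <= 5/8 the exponent is at most -1. Then [t1] >= 3/4, and (3/4)(1/32) =
   3/128. *)
have Y2 : Y k y <= 2^-1.
  apply: (@le_trans _ _ (expR (- 1))).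
    rewrite ler_expR; nra.
  by rewrite expRN lef_pV2 ?posrE ?expR_gt0// (le_trans _ (expR_ge1Dx 1))//.
have t34 : 3 / 4 <= t1.
  rewrite /t1 /pos_cube (max_l (_ : 0 <= 1 - Y k y)); last by rewrite subr_ge0 (le_trans Y2)// invf_le1// ler1n.
  nra.
apply: (@le_trans _ _ (3 / 128 * (k * Y k y) * 1)).
  rewrite ler_pM//; first by rewrite !mulr_ge0 ?expR_ge0// ltW.
  by rewrite -mulrA ler_wpM2l// ler_wpM2l// ltW.
rewrite mulr1 [leRHS]mulrAC ler_wpM2r// .
by rewrite (le_trans _ (ler_wpM2r _ t34))// le_eqVlt; apply/orP; left; apply/eqP; field.
Qed.

End exponential_barrier.

Lemma second_order_addc {R : realType} {d : nat} (A : 'rV[R]_d -> 'M[R]_d) b (f : 'rV[R]_d -> R) (c : R) :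
  Ck 2 setT f ->
  [/\ second_order A (fun x => f x + c) = second_order A f,
      gradient_form A (fun x => f x + c) = gradient_form A f &
      transport b (fun x => f x + c) = transport b f].
Proof.
move=> Cf; have E i : partial i (fun x => f x + c) = partial i f.
  apply/funext => x; rewrite partialD.
  - by rewrite /partial derive_cst addr0.
  - exact: Ck_derivable (CkS Cf) I.
  - exact: derivable_cst.
split; apply/funext => x.
- by apply: eq_bigr => i _; apply: eq_bigr => j _; rewrite E.
- by apply: eq_bigr => i _; apply: eq_bigr => j _; rewrite !E.
- by apply: eq_bigr => i _; rewrite E.
Qed.

(** The barrier is nonnegative and lam >= 0, so its generator has nonpositive expectation.
    Integrating the pointwise lower bound leaves c1 E[m] <= c2, where c2/c1 is exponentially
    small. *)
Lemma expectation_near_level_le {R : realType} {d : nat} (Om K : set 'rV[R]_d)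
    (A : 'rV[R]_d -> 'M[R]_d) (b : 'rV[R]_d -> 'rV[R]_d) (S : 'rV[R]_d -> R) :
  open Om -> Ck_mx 2 Om A -> (forall x, Om x -> sym_posdef (A x)) -> Ck_rV 1 Om b ->
  Ck 2 setT S -> compact K -> K `<=` Om -> (forall x, ~ K x -> S x = 1) ->
  (forall x, 4^-1 <= S x <= 7 / 8 -> \sum_i b x 0 i * partial i S x <= - 16^-1) ->
  exists kappa C e1 : R, [/\ 0 < kappa, 0 <= C, 0 < e1 &
    forall (eps : R) u lam m, 0 < eps <= e1 -> EP_solution A b Om eps u lam ->
      admissible Om m -> (forall x, 0 <= m x <= 1) ->
      (forall x, m x != 0 -> 3 / 8 <= S x <= 5 / 8) ->
      expect Om u m <= C * expR (- (kappa / eps ^+ 2))].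
Proof.
move=> oOm CA pdA Cb CS cK KO SK bS.
have CA0 : Ck_mx 0 Om A by move=> i j; exact: CkS (CkS (CA i j)).
have Cb0 : Ck_rV 0 Om b by move=> i; exact: CkS (Cb i).
(* S - 1 has compact support and the same derivatives as S, so the coefficients built from S are
   bounded. *)
have tS : test_fun 2 K (fun x => S x + (- 1)).
  split; first exact: (CkD openT CS (Ck_cst 2 _ _)).
  by move=> x /SK ->; rewrite subrr.
have [ES2 ESg ESt] := second_order_addc A b (- 1) CS.
have [C1 [C10 C1P]] := test_fun_bounded cK (second_order_test_fun oOm cK KO CA0 tS).
have [C2 [C20 C2P]] := test_fun_bounded cK (gradient_form_test_fun oOm cK KO CA0 tS).
have [C3 [C30 C3P]] := test_fun_bounded cK (transport_test_fun oOm cK KO Cb0 tS).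
rewrite ES2 in C1P; rewrite ESg in C2P; rewrite ESt in C3P.
clear ES2 ESg ESt tS.
(* [kap] makes e k a(DS,DS) <= 1/64, with e = eps^2/2. The entries of [e1] give eps^2 <= eps, e
   a:D^2S <= 1/64, and k >= 4. Together with the drift -1/16 this leaves at most -1/32. *)
pose kap : R := (32 * (C2 + 1))^-1; pose C4 := C3 + 1.
have kap0 : 0 < kap by rewrite invr_gt0 mulr_gt0// ltr_wpDl.
pose e1 : R := Order.min (Order.min 1 (32 * (C1 + 1))^-1) (kap / 4).
have e10 : 0 < e1 by rewrite !lt_min ltr01 divr_gt0// invr_gt0 mulr_gt0// ltr_wpDl.
(* The rate is 5/8 - 1/2 = 1/8 of k, and 128 is the quotient of 3 by 3/128. *)
exists (kap / 8), (128 * C4), e1; split; [by rewrite divr_gt0|by rewrite mulr_ge0// addr_ge0|by []|].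
move=> eps u lam m /andP[eps0]; rewrite !le_min => /andP[/andP[eps1 epsC1] epsk] sol am m01 mS.
have [Cu _ u0 u1 l0] := sol.
have cu x : Om x -> {for x, continuous u} by move=> Ox; exact: Ck_continuous Cu Ox.
have e20 : 0 < eps ^+ 2 by rewrite exprn_gt0.
have e2e : eps ^+ 2 <= eps by rewrite expr2 ger_pMl.
pose k := kap / eps ^+ 2.
have k4 : 4 <= k.
  rewrite /k ler_pdivlMr// mulrC -ler_pdivlMr//; exact: le_trans e2e epsk.
pose f x := barrier k 0 (S x).
have Cf : Ck 2 setT f.
  apply: (@Ck_comp _ _ 2 setT (barrier k) S openT) => //.
    by move=> n y _; exact: barrier_continuous.
  by move=> n y n2 _; exact: barrier_is_derive.
have tf : test_fun 2 K f.
  split=> // x /SK Sx; rewrite /f Sx /barrier pos_cube0// subr_le0 -[leLHS]expR0 ler_expR.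
  rewrite mulr_ge0// ?(le_trans _ k4)//.
  by rewrite subr_ge0 ler_pdivrMr// mul1r ler_nat.
have Lf x : generator A b eps f x = eps ^+ 2 / 2 * (barrier k 2 (S x) * gradient_form A S x +
    barrier k 1 (S x) * second_order A S x) + barrier k 1 (S x) * transport b S x.
  have D0 z : [set: 'rV[R]_d] z -> is_derive (S z) (1 : R) (barrier k 0) (barrier k 1 (S z)).
    by move=> _; exact: barrier_is_derive.
  have D1 z : [set: 'rV[R]_d] z -> is_derive (S z) (1 : R) (barrier k 1) (barrier k 2 (S z)).
    by move=> _; exact: barrier_is_derive.
  rewrite generatorE /f (second_order_comp openT CS D0 D1 A I).
  by rewrite (transport_comp CS D0 b I).
have ek : eps ^+ 2 / 2 * k = kap / 2 by rewrite /k; field; rewrite gt_eqF.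
have EQ x : Om x -> eps ^+ 2 / 2 * k * gradient_form A S x <= 64^-1.
  move=> Ox; rewrite ek; apply: (@le_trans _ _ (kap / 2 * (C2 + 1))).
    rewrite ler_wpM2l ?divr_ge0 ?(ltW kap0)//.
    by rewrite (le_trans (ler_norm _))// (le_trans (C2P x))// lerDl.
  rewrite /kap le_eqVlt; apply/orP; left; apply/eqP; field.
  by rewrite gt_eqF// ltr_wpDl.
have EP x : eps ^+ 2 / 2 * second_order A S x <= 64^-1.
  apply: (@le_trans _ _ ((32 * (C1 + 1))^-1 / 2 * (C1 + 1))).
    apply: (@le_trans _ _ (eps ^+ 2 / 2 * (C1 + 1))).
      rewrite ler_wpM2l ?divr_ge0 ?(ltW e20)//.
      by rewrite (le_trans (ler_norm _))// (le_trans (C1P x))// lerDl.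
    rewrite ler_wpM2r ?addr_ge0// ler_wpM2r// (le_trans e2e)//.
  rewrite le_eqVlt; apply/orP; left; apply/eqP; field.
  by rewrite gt_eqF// ltr_wpDl.
have low x : Om x -> 3 / 128 * k * expR (k * (- (1 / 2))) * m x
    + (- (3 * k * C4 * expR (k * (- (5 / 8))))) <= generator A b eps f x.
  move=> Ox; rewrite Lf; apply: barrier_generator_ge => //.
  - by rewrite divr_ge0// ltW.
  - exact: gradient_form_ge0 (pdA x Ox).
  - move=> /bS; rewrite -/(transport b S x) => Bx.
    have := EQ x Ox; have := EP x; move: Bx; clear.
    move: (transport b S x) (eps ^+ 2 / 2 * k * gradient_form A S x)
      (eps ^+ 2 / 2 * second_order A S x) => p q r *; lra.
  - have := EQ x Ox; have := EP x; have := le_trans (ler_norm _) (C3P x); rewrite /C4; clear.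
    move: (transport b S x) (eps ^+ 2 / 2 * k * gradient_form A S x)
      (eps ^+ 2 / 2 * second_order A S x) => p q r *; lra.
  - by rewrite addr_ge0.
  - exact: mS.
have tL := generator_test_fun oOm cK KO CA0 Cb0 tf eps.
have aL := test_fun_admissible Om cK tL; have af := test_fun_admissible Om cK tf.
(* The only place in this estimate where the sign of the eigenvalue enters. *)
have EL : expect Om u (generator A b eps f) <= 0.
  rewrite (weak_expect oOm CA Cb sol cK KO tf) mulNr oppr_le0 mulr_ge0//.
  have H := le_expect oOm cu u0 u1 (admissible_cst Om 0) af (fun y _ => pos_cube_ge0 0 _).
  by rewrite (expect_cst oOm cu u0 u1) in H.
pose c1 := 3 / 128 * k * expR (k * (- (1 / 2))); pose c2 := 3 * k * C4 * expR (k * (- (5 / 8))).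
have acm : admissible Om (fun x => c1 * m x) := admissibleM (admissible_cst Om c1) am.
have E1 := le_expect oOm cu u0 u1 (admissibleD acm (admissible_cst Om (- c2))) aL low.
rewrite (expectD oOm cu u0 u1 acm (admissible_cst Om (- c2))) in E1.
rewrite (expectZ oOm cu u0 u1 c1 am) (expect_cst oOm cu u0 u1) in E1.
have {}E1 : c1 * expect Om u m <= c2 by rewrite -subr_le0 (le_trans E1 EL).
have k0 : 0 < k by rewrite (lt_le_trans _ k4).
have c10 : 0 < c1 by rewrite mulr_gt0 ?expR_gt0// mulr_gt0// divr_gt0.
rewrite -(ler_pM2l c10) (le_trans E1)//.
have -> : - (kap / 8 / eps ^+ 2) = k * (- (5 / 8)) - k * (- (1 / 2)) by rewrite /k; field; rewrite gt_eqF.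
rewrite expRD expRN /c1 /c2 le_eqVlt; apply/orP; left; apply/eqP.
by field; rewrite gt_eqF// expR_gt0.
Qed.

(** * The density is bounded by its local mass *)

Lemma is_derive_exprVn {R : realType} (m : nat) (z : R) : z != 0 ->
  is_derive z (1 : R) (fun z : R => z ^- m) (- m%:R * z ^- m.+1).
Proof.
move=> z0; have H : is_derive z (1 : R) (fun z : R => z ^+ m) (m%:R * z ^+ m.-1).
  split; first exact: exprn_derivable.
  by rewrite exp_derive [_ *: 1]mulr1.
have zm0 : z ^+ m != 0 by rewrite expf_neq0.
have [H1 H2] := H.
split; first exact: derivableV.
rewrite deriveV// H2 /GRing.scale/=.
case: m zm0 {H H1 H2} => [|m] zm0; first by rewrite mul0r mulr0 oppr0 mul0r.
rewrite mulNr mulNr; congr (- _); rewrite mulrCA; congr (_ * _).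
have z1 : z ^+ m != 0 by rewrite expf_neq0.
by rewrite /= !exprSr; move: (z ^+ m) z1 => X X0; field; rewrite z0 X0.
Qed.

Section approximate_kernel.
Context {R : realType}.
Variables (d : nat) (c : R).
Hypothesis c0 : 0 < c.
Implicit Types s y : R.

(* Let q(x) = (x - x0) A(x0)^-1 (x - x0)^T. Then x |-> kern s (q x) is concentrated at distance
   s^2 from x0 with mass of order 1, and A(x0):D^2 pot s (q x) = d s (d/ds) kern s (q x).
   Hence (EP), tested with a cut-off of [pot s], controls the s-derivative of the average of u
   against [kern s]. *)
Definition kern s y : R := s ^+ (d.*2 + 4) * (s ^+ 4 + y) ^- d.+1.
Definition pot s y : R := s ^+ (d.*2 + 4) * (s ^+ 4 + y) ^- d.

(* The n-th derivative of [y |-> pos_cube 0 (1 - c * y)]. *)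
Definition cut (n : nat) y : R := (- c) ^+ n * pos_cube n (1 - c * y).

(** The product of cut-off and [pot] with its first two derivatives in y, expanded by means of pot'
    = -d kern and kern' = -(d+1) kern / (s^4 + y). *)
Definition cut_pot s (n : nat) y : R :=
  match n with
  | 0 => cut 0 y * pot s y
  | 1 => cut 1 y * pot s y - d%:R * (cut 0 y * kern s y)
  | _ => cut 2 y * pot s y - 2 * d%:R * (cut 1 y * kern s y)
         + d%:R * d.+1%:R * (cut 0 y * (kern s y / (s ^+ 4 + y)))
  end.

(* The derivative of [kern] in [s]. *)
Definition kern_ds s y : R := kern s y * ((d.*2 + 4)%:R / s - 4 * d.+1%:R * s ^+ 3 / (s ^+ 4 + y)).

Section fixed_scale.
Variable s : R.
Hypothesis s0 : 0 < s.

Lemma rho_gt0 y : 0 <= y -> 0 < s ^+ 4 + y.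
Proof. by move=> y0; rewrite ltr_pwDl// exprn_gt0. Qed.

Lemma kern_gt0 y : 0 <= y -> 0 < kern s y.
Proof. by move=> /rho_gt0 r0; rewrite mulr_gt0 ?invr_gt0 ?exprn_gt0. Qed.

Lemma potE y : 0 <= y -> pot s y = kern s y * (s ^+ 4 + y).
Proof.
move=> /rho_gt0 r0; rewrite /pot /kern [(s ^+ 4 + y) ^+ d.+1]exprS invfM -!mulrA; congr (_ * _).
by rewrite mulrC -mulrA mulfV ?mulr1// gt_eqF.
Qed.

Let shift_is_derive m y : 0 <= y ->
  is_derive y (1 : R) (fun y => (s ^+ 4 + y) ^- m) (- m%:R * (s ^+ 4 + y) ^- m.+1).
Proof.
move=> /rho_gt0 r0.
have H1 : is_derive y (1 : R) (fun y => s ^+ 4 + y) 1.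
  have H := is_deriveD (is_derive_cst (s ^+ 4 : R) y (1 : R)) (is_derive_id y (1 : R)).
  by rewrite add0r in H.
have H2 := @comp_is_derive R R (fun z => z ^- m) (fun y => s ^+ 4 + y) y 1 _ _
  (is_derive_exprVn m (lt0r_neq0 r0)) H1.
by rewrite mulr1 in H2.
Qed.

Lemma pot_is_derive y : 0 <= y -> is_derive y (1 : R) (pot s) (- d%:R * kern s y).
Proof.
move=> y0; have H := is_deriveZ (s ^+ (d.*2 + 4)) (shift_is_derive d y0).
by rewrite /kern mulrCA; exact: H.
Qed.

Lemma kern_is_derive y : 0 <= y ->
  is_derive y (1 : R) (kern s) (- d.+1%:R * (kern s y / (s ^+ 4 + y))).
Proof.
move=> y0; have H := is_deriveZ (s ^+ (d.*2 + 4)) (shift_is_derive d.+1 y0).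
rewrite (_ : - d.+1%:R * _ = s ^+ (d.*2 + 4) *: (- d.+1%:R * (s ^+ 4 + y) ^- d.+2)); first exact: H.
rewrite /kern /GRing.scale/= [in RHS]mulrCA; congr (_ * _).
by rewrite -mulrA; congr (_ * _); rewrite -invfM -exprSr.
Qed.

Lemma cut_is_derive n y : (n < 2)%N -> is_derive y (1 : R) (cut n) (cut n.+1 y).
Proof.
move=> n2; have H1 : is_derive y (1 : R) (fun y => 1 - c * y) (- c).
  have H := is_deriveB (is_derive_cst (1 : R) y (1 : R)) (is_deriveZ c (is_derive_id y (1 : R))).
  by rewrite sub0r [_ *: 1]mulr1 in H.
have H2 := @comp_is_derive R R (pos_cube n) (fun y => 1 - c * y) y 1 _ _ (pos_cube_is_derive _ n2) H1.
have H := is_deriveZ ((- c) ^+ n) H2.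
rewrite (_ : cut n.+1 y = (- c) ^+ n *: (pos_cube n.+1 (1 - c * y) * - c)); first exact: H.
by rewrite /cut /GRing.scale/= exprSr -mulrA [- c * _]mulrC.
Qed.

Lemma cut_pot_is_derive n y : (n < 2)%N -> 0 <= y ->
  is_derive y (1 : R) (cut_pot s n) (cut_pot s n.+1 y).
Proof.
move=> + y0; case: n => [|[|//]] _.
  have H := is_deriveM (cut_is_derive y (isT : (0 < 2)%N)) (pot_is_derive y0).
  rewrite (_ : cut_pot s 1 y = cut 0 y *: (- d%:R * kern s y) + pot s y *: cut 1 y); first exact: H.
  by rewrite /cut_pot /GRing.scale/=; ring.
have Ha := is_deriveM (cut_is_derive y (isT : (1 < 2)%N)) (pot_is_derive y0).
have Hb := is_deriveM (cut_is_derive y (isT : (0 < 2)%N)) (kern_is_derive y0).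
have H := is_deriveB Ha (is_deriveZ d%:R Hb).
rewrite (_ : cut_pot s 2 y = cut 1 y *: (- d%:R * kern s y) + pot s y *: cut 2 y -
  d%:R *: (cut 0 y *: (- d.+1%:R * (kern s y / (s ^+ 4 + y))) + kern s y *: cut 1 y)); first exact: H.
by rewrite /cut_pot /GRing.scale/=; ring.
Qed.

Lemma kern_is_derive_scale y : 0 <= y -> is_derive s (1 : R) (kern ^~ y) (kern_ds s y).
Proof.
move=> y0; have r0 := rho_gt0 y0.
have dX m : is_derive s (1 : R) (fun z : R => z ^+ m) (m%:R * s ^+ m.-1).
  by split; [exact: exprn_derivable|rewrite exp_derive [_ *: 1]mulr1].
have H1 : is_derive s (1 : R) (fun z : R => z ^+ 4 + y) (4 * s ^+ 3).
  have H := is_deriveD (dX 4) (is_derive_cst y s (1 : R)).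
  by rewrite addr0 in H.
have H2 := @comp_is_derive R R (fun z => z ^- d.+1) (fun z => z ^+ 4 + y) s 1 _ _
  (is_derive_exprVn d.+1 (lt0r_neq0 r0)) H1.
have H := is_deriveM (dX (d.*2 + 4)%N) H2.
rewrite (_ : kern_ds s y = s ^+ (d.*2 + 4) *: (- d.+1%:R * (s ^+ 4 + y) ^- d.+2 * (4 * s ^+ 3)) +
  (s ^+ 4 + y) ^- d.+1 *: ((d.*2 + 4)%:R * s ^+ (d.*2 + 4).-1)); first exact: H.
rewrite /kern_ds /kern /GRing.scale/=.
have -> : s ^+ (d.*2 + 4) = s * s ^+ (d.*2 + 4).-1 by rewrite -exprS addnS.
rewrite [(s ^+ 4 + y) ^+ d.+2]exprS.
have /lt0r_neq0 rd0 : 0 < (s ^+ 4 + y) ^+ d.+1 by rewrite exprn_gt0.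
move: (s ^+ (d.*2 + 4).-1) ((s ^+ 4 + y) ^+ d.+1) rd0 => S D D0.
by field; rewrite D0 !gt_eqF.
Qed.

(** 4 y F'' + 2 d F' is the second-order part of the generator on F(q) when the coefficients are
    frozen at x0. On [pot] it reproduces d s times the s-derivative of [kern]; the bracket collects
    the terms in which a derivative falls on the cut-off. *)
Lemma cut_pot_identity y : 0 <= y ->
  d%:R * s * (cut 0 y * kern_ds s y) = 4 * y * cut_pot s 2 y + 2 * d%:R * cut_pot s 1 y
  - (4 * y * (cut 2 y * pot s y - 2 * d%:R * (cut 1 y * kern s y)) + 2 * d%:R * (cut 1 y * pot s y)).
Proof.
move=> y0; have r0 := rho_gt0 y0.
rewrite /kern_ds /cut_pot potE// -muln2 natrD natrM -[d.+1]addn1 natrD.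
move: (kern s y) (cut 0 y) (cut 1 y) (cut 2 y) => K t0 t1 t2.
by field; rewrite !gt_eqF.
Qed.

Lemma cut_bounds y : 0 <= y -> [/\ 0 <= cut 0 y <= 1, `|cut 1 y| <= 3 * c & `|cut 2 y| <= 6 * c ^+ 2].
Proof.
move=> y0; have m0 : 0 <= Order.max (1 - c * y) 0 by rewrite le_max lexx orbT.
have m1 : Order.max (1 - c * y) 0 <= 1 by rewrite ge_max ler01 andbT gerBl mulr_ge0// ltW.
have c00 := ltW c0; rewrite /cut /pos_cube expr0 mul1r expr1 sqrrN; split.
- by rewrite exprn_ge0// exprn_ile1.
- rewrite normrM normrN (ger0_norm c00) [leRHS]mulrC ler_wpM2l// ger0_norm ?mulr_ge0 ?exprn_ge0//.
  by rewrite ger_pMr// exprn_ile1.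
- rewrite normrM [`|c ^+ 2|]ger0_norm ?sqr_ge0// [leRHS]mulrC ler_wpM2l ?sqr_ge0//.
  by rewrite ger0_norm ?mulr_ge0// ger_pMr.
Qed.

Lemma cut_pot0 n y : 1 <= c * y -> cut_pot s n y = 0 /\ cut 0 y = 0.
Proof.
move=> cy; have E m : cut m y = 0 by rewrite /cut pos_cube0 ?mulr0// subr_le0.
by split => //; case: n => [|[|n]]; rewrite /cut_pot !E !(mul0r, mulr0, subr0, addr0).
Qed.

Hypothesis s1 : s <= 1.
Let P := 1 + c^-1.

Let rho_le y : 0 <= y -> c * y <= 1 -> s ^+ 4 + y <= P.
Proof.
move=> y0 cy; rewrite lerD//; first by rewrite exprn_ile1// ltW.
by rewrite -[leRHS]mul1r ler_pdivlMr// mulrC.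
Qed.

(** On the support s^4 + y is bounded by [P], so derivatives of the cut-off cost only constants: the
    first derivative has the size of [kern], the second that of kern / (s^4 + y), and the cut-off
    terms are smaller than [kern] by a factor s^4 + y. *)
Lemma cut_pot_bounds y : 0 <= y -> c * y <= 1 ->
  [/\ `|cut_pot s 1 y| <= (3 * c * P + d%:R) * kern s y,
   `|cut_pot s 2 y| * (s ^+ 4 + y) <=
     (6 * c ^+ 2 * P ^+ 2 + 6 * c * d%:R * P + d%:R * d.+1%:R) * kern s y &
   `|4 * y * (cut 2 y * pot s y - 2 * d%:R * (cut 1 y * kern s y)) + 2 * d%:R * (cut 1 y * pot s y)|
     <= (24 * c ^+ 2 * P + 30 * c * d%:R) * ((s ^+ 4 + y) * kern s y)].
Proof.
move=> y0 cy; have r0 := rho_gt0 y0; have K0 := kern_gt0 y0.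
have [/andP[t00 t01] t1 t2] := cut_bounds y0; have rP := rho_le y0 cy.
have P0 : 0 < P := lt_le_trans r0 rP; have d0 : 0 <= d%:R :> R by [].
have d10 : 0 <= d.+1%:R :> R by [].
have yr : y <= s ^+ 4 + y by rewrite lerDr exprn_ge0// ltW.
rewrite /cut_pot (potE y0); move: (d.+1%:R : R) d10 => d1 d10.
move: (d%:R : R) d0 => D D0.
move: (kern s y) (cut 0 y) (cut 1 y) (cut 2 y) K0 t00 t01 t1 t2 => K z0 z1 z2 K0 t00 t01 t1 t2.
move: (s ^+ 4 + y) r0 rP yr => r r0 rP yr; move: P P0 rP => P' P0 rP.
have r00 := ltW r0; have K00 := ltW K0.
have b1 : `|z1 * (K * r)| <= 3 * c * (K * r).
  by rewrite normrM [`|K * r|]ger0_norm ?mulr_ge0// ler_wpM2r// mulr_ge0.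
have b2 : `|z2 * (K * r)| <= 6 * c ^+ 2 * (K * r).
  by rewrite normrM [`|K * r|]ger0_norm ?mulr_ge0// ler_wpM2r// mulr_ge0.
have b3 : `|z1 * K| <= 3 * c * K by rewrite normrM [`|K|]ger0_norm// ler_wpM2r.
have KrP : K * r <= K * P' by rewrite ler_wpM2l.
have c00 := ltW c0.
split.
- rewrite (le_trans (ler_normB _ _))// mulrDl lerD//.
    by rewrite (le_trans b1)// -[leRHS]mulrA [P' * K]mulrC ler_wpM2l// mulr_ge0.
  by rewrite normrM [`|D|]ger0_norm// ler_wpM2l// ger0_norm ?mulr_ge0// ler_piMl.
- have H : `|z2 * (K * r) - 2 * D * (z1 * K) + D * d1 * (z0 * (K / r))| <=
    6 * c ^+ 2 * (K * r) + 2 * D * (3 * c * K) + D * d1 * (K / r).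
    rewrite (le_trans (ler_normD _ _))// lerD//; last first.
      rewrite normrM [`|D * d1|]ger0_norm ?mulr_ge0// ler_wpM2l ?mulr_ge0//.
      by rewrite ger0_norm ?mulr_ge0 ?invr_ge0// ler_piMl// mulr_ge0 ?invr_ge0.
    rewrite (le_trans (ler_normB _ _))// lerD// normrM [`|2 * D|]ger0_norm ?mulr_ge0//.
    by rewrite ler_wpM2l ?mulr_ge0.
  rewrite (le_trans (ler_wpM2r r00 H))//.
  rewrite [leLHS](_ : _ = 6 * c ^+ 2 * (r ^+ 2) * K + 6 * c * D * r * K + D * d1 * K); last first.
    by field; rewrite gt_eqF.
  have q1 : 6 * c ^+ 2 * r ^+ 2 * K <= 6 * c ^+ 2 * P' ^+ 2 * K.
    by rewrite ler_wpM2r// ler_wpM2l ?mulr_ge0 ?sqr_ge0// lerXn2r// nnegrE// ltW.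
  have q2 : 6 * c * D * r * K <= 6 * c * D * P' * K.
    by rewrite ler_wpM2r// ler_wpM2l// !mulr_ge0.
  rewrite [leRHS](_ : _ = 6 * c ^+ 2 * P' ^+ 2 * K + 6 * c * D * P' * K + D * d1 * K); last by ring.
  exact: lerD (lerD q1 q2) (lexx _).
- rewrite (le_trans (ler_normD _ _))//.
  rewrite [leRHS](_ : _ = 4 * r * (6 * c ^+ 2 * (K * P') + 2 * D * (3 * c * K)) + 2 * D * (3 * c * (K * r))); last by ring.
  rewrite lerD//; last by rewrite normrM [`|2 * D|]ger0_norm ?mulr_ge0// ler_wpM2l ?mulr_ge0.
  rewrite normrM ler_pM//; first by rewrite ger0_norm ?mulr_ge0// ler_wpM2l.
  rewrite (le_trans (ler_normB _ _))// lerD//.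
    by rewrite (le_trans b2)// ler_wpM2l// mulr_ge0// sqr_ge0.
  by rewrite normrM [`|2 * D|]ger0_norm ?mulr_ge0// ler_wpM2l ?mulr_ge0.
Qed.

Let C0 : R := 2 * (8 + (2 * c) ^+ d.+1).

(** Freezing the coefficients causes an error of size N kern, with N = sqrt(q), and it must be paid
    by s times the averages. For N > s the width s^2 makes the tail so thin that N kern <= s. For N
    <= s either c N^2 <= 1/2 and the cut-off is at least 1/8, or [kern] is at most (2c)^(d+1). Width
    s^2 instead of s is what makes the resulting rate bounded in s. *)
Lemma kern_scale_le N : 0 <= N -> c * N ^+ 2 <= 1 ->
  kern s (N ^+ 2) * (s + N) <= C0 * (s * (cut 0 (N ^+ 2) * kern s (N ^+ 2) + pos_cube 0 (2 - c * N ^+ 2))).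
Proof.
move=> N0 cN; have y0 := sqr_ge0 N; have K0 := kern_gt0 y0.
have [/andP[t00 _] _ _] := cut_bounds y0.
have z1 : 1 <= pos_cube 0 (2 - c * N ^+ 2).
  rewrite /pos_cube exprn_ege1// le_max; apply/orP; left.
  by rewrite lerBrDr -lerBrDl (le_trans cN)// lerBrDl.
have z0 : 0 <= pos_cube 0 (2 - c * N ^+ 2) := le_trans ler01 z1.
have c20 : 0 <= (2 * c) ^+ d.+1 by rewrite exprn_ge0// mulr_ge0// ltW.
have tK0 : 0 <= cut 0 (N ^+ 2) * kern s (N ^+ 2) by rewrite mulr_ge0// ltW.
have [Ns|sN] := leP N s; last first.
  have N00 : 0 < N := lt_trans s0 sN.
  have H : kern s (N ^+ 2) * N <= s.
    rewrite /kern mulrAC ler_pdivrMr ?exprn_gt0 ?rho_gt0//.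
    apply: (@le_trans _ _ (s * (N ^+ 2) ^+ d.+1)); last first.
      by rewrite ler_wpM2l ?(ltW s0)// lerXn2r ?nnegrE ?(ltW (rho_gt0 y0))// lerDr exprn_ge0// ltW.
    rewrite -exprM (_ : (d.*2 + 4 = (d.*2.+1 + 2).+1)%N); last by rewrite addSn !addnS.
    rewrite exprS -mulrA ler_wpM2l ?(ltW s0)// (_ : (2 * d.+1 = d.*2.+1.+1)%N); last by rewrite mul2n doubleS.
    rewrite [leRHS]exprSr ler_wpM2r// exprD.
    rewrite -[leRHS]mulr1 ler_pM ?exprn_ge0 ?(ltW s0)//; last by rewrite exprn_ile1// ltW.
    by rewrite lerXn2r ?nnegrE ?(ltW s0)// ltW.
  apply: (@le_trans _ _ (2 * s)).
    apply: (@le_trans _ _ (2 * (kern s (N ^+ 2) * N))); last by rewrite ler_wpM2l.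
    by rewrite mulrCA ler_wpM2l ?(ltW K0)// mulr_natl mulr2n lerD2r ltW.
  rewrite /C0 -mulrA ler_wpM2l// mulrCA -[leLHS]mulr1 ler_wpM2l ?(ltW s0)//.
  rewrite (@le_trans _ _ (8 * 1))//; first by rewrite mulr1 ler1n.
  apply: ler_pM => //; first by rewrite lerDl.
  by rewrite (le_trans z1)// lerDr.
suff key : kern s (N ^+ 2) <= (8 + (2 * c) ^+ d.+1) *
    (cut 0 (N ^+ 2) * kern s (N ^+ 2) + pos_cube 0 (2 - c * N ^+ 2)).
  move: key K0; rewrite /C0.
  move: (kern s _) (_ * kern _ _ + _) (8 + _) => K X a key K0.
  apply: (@le_trans _ _ (2 * s * K)).
    by rewrite mulrC ler_wpM2r ?(ltW K0)// mulr_natl mulr2n lerD2l.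
  by rewrite -!mulrA ler_wpM2l// [leRHS]mulrCA ler_wpM2l// ltW.
have [cy|cy] := leP (c * N ^+ 2) (1 / 2).
  have t8 : 1 <= 8 * cut 0 (N ^+ 2).
    have h : 2^-1 <= 1 - c * N ^+ 2 by move: cy; move: (c * _) => z ?; lra.
    have h2 : 0 <= (2^-1 : R) by rewrite invr_ge0.
    have h0 := le_trans h2 h.
    rewrite /cut /pos_cube expr0 mul1r max_l//.
    apply: (@le_trans _ _ (8 * 2^-1 ^+ 3)); first by rewrite le_eqVlt; apply/orP; left; apply/eqP; field.
    by rewrite ler_wpM2l// lerXn2r// nnegrE.
  apply: (@le_trans _ _ (8 * cut 0 (N ^+ 2) * kern s (N ^+ 2))).
    by rewrite ler_peMl// ltW.
  move: (kern s _) (cut 0 _) (pos_cube 0 _) ((2 * c) ^+ _) K0 z0 c20 tK0 => K t z e K0 z0 c20 tK0.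
  rewrite -mulrA ler_pM// ?lerDl//.
have H : kern s (N ^+ 2) <= (2 * c) ^+ d.+1.
  rewrite /kern ler_pdivrMr ?exprn_gt0 ?rho_gt0// -exprMn.
  rewrite (@le_trans _ _ 1)//; first by rewrite exprn_ile1// ltW.
  rewrite exprn_ege1// mulrDr (@le_trans _ _ (2 * c * N ^+ 2))//.
    by rewrite -mulrA; move: cy; move: (c * _) => z ?; lra.
  by rewrite lerDr mulr_ge0 ?mulr_ge0 ?exprn_ge0// ltW.
rewrite (le_trans H)//.
move: (_ * kern s _) (pos_cube 0 _) ((2 * c) ^+ _) z1 c20 tK0 => X z e z1 c20 X0.
apply: (@le_trans _ _ ((8 + e) * 1)); first by rewrite mulr1 lerDr.
rewrite ler_wpM2l ?addr_ge0//.
by rewrite (le_trans z1)// lerDr.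
Qed.

(** The summands pay, in order, for the error in a(Dq, Dq), for those in a:D^2q and in the drift,
    for the cut-off terms, and for the size of the test function itself. *)
Definition kernel_constant (C1 : R) : R :=
  ((6 * c ^+ 2 * P ^+ 2 + 6 * c * d%:R * P + d%:R * d.+1%:R) * C1 + 2 * (3 * c * P + d%:R) * C1
   + (24 * c ^+ 2 * P + 30 * c * d%:R) * P + P) * C0.

Lemma kernel_constant_ge0 (C1 : R) : 0 <= C1 -> 0 <= kernel_constant C1.
Proof.
have P0 : 0 <= P by rewrite addr_ge0 ?invr_ge0// ltW.
have c00 := ltW c0.
move=> C10; rewrite /kernel_constant /C0; move: P P0 => p p0.
by rewrite !(addr_ge0, mulr_ge0, exprn_ge0).
Qed.

Lemma cut_kern_ge0 y : 0 <= y -> 0 <= cut 0 y * kern s y.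
Proof. by move=> y0; have [/andP[t0 _] _ _] := cut_bounds y0; rewrite mulr_ge0// ltW// kern_gt0. Qed.

(* [N ^+ 2], [Q], [S], [B] stand for q(x), a(x)(Dq, Dq), a(x):D^2q and b(x).Dq. *)
Lemma kernel_generator_ge (C1 e N Q S B : R) : 0 <= C1 -> 0 <= e <= 1 -> 0 <= N ->
  (c * N ^+ 2 <= 1 -> [/\ `|Q - 4 * N ^+ 2| <= C1 * N ^+ 3, `|S - 2 * d%:R| <= C1 * N & `|B| <= C1 * N]) ->
  let E := kernel_constant C1 * (s * (cut 0 (N ^+ 2) * kern s (N ^+ 2) + pos_cube 0 (2 - c * N ^+ 2))) in
  e * (cut_pot s 2 (N ^+ 2) * Q + cut_pot s 1 (N ^+ 2) * S) + cut_pot s 1 (N ^+ 2) * B - E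
    <= e * (d%:R * s * (cut 0 (N ^+ 2) * kern_ds s (N ^+ 2)))
  /\ cut_pot s 0 (N ^+ 2) <= E.
Proof.
move=> C10 /andP[e0 e1] N0 H E; have y0 := sqr_ge0 N.
have K0 := kern_gt0 y0; have r0 := rho_gt0 y0.
have z0 : 0 <= pos_cube 0 (2 - c * N ^+ 2) := pos_cube_ge0 _ _.
have E0 : 0 <= E.
  apply: mulr_ge0; first exact: kernel_constant_ge0.
  by apply: mulr_ge0; [exact: ltW|apply: addr_ge0 => //; exact: cut_kern_ge0].
have [cy|cy] := leP 1 (c * N ^+ 2).
  have [F2 t0] := cut_pot0 2 cy; have [F1 _] := cut_pot0 1 cy; have [F0 _] := cut_pot0 0 cy.
  clearbody E; rewrite F2 F1 F0 t0 !mul0r !mulr0 !add0r.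
  by split => //; rewrite mulr0 addr0 add0r oppr_le0.
have {}cy := ltW cy; have [hQ hS hB] := H cy.
have [b1 b2 b3] := cut_pot_bounds y0 cy.
have key := kern_scale_le N0 cy.
have rP := rho_le y0 cy.
have P1 : 1 <= P by rewrite lerDl invr_ge0 ltW.
have s4 : s ^+ 4 <= s by rewrite exprS ler_piMr ?exprn_ile1// ltW.
have NP : N <= P.
  rewrite leNgt; apply/negP => PN; suff : P < N ^+ 2.
    by rewrite ltNge (le_trans _ rP)// lerDr exprn_ge0// ltW.
  rewrite expr2 (lt_le_trans PN)// ler_peMr//.
  exact: le_trans P1 (ltW PN).
(* Brings every error to the common form kern (s + N). *)
have rsN : s ^+ 4 + N ^+ 2 <= P * (s + N).
  rewrite mulrDr lerD//; first by rewrite (le_trans s4)// ler_peMl// ltW.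
  by rewrite expr2 ler_wpM2r.
have id := cut_pot_identity y0.
have pE := potE y0.
have t01 := cut_bounds y0.
have cP0 : 0 <= P := le_trans ler01 P1.
have y_r : N ^+ 2 <= s ^+ 4 + N ^+ 2 by rewrite lerDr exprn_ge0// ltW.
have c00 := ltW c0; have s00 := ltW s0.
have D0 : 0 <= d%:R :> R by []. have D10 : 0 <= d.+1%:R :> R by [].
have [c10 c20 c30] : [/\ 0 <= 3 * c * P + d%:R,
    0 <= 6 * c ^+ 2 * P ^+ 2 + 6 * c * d%:R * P + d%:R * d.+1%:R & 0 <= 24 * c ^+ 2 * P + 30 * c * d%:R].
  by move: P cP0 => p p0; split; rewrite !(addr_ge0, mulr_ge0, exprn_ge0).
have EE : E = kernel_constant C1 * (s * (cut 0 (N ^+ 2) * kern s (N ^+ 2) + pos_cube 0 (2 - c * N ^+ 2))) by [].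
rewrite /kernel_constant in EE; clearbody E.
set c1 := 3 * c * P + d%:R in c10 b1 EE *.
set c2 := 6 * c ^+ 2 * P ^+ 2 + 6 * c * d%:R * P + d%:R * d.+1%:R in c20 b2 EE *.
set c3 := 24 * c ^+ 2 * P + 30 * c * d%:R in c30 b3 EE *.
clearbody c1 c2 c3.
set G := 4 * N ^+ 2 * _ + _ in b3 id.
have E1 : cut_pot s 0 (N ^+ 2) <= kern s (N ^+ 2) * (s ^+ 4 + N ^+ 2).
  rewrite /cut_pot pE; have [/andP[_ t1] _ _] := t01.
  by rewrite ler_piMl// mulr_ge0// ltW.
rewrite id; clearbody G; move: EE key b1 b2 b3 E1 K0.
clear pE t01 id H.
move: (cut_pot s 0 _) (cut_pot s 1 _) (cut_pot s 2 _) => F0 F1 F2.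
set X := s * (cut 0 _ * _ + _); clearbody X.
move: (kern s _) => K; move: C0 => k0.
move=> EE key b1 b2 b3 E1 K0; have K00 := ltW K0.
move: (s ^+ 4 + N ^+ 2) r0 rP rsN y_r E1 b2 b3 => r r0 rP rsN y_r E1 b2 b3.
have P0 : 0 <= P := le_trans ler01 P1.
have Nw : N <= s + N by rewrite lerDr.
move: (s + N) (addr_ge0 s00 N0) Nw rsN key => w w0 Nw rsN key.
have err : e * `|F2| * `|Q - 4 * N ^+ 2| + e * `|F1| * `|S - 2 * d%:R| + `|F1| * `|B| + e * `|G|
    <= (c2 * C1 + 2 * c1 * C1 + c3 * P) * (K * w).
  have e_le z : 0 <= z -> e * z <= z by move=> z_0; rewrite ler_piMl.
  have F1N : `|F1| * (C1 * N) <= c1 * C1 * (K * w).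
    rewrite [leRHS](_ : _ = c1 * K * (C1 * w)); last by ring.
    by rewrite ler_pM// ?mulr_ge0// ler_wpM2l.
  rewrite [leRHS](_ : _ = c2 * C1 * (K * w) + c1 * C1 * (K * w) + c1 * C1 * (K * w) + c3 * (K * (P * w))); last by ring.
  apply: lerD; first apply: lerD; first apply: lerD.
  - rewrite -mulrA (le_trans (e_le _ _))// ?mulr_ge0//.
    apply: (@le_trans _ _ (`|F2| * (C1 * N ^+ 3))); first by rewrite ler_wpM2l.
    apply: (@le_trans _ _ (`|F2| * r * (C1 * N))).
      rewrite [leRHS](_ : _ = `|F2| * (C1 * (r * N))); last by ring.
      by rewrite ler_wpM2l// ler_wpM2l// exprSr ler_wpM2r.
    rewrite [leRHS](_ : _ = c2 * K * (C1 * w)); last by ring.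
    by rewrite ler_pM// ?mulr_ge0// ?(ltW r0)// ler_wpM2l.
  - rewrite -mulrA (le_trans (e_le _ _))// ?mulr_ge0// (le_trans _ F1N)// ler_wpM2l//.
  - by rewrite (le_trans _ F1N)// ler_wpM2l.
  - rewrite (le_trans (e_le _ _))// (le_trans b3)// ler_wpM2l// mulrC ler_wpM2l//.
have Kw0 : 0 <= K * w by rewrite mulr_ge0.
have big : (c2 * C1 + 2 * c1 * C1 + c3 * P + P) * (K * w) <=
    (c2 * C1 + 2 * c1 * C1 + c3 * P + P) * k0 * X.
  rewrite -[leRHS]mulrA ler_wpM2l//.
  by move: P P0 => p p0; rewrite !(addr_ge0, mulr_ge0).
have {}big : (c2 * C1 + 2 * c1 * C1 + c3 * P) * (K * w) + P * (K * w) <= E.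
  by rewrite -mulrDl EE.
split; last first.
  rewrite (le_trans E1)// (le_trans _ big)// ler_wpDl//.
    by rewrite mulr_ge0//; move: P P0 => p p0; rewrite !(addr_ge0, mulr_ge0).
  by rewrite mulrCA ler_wpM2l.
have PKw : 0 <= P * (K * w) by rewrite mulr_ge0.
(* The deviation from the model operator, split into the three coefficient errors and the cut-off
   error. *)
have ineq : e * (F2 * Q + F1 * S) + F1 * B - e * (4 * N ^+ 2 * F2 + 2 * d%:R * F1 - G) <=
    e * `|F2| * `|Q - 4 * N ^+ 2| + e * `|F1| * `|S - 2 * d%:R| + `|F1| * `|B| + e * `|G|.
  rewrite [leLHS](_ : _ = e * F2 * (Q - 4 * N ^+ 2) + e * F1 * (S - 2 * d%:R) + F1 * B + e * G); last by ring.
  have ab (a z : R) : a * z <= `|a| * `|z| by rewrite -normrM ler_norm.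
  apply: lerD; first apply: lerD; first apply: lerD.
  - by rewrite -!mulrA ler_wpM2l.
  - by rewrite -!mulrA ler_wpM2l.
  - exact: ab.
  - by rewrite ler_wpM2l// ler_norm.
rewrite lerBlDl -lerBlDr (le_trans ineq)// (le_trans err)// (le_trans _ big)//.
by rewrite lerDl.
Qed.

End fixed_scale.
End approximate_kernel.

Lemma kern_le {R : realType} d (s y : R) : 0 < s -> 0 <= y -> kern d s y <= s ^- d.*2.
Proof.
move=> s0 y0; have r0 := rho_gt0 s0 y0.
rewrite /kern ler_pdivrMr ?exprn_gt0// mulrC ler_pdivlMr ?exprn_gt0// -exprD.
rewrite (_ : (d.*2 + 4 + d.*2 = 4 * d.+1)%N); last first.
  by rewrite -!muln2 -addn1; ring.
by rewrite exprM lerXn2r ?nnegrE ?exprn_ge0 ?(ltW s0)// ?(ltW r0)// lerDl.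
Qed.

Section kernel_continuity.
Context {R : realType}.
Variables (d : nat) (c s : R).
Hypotheses (c0 : 0 < c) (s0 : 0 < s).

Let kc (y : R) : 0 <= y -> {for y, continuous (kern d s)}.
Proof. by move=> y0; exact: is_derive_continuous (kern_is_derive d s0 y0). Qed.

Let pc (y : R) : 0 <= y -> {for y, continuous (pot d s)}.
Proof. by move=> y0; exact: is_derive_continuous (pot_is_derive d s0 y0). Qed.

Lemma cut_continuous n : continuous (cut c n).
Proof.
move=> y; apply: (@cvgM _ _ (nbhs y)); first exact: cvg_cst.
apply: (@continuous_comp _ _ _ (fun y => 1 - c * y) (pos_cube n)); last exact: pos_cube_continuous.
apply: (@cvgB _ _ _ (nbhs y)); first exact: cvg_cst.
by apply: (@cvgM _ _ (nbhs y)); [exact: cvg_cst|exact: cvg_id].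
Qed.

Lemma cut_kern_continuous (y : R) : 0 <= y ->
  {for y, continuous (fun y => cut c 0 y * kern d s y)}.
Proof. by move=> y0; apply: (@cvgM _ _ (nbhs y)); [exact: cut_continuous|exact: kc]. Qed.

Let rho_inv (y : R) : 0 <= y -> {for y, continuous (fun y => (s ^+ 4 + y)^-1)}.
Proof.
move=> y0; have r0 := rho_gt0 s0 y0.
apply: (@cvgV _ _ (nbhs y)); first exact: lt0r_neq0.
by apply: (@cvgD _ _ _ (nbhs y)); [exact: cvg_cst|exact: cvg_id].
Qed.

Lemma cut_kern_ds_continuous (y : R) : 0 <= y ->
  {for y, continuous (fun y => cut c 0 y * kern_ds d s y)}.
Proof.
move=> y0; apply: (@cvgM _ _ (nbhs y)); first exact: cut_continuous.
apply: (@cvgM _ _ (nbhs y)); first exact: kc.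
apply: (@cvgB _ _ _ (nbhs y)); first exact: cvg_cst.
by apply: (@cvgM _ _ (nbhs y)); [exact: cvg_cst|exact: rho_inv].
Qed.

Lemma cut_pot_continuous n (y : R) : 0 <= y -> {for y, continuous (cut_pot d c s n)}.
Proof.
move=> y0; have ck m : (fun y => cut c m y * kern d s y) @ y --> cut c m y * kern d s y.
  by apply: (@cvgM _ _ (nbhs y)); [exact: cut_continuous|exact: kc].
have cp m : (fun y => cut c m y * pot d s y) @ y --> cut c m y * pot d s y.
  by apply: (@cvgM _ _ (nbhs y)); [exact: cut_continuous|exact: pc].
case: n => [|[|n]]; first exact: cp.
  apply: (@cvgB _ _ _ (nbhs y)); first exact: cp.
  by apply: (@cvgM _ _ (nbhs y)); [exact: cvg_cst|exact: ck].
apply: (@cvgD _ _ _ (nbhs y)).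
  apply: (@cvgB _ _ _ (nbhs y)); first exact: cp.
  by apply: (@cvgM _ _ (nbhs y)); [exact: cvg_cst|exact: ck].
apply: (@cvgM _ _ (nbhs y)); first exact: cvg_cst.
apply: (@cvgM _ _ (nbhs y)); first exact: cut_continuous.
by apply: (@cvgM _ _ (nbhs y)); [exact: kc|exact: rho_inv].
Qed.

End kernel_continuity.

(** * The average of the density against the kernel, as a function of the scale *)

Section kernel_average.
Context {R : realType} {d : nat}.
Local Notation V := 'rV[R]_d.
Local Notation mu := (lebesgue_tuple R d).
Local Notation toV := (@tuple_rV R d).
Variables (Om K : set V) (A : V -> 'M[R]_d) (b : V -> V) (q : V -> R) (c C1 : R).
Hypotheses (oOm : open Om) (CA : Ck_mx 2 Om A) (Cb : Ck_rV 1 Om b).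
Hypotheses (Cq : Ck 2 setT q) (q0 : forall x, 0 <= q x).
Hypotheses (cK : compact K) (KO : K `<=` Om) (c0 : 0 < c) (qK : forall x, c * q x <= 2 -> K x).
Hypotheses (d0 : (0 < d)%N) (C10 : 0 <= C1).
Hypothesis qA : forall x, c * q x <= 1 ->
  [/\ `|gradient_form A q x - 4 * q x| <= C1 * Num.sqrt (q x) ^+ 3,
   `|second_order A q x - 2 * d%:R| <= C1 * Num.sqrt (q x) &
   `|transport b q x| <= C1 * Num.sqrt (q x)].

Let qoff x : ~ K x -> 2 < c * q x.
Proof. by move=> Kx; rewrite ltNge; apply/negP => /qK. Qed.

Let qoff1 x : ~ K x -> 1 <= c * q x.
Proof. by move=> /qoff/ltW; apply: le_trans; rewrite ler1n. Qed.

Let cq : continuous q.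
Proof. by move=> x; exact: Ck_continuous Cq _. Qed.

Let test_pot (s : R) : 0 < s -> test_fun 2 K (fun x => cut_pot d c s 0 (q x)).
Proof.
move=> s0; split; last by move=> x /qoff1 Hx; have [] := @cut_pot0 R d c s 0 (q x) Hx.
apply: (@Ck_comp _ _ 2 setT (cut_pot d c s) q openT) => //.
  by move=> n x _; exact: cut_pot_continuous.
by move=> n x n2 _; exact: cut_pot_is_derive.
Qed.

Let k (s : R) (x : V) := cut c 0 (q x) * kern d s (q x).
Let dk (s : R) (x : V) := cut c 0 (q x) * kern_ds d s (q x).
(** A wider cut-off, at least 1 on {c q <= 1} and supported in [K]. Its expectation is the local
    mass that bounds the density. *)
Definition mass_bump (x : V) := pos_cube 0 (2 - c * q x).

Let cut_off x : ~ K x -> cut c 0 (q x) = 0.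
Proof. by move=> /qoff1 Hx; have [] := @cut_pot0 R d c 0 0 (q x) Hx. Qed.

Let test_k s : 0 < s -> test_fun 0 K (k s).
Proof.
move=> s0; split; last by move=> x /cut_off E; rewrite /k E mul0r.
split => // x _.
apply: (@continuous_comp _ _ _ q (fun y => cut c 0 y * kern d s y)); first exact: cq.
exact: cut_kern_continuous.
Qed.

Let test_dk s : 0 < s -> test_fun 0 K (dk s).
Proof.
move=> s0; split; last by move=> x /cut_off E; rewrite /dk E mul0r.
split => // x _.
apply: (@continuous_comp _ _ _ q (fun y => cut c 0 y * kern_ds d s y)); first exact: cq.
exact: cut_kern_ds_continuous.
Qed.

Lemma test_mass_bump : test_fun 2 K mass_bump.
Proof.
split; last by move=> x /qoff qx; rewrite /mass_bump pos_cube0// subr_le0 ltW.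
have Cg : Ck 2 setT (fun x => - c * q x) := CkM openT (Ck_cst 2 _ (- c)) Cq.
have Cg' : Ck 2 setT (fun x => 2 - c * q x).
  by apply: (Ck_ext openT _ (CkD openT (Ck_cst 2 _ 2) Cg)) => x _; rewrite mulNr.
exact: (@Ck_pos_cube R d setT (fun x => 2 - c * q x) 2 isT openT Cg').
Qed.

Let adm_k s : 0 < s -> admissible Om (k s).
Proof. by move=> s0; exact: test_fun_admissible (test_k s0). Qed.

Let adm_dk s : 0 < s -> admissible Om (dk s).
Proof. by move=> s0; exact: test_fun_admissible (test_dk s0). Qed.

Let adm_z : admissible Om mass_bump := test_fun_admissible Om cK test_mass_bump.

Section solution.
Variables (eps : R) (u : V -> R) (lam Lam : R).
Hypotheses (eps01 : 0 < eps <= 1) (sol : EP_solution A b Om eps u lam) (lamL : lam <= Lam).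

Let u0 x : Om x -> 0 < u x. Proof. by case: sol => _ _ + _ _; apply. Qed.
Let u1 : integral_rV Om u = 1%E. Proof. by case: sol. Qed.
Let l0 : 0 <= lam. Proof. by case: sol. Qed.
Let cu x : Om x -> {for x, continuous u}.
Proof. by move=> Ox; case: sol => Cu _ _ _ _; exact: Ck_continuous Cu Ox. Qed.

Let m s := expect Om u (k s).
Let M2 := expect Om u mass_bump.

Let m_ge0 s : 0 < s -> 0 <= m s.
Proof.
move=> s0; have H := le_expect oOm cu u0 u1 (admissible_cst Om 0) (adm_k s0).
rewrite (expect_cst oOm cu u0 u1) in H; apply: H => x _; exact: cut_kern_ge0.
Qed.

Let M2_ge0 : 0 <= M2.
Proof.
have H := le_expect oOm cu u0 u1 (admissible_cst Om 0) adm_z.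
rewrite (expect_cst oOm cu u0 u1) in H; apply: H => x _; exact: pos_cube_ge0.
Qed.

Let m_is_derive (s : R) : 0 < s -> is_derive s (1 : R) m (expect Om u (dk s)).
Proof.
move=> s0; pose a := s / 2; pose B : set (d.-tuple (measurableTypeR R)) := toV @^-1` Om.
have a0 : 0 < a by rewrite divr_gt0.
have mB : measurable B by exact: measurable_open_preimage.
(* For scales above s/2 = a the kernel is at most a^(-2d), and both terms of its logarithmic
   derivative are of order 1/a; this is the dominating constant. *)
pose D := a ^- d.*2 * ((d.*2 + 4)%:R / a + 4 * d.+1%:R / a).
have D0 : 0 <= D.
  have a00 : 0 <= a^-1 by rewrite invr_ge0 ltW.
  by rewrite /D mulr_ge0 ?invr_ge0 ?exprn_ge0 ?(ltW a0)// addr_ge0// mulr_ge0.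
have sI : a < s < s + 1 by rewrite ltrDl ltr01 andbT gtr_pMr// invf_lt1// ltr1n.
have pos (z : R) : a < z < s + 1 -> 0 < z by move=> /andP[/(lt_trans a0)].
have bnd (z y : R) : a < z < s + 1 -> 0 <= y -> `|kern_ds d z y| <= D.
  move=> zI y0; have z0 := pos z zI; have /andP[az _] := zI.
  have r0 := rho_gt0 z0 y0; have K0 := kern_gt0 d z0 y0.
  rewrite /kern_ds normrM /D ler_pM//.
    rewrite ger0_norm ?(ltW K0)// (le_trans (kern_le _ z0 y0))//.
    by rewrite lef_pV2 ?posrE ?exprn_gt0// lerXn2r ?nnegrE ?ltW.
  have za : z^-1 <= a^-1 by rewrite lef_pV2 ?posrE// ltW.
  rewrite (le_trans (ler_normB _ _))// lerD//.
    by rewrite ger0_norm ?ler_wpM2l// mulr_ge0// invr_ge0 ltW.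
  rewrite ger0_norm ?mulr_ge0 ?invr_ge0 ?exprn_ge0 ?(ltW z0) ?(ltW r0)//.
  rewrite -mulrA ler_wpM2l ?mulr_ge0// (le_trans _ za)//.
  rewrite ler_pdivrMr// ler_pdivlMl// -exprS lerDl//.
apply: (@Rintegral_is_derive R _ _ mu B (fun s t => u (toV t) * k s (toV t))
  (fun s t => u (toV t) * dk s (toV t)) (fun t => `|u (toV t) * D|) s a (s + 1) mB sI).
- by move=> z zI; exact: (expect_integrable oOm cu u0 u1 (adm_k (pos z zI))).
- move=> z t zI Bt; have H := is_deriveZ (u (toV t)) (is_deriveZ (cut c 0 (q (toV t)))
    (kern_is_derive_scale d (pos z zI) (q0 (toV t)))).
  exact: H.
- by move=> t; exact: normr_ge0.
- exact: integrable_abse (expect_integrable oOm cu u0 u1 (admissible_cst Om D)).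
- move=> z t zI Bt; rewrite normrM [leRHS]normrM ler_wpM2l// (ger0_norm D0) normrM -[leRHS]mul1r.
  rewrite ler_pM//; last exact: bnd.
  have [/andP[t0 t1] _ _] := cut_bounds c0 (q0 (toV t)).
  by rewrite ger0_norm.
Qed.

(** The test function is the cut-off potential. Its generator is the s-derivative of the kernel up
    to errors of order s times the averages, and the eigenvalue term is of the same order, so
    dividing by s leaves a rate independent of s. *)
Lemma mass_growth s : 0 < s <= 1 ->
  - ((Lam + 1) * kernel_constant d c C1 * (m s + M2)) <= eps ^+ 2 / 2 * d%:R * expect Om u (dk s).
Proof.
move=> /andP[s0 s1]; have /andP[e0 e1] := eps01.
set Cg := kernel_constant d c C1; have Cg0 : 0 <= Cg by exact: kernel_constant_ge0.
have ee : 0 <= eps ^+ 2 / 2 <= 1.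
  rewrite divr_ge0 ?exprn_ge0 ?(ltW e0)//=.
  by rewrite ler_pdivrMr// mul1r (le_trans (exprn_ile1 2 (ltW e0) e1))// ler1n.
pose f x := cut_pot d c s 0 (q x); have tf : test_fun 2 K f := test_pot s0.
have CA0 : Ck_mx 0 Om A by move=> i j; exact: CkS (CkS (CA i j)).
have Cb0 : Ck_rV 0 Om b by move=> i; exact: CkS (Cb i).
have tL := generator_test_fun oOm cK KO CA0 Cb0 tf eps.
have aL := test_fun_admissible Om cK tL; have af := test_fun_admissible Om cK tf.
have Lf x : generator A b eps f x = eps ^+ 2 / 2 * (cut_pot d c s 2 (q x) * gradient_form A q x +
    cut_pot d c s 1 (q x) * second_order A q x) + cut_pot d c s 1 (q x) * transport b q x.
  have D0 z : [set: V] z -> is_derive (q z) (1 : R) (cut_pot d c s 0) (cut_pot d c s 1 (q z)).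
    by move=> _; exact: cut_pot_is_derive.
  have D1 z : [set: V] z -> is_derive (q z) (1 : R) (cut_pot d c s 1) (cut_pot d c s 2 (q z)).
    by move=> _; exact: cut_pot_is_derive.
  rewrite generatorE /f (second_order_comp openT Cq D0 D1 A I).
  by rewrite (transport_comp Cq D0 b I).
pose E x := Cg * s * (k s x + mass_bump x).
have pw x : generator A b eps f x <= eps ^+ 2 / 2 * d%:R * s * dk s x + E x /\ f x <= E x.
  have N2 : Num.sqrt (q x) ^+ 2 = q x by rewrite sqr_sqrtr.
  have := @kernel_generator_ge R d c c0 s s0 s1 C1 (eps ^+ 2 / 2) (Num.sqrt (q x))
    (gradient_form A q x) (second_order A q x) (transport b q x) C10 ee (sqrtr_ge0 _).
  rewrite N2 => /(_ (@qA x)) H; case: H; rewrite -/Cg -Lf => H1 H2.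
  have EE : E x = Cg * (s * (cut c 0 (q x) * kern d s (q x) + pos_cube 0 (2 - c * q x))).
    by rewrite [RHS]mulrA.
  have ED : eps ^+ 2 / 2 * d%:R * s * dk s x = eps ^+ 2 / 2 * (d%:R * s * (cut c 0 (q x) * kern_ds d s (q x))).
    by rewrite /dk; move: (cut _ _ _ * kern_ds _ _ _) => z; ring.
  by rewrite -lerBlDr EE ED; split.
have aE0 := admissibleD (adm_k s0) adm_z.
have aE : admissible Om E := admissibleM (admissible_cst Om (Cg * s)) aE0.
have EE : expect Om u E = Cg * s * (m s + M2).
  rewrite /E (expectZ oOm cu u0 u1 _ aE0) (expectD oOm cu u0 u1 (adm_k s0) adm_z)//.
have ad := admissibleM (admissible_cst Om (eps ^+ 2 / 2 * d%:R * s)) (adm_dk s0).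
have I1 := le_expect oOm cu u0 u1 aL (admissibleD ad aE) (fun x _ => (pw x).1).
have I2 := le_expect oOm cu u0 u1 af aE (fun x _ => (pw x).2).
rewrite (expectD oOm cu u0 u1 ad aE) (expectZ oOm cu u0 u1 _ (adm_dk s0)) in I1.
rewrite (weak_expect oOm CA Cb sol cK KO tf) EE in I1; rewrite EE in I2.
rewrite -(ler_pM2l s0).
have I3 : lam * expect Om u f <= Lam * (Cg * s * (m s + M2)).
  rewrite (le_trans (ler_wpM2l l0 I2))// ler_wpM2r//.
  by apply: mulr_ge0; [exact: mulr_ge0 Cg0 (ltW s0)|exact: addr_ge0 (m_ge0 s0) M2_ge0].
move: I1 I3; rewrite mulNr; move: (expect Om u f) (expect Om u (dk s)) (m s + M2) => X Y Z I1 I3.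
rewrite -subr_ge0 (_ : _ - _ = (eps ^+ 2 / 2 * d%:R * s * Y + Cg * s * Z - - (lam * X)) +
  (Lam * (Cg * s * Z) - lam * X)); last by ring.
by rewrite addr_ge0// subr_ge0.
Qed.

(** kap / eps^2 is the rate of [mass_growth] divided by the coefficient (eps^2/2) d. *)
Let kap : R := (Lam + 1) * kernel_constant d c C1 * 2 / d%:R.

Let dR0 : 0 < d%:R :> R. Proof. by rewrite ltr0n. Qed.

Let eps20 : 0 < eps ^+ 2. Proof. by rewrite exprn_gt0//; case/andP: eps01. Qed.

(** The exponential is the integrating factor of the differential inequality in [mass_growth]. *)
Lemma mass_monotone (s t : R) : 0 < s -> s <= t -> t <= 1 ->
  expR (kap / eps ^+ 2 * s) * (m s + M2) <= expR (kap / eps ^+ 2 * t) * (m t + M2).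
Proof.
move=> s0; rewrite le_eqVlt => /orP[/eqP <-//|st] t1.
set kk := kap / eps ^+ 2.
pose g (z : R) := expR (kk * z) * (m z + M2).
pose dg (z : R) := expR (kk * z) * (kk * (m z + M2) + expect Om u (dk z)).
have dgP (z : R) : 0 < z -> is_derive z (1 : R) g (dg z).
  move=> z0; have H2 := expR_scale_is_derive kk z.
  have H3 := is_deriveD (m_is_derive z0) (is_derive_cst (M2 : R) z (1 : R)).
  have H4 := is_deriveM H2 H3.
  rewrite (_ : dg z = expR (kk * z) *: (expect Om u (dk z) + 0) + (m z + M2) *: (kk * expR (kk * z))); first exact: H4.
  by rewrite /dg /GRing.scale/=; ring.
have cg : {within `[s, t], continuous g}.
  apply: continuous_in_subspaceT => z; rewrite inE/= in_itv/= => /andP[sz _].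
  exact: is_derive_continuous (dgP z (lt_le_trans s0 sz)).
have Dg z : z \in `]s, t[ -> is_derive z (1 : R) g (dg z).
  by rewrite in_itv/= => /andP[sz _]; exact: dgP (lt_trans s0 sz).
have [z + E] := MVT st Dg cg.
rewrite in_itv/= => /andP[sz zt]; rewrite -subr_ge0 -/(g s) -/(g t) E mulr_ge0//; last first.
  by rewrite subr_ge0 ltW.
rewrite mulr_ge0 ?expR_ge0// -(@pmulr_rge0 _ (eps ^+ 2 / 2 * d%:R)); last first.
  by rewrite mulr_gt0// divr_gt0.
have z01 : 0 < z <= 1 by rewrite (lt_trans s0 sz) (le_trans (ltW zt)).
have := mass_growth z01; rewrite -subr_ge0 opprK.
suff -> : eps ^+ 2 / 2 * d%:R * expect Om u (dk z) + (Lam + 1) * kernel_constant d c C1 * (m z + M2) =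
  eps ^+ 2 / 2 * d%:R * (kk * (m z + M2) + expect Om u (dk z)) by [].
have /andP[e0 _] := eps01; rewrite /kk /kap.
move: (expect Om u (dk z)) (m z + M2) (kernel_constant _ _ _) (d%:R : R) dR0 => X Y Z D D0.
by field; rewrite !gt_eqF.
Qed.

(** At s = eps^2 the kernel is at most its value at y = 0, and the narrow cut-off is below the wide
    one. *)
Let mass_end : m (eps ^+ 2) + M2 <= 2 * (eps ^+ 2) ^- d.*2 * M2.
Proof.
have /andP[e0 e1] := eps01.
have e21 : eps ^+ 2 <= 1 by rewrite exprn_ile1// ltW.
have h1 : 1 <= (eps ^+ 2) ^- d.*2.
  by rewrite invf_ge1 ?exprn_gt0// exprn_ile1// ltW.
have H : m (eps ^+ 2) <= (eps ^+ 2) ^- d.*2 * M2.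
  rewrite /M2 -(expectZ oOm cu u0 u1 _ adm_z).
  apply: (le_expect oOm cu u0 u1 (adm_k eps20) (admissibleM (admissible_cst Om _) adm_z)) => x _.
  rewrite /k mulrC ler_pM//; last 2 first.
  - exact: kern_le.
  - have p0 (z : R) : Order.max z 0 \is Num.nneg by rewrite nnegrE le_max lexx orbT.
    rewrite /cut expr0 mul1r /mass_bump /pos_cube lerXn2r//.
    by rewrite ge_max !le_max lexx orbT andbT lerD2r ler1n.
  - by rewrite ltW// kern_gt0.
  - by have [/andP[]] := cut_bounds c0 (q0 x).
by rewrite mulr_natl mulr2n mulrDl lerD// ler_peMl.
Qed.

(* Compares the average against [kern s] as [s] tends to 0 with the one at [s = eps^2]. *)
Lemma density_le_mass (x0 : V) (C2 : R) : Om x0 -> 0 <= C2 ->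
  (forall x, q x <= C2 * `|x - x0| ^+ 2) -> 0 <= Lam ->
  u x0 * (16 * (1 + C2) ^+ d.+1)^-1 <= expR kap * (2 * (eps ^+ 2) ^- d.*2 * M2).
Proof.
move=> Ox0 C20 qC Lam0; have /andP[e0 e1] := eps01.
have e21 : eps ^+ 2 <= 1 by rewrite exprn_ile1// ltW.
have ux0 : 0 < u x0 / 2 by rewrite divr_gt0// u0.
have kap0 : 0 <= kap.
  by rewrite /kap mulr_ge0 ?invr_ge0// mulr_ge0// mulr_ge0 ?addr_ge0// kernel_constant_ge0.
have /nbhs_ballP[r /= r0 rP] : \forall x \near x0, Om x /\ u x0 / 2 <= u x.
  apply: filterI; first exact: (open_nbhs_nbhs (conj oOm Ox0)).
  have near : \forall x \near x0, `|u x0 - u x| <= u x0 / 2.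
    exact: (@cvgrPdist_le _ _ _ (nbhs x0) _ _ _).1 (cu Ox0) _ ux0.
  apply: filterS near => x; rewrite ler_norml => /andP[_].
  by rewrite lerBlDr addrC -lerBlDr => h; rewrite (le_trans _ h)// {2}[u x0]splitr addrK.
(* Within distance s^2 of x0, [r] ensures u >= u(x0)/2 and the last entry c q <= 1/2. This [s]
   depends on u, but the final bound does not. *)
pose s := Order.min (Order.min (eps ^+ 2) r) (2 * (c * C2 + 1))^-1.
have cC : 0 <= c * C2 by rewrite mulr_ge0// ltW.
have s0 : 0 < s by rewrite !lt_min eps20 r0 invr_gt0 mulr_gt0// ltr_wpDl.
have se : s <= eps ^+ 2 by rewrite !ge_min lexx.
have sr : s <= r by rewrite !ge_min lexx orbT.
have sc : s <= (2 * (c * C2 + 1))^-1 by rewrite !ge_min lexx orbT.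
have s1 : s <= 1 := le_trans se e21.
have s20 : 0 < s ^+ 2 by rewrite exprn_gt0.
have s2s : s ^+ 2 <= s by rewrite expr2 ler_piMl// ltW.
have bO x : ball x0 (s ^+ 2) x -> [/\ Om x, u x0 / 2 <= u x & q x <= C2 * s ^+ 4].
  move=> xb; have [Ox ux] : Om x /\ u x0 / 2 <= u x.
    by apply: rP; apply: le_ball xb; exact: le_trans s2s sr.
  split => //; rewrite (le_trans (qC x))// ler_wpM2l// (_ : s ^+ 4 = (s ^+ 2) ^+ 2); last by rewrite -exprM.
  rewrite lerXn2r ?nnegrE ?(ltW s20)//.
  by move: xb; rewrite -ball_normE /= distrC => /ltW.
(* A lower bound for u times the cut kernel on that ball: 1/8 = (1/2)^3 comes from the cut-off, and
   q <= C2 s^4 bounds the denominator. *)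
pose w := (u x0 / 2) * (8^-1 * (s ^+ (d.*2 + 4) * ((1 + C2) * s ^+ 4) ^- d.+1)).
have C210 : 0 < 1 + C2 by rewrite ltr_pwDl.
have w0 : 0 <= w.
  by rewrite /w mulr_ge0 ?(ltW ux0)// mulr_ge0 ?invr_ge0// mulr_ge0 ?invr_ge0 ?exprn_ge0 ?mulr_ge0 ?exprn_ge0// ltW.
have low : w * (2 * s ^+ 2) ^+ d <= m s.
  apply: (expect_ge_box oOm cu u0 u1 (adm_k s0) _ s20 _ w0).
  - by move=> x _; exact: cut_kern_ge0.
  - by move=> x /bO[].
  move=> x /bO[Ox ux qx]; rewrite /w ler_pM ?(ltW ux0)//.
    by rewrite mulr_ge0 ?invr_ge0// mulr_ge0 ?invr_ge0 ?exprn_ge0 ?mulr_ge0 ?exprn_ge0// ltW.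
  rewrite /k ler_pM ?invr_ge0//.
  - by rewrite mulr_ge0 ?invr_ge0 ?exprn_ge0 ?mulr_ge0 ?exprn_ge0// ltW.
  - have cq2 : c * q x <= 2^-1.
      have h : c * C2 * s <= 2^-1.
        apply: (@le_trans _ _ ((c * C2 + 1) * (2 * (c * C2 + 1))^-1)).
          by rewrite ler_pM// ?(ltW s0)// lerDl.
        rewrite invfM mulrCA mulfV ?mulr1// gt_eqF// ltr_wpDl//.
      rewrite (le_trans _ h)// (le_trans (ler_wpM2l (ltW c0) qx))// mulrA ler_wpM2l//.
      by rewrite exprS ler_piMr ?(ltW s0)// exprn_ile1// ltW.
    have h2 : 2^-1 <= 1 - c * q x by move: cq2; move: (c * q x) => z ?; lra.
    have h20 : 0 <= (2^-1 : R) by rewrite invr_ge0.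
    rewrite /cut /pos_cube expr0 mul1r max_l; last exact: le_trans h20 h2.
    apply: (@le_trans _ _ (2^-1 ^+ 3)); first by rewrite le_eqVlt; apply/orP; left; apply/eqP; field.
    by rewrite lerXn2r ?nnegrE//; exact: le_trans h20 h2.
  - have r4 := rho_gt0 s0 (q0 x).
    rewrite /kern ler_wpM2l ?exprn_ge0 ?(ltW s0)// lef_pV2 ?posrE ?exprn_gt0 ?mulr_gt0 ?exprn_gt0//.
    by rewrite lerXn2r ?nnegrE ?mulr_ge0 ?exprn_ge0 ?(ltW s0) ?(ltW r4) ?(ltW C210)// mulrDl mul1r lerD2l.
(* The powers of [s] cancel, as the kernel has mass of order 1 at every scale. *)
have wE : w * (2 * s ^+ 2) ^+ d = u x0 * (2 ^+ d * (16 * (1 + C2) ^+ d.+1)^-1).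
  have x1 : (2 * s ^+ 2) ^+ d = 2 ^+ d * s ^+ d.*2 by rewrite exprMn -exprM mul2n.
  have x2 : ((1 + C2) * s ^+ 4) ^+ d.+1 = (1 + C2) ^+ d.+1 * (s ^+ d.*2 * s ^+ d.*2 * s ^+ 4).
    rewrite exprMn -exprM (_ : (4 * d.+1 = d.*2 + d.*2 + 4)%N) ?exprD//.
    by rewrite -!muln2 -addn1; ring.
  rewrite /w x1 x2 exprD.
  have P1 : s ^+ d.*2 != 0 by rewrite expf_neq0// gt_eqF.
  have P2 : (1 + C2) ^+ d.+1 != 0 by rewrite expf_neq0// gt_eqF.
  have s_0 : s != 0 by rewrite gt_eqF.
  move: (s ^+ d.*2) ((1 + C2) ^+ d.+1) (2 ^+ d) P1 P2 => X Y Z X0 Y0.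
  by field; rewrite X0 Y0 s_0.
have H1 := mass_monotone s0 se e21.
have -> : expR kap = expR (kap / eps ^+ 2 * eps ^+ 2) by rewrite divfK// gt_eqF.
rewrite (le_trans _ (ler_wpM2l (expR_ge0 _) mass_end))// (le_trans _ H1)//.
have E1 : 1 <= expR (kap / eps ^+ 2 * s).
  by rewrite -expR0 ler_expR mulr_ge0 ?(ltW s0)// mulr_ge0 ?invr_ge0// ltW.
apply: (@le_trans _ _ (1 * (m s + M2))); last by rewrite ler_wpM2r// addr_ge0// m_ge0.
rewrite mul1r (le_trans _ (_ : m s <= _)) ?lerDl// (le_trans _ low)// wE.
rewrite ler_wpM2l ?(ltW (u0 Ox0))// ler_peMl ?invr_ge0 ?mulr_ge0 ?exprn_ge0 ?(ltW C210)//.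
by rewrite exprn_ege1// ler1n.
Qed.

End solution.
End kernel_average.

(** * The quadratic form adapted to the diffusion matrix at a point *)

Section matrix_bounds.
Context {R : realType} {d : nat}.
Local Notation V := 'rV[R]_d.

Definition mx_abs (M : 'M[R]_d) : R := \sum_i \sum_j `|M i j|.

Lemma mx_abs_ge0 M : 0 <= mx_abs M.
Proof. by apply: sumr_ge0 => i _; apply: sumr_ge0. Qed.

Lemma bilinear_le (M : 'M[R]_d) (v w : V) :
  `|\sum_i \sum_j M i j * (v 0 i * w 0 j)| <= mx_abs M * (`|v| * `|w|).
Proof.
rewrite (le_trans (ler_norm_sum _ _ _))// /mx_abs mulr_suml ler_sum// => i _.
rewrite (le_trans (ler_norm_sum _ _ _))// mulr_suml ler_sum// => j _.
by rewrite !normrM ler_wpM2l// ler_pM// coord_norm_le.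
Qed.

Lemma mulmx_norm_le (M : 'M[R]_d) (v : V) : `|v *m M| <= mx_abs M * `|v|.
Proof.
apply: rV_norm_le => [|j]; first by rewrite mulr_ge0// mx_abs_ge0.
rewrite mxE (le_trans (ler_norm_sum _ _ _))// /mx_abs mulr_suml ler_sum// => i _.
rewrite normrM mulrC ler_pM// ?coord_norm_le//.
by rewrite (bigD1 j)//= lerDl sumr_ge0.
Qed.

Lemma compact_sphere : compact [set v : V | `|v| = 1].
Proof.
apply: (subclosed_compact _ (@compact_closed_ball0 R d 1)); last by move=> v /= ->.
rewrite (_ : [set v | _] = (fun x : V => `|x|) @^-1` [set 1])//.
apply: closed_comp; last exact: closed_eq.
by move=> x _; exact: norm_continuous.
Qed.

(** The form is positive and continuous on the compact unit sphere; homogeneity extends its minimum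
    to all vectors. *)
Lemma posdef_lower (M : 'M[R]_d) : sym_posdef M ->
  exists2 kp : R, 0 < kp & forall v : V, kp * `|v| ^+ 2 <= (v *m M *m v^T) 0 0.
Proof.
move=> [_ pd]; pose f (v : V) := (v *m M *m v^T) 0 0.
have fZ (t : R) v : f (t *: v) = t ^+ 2 * f v.
  by rewrite /f -scalemxAl linearZ/= -scalemxAl -scalemxAr !mxE mulrA expr2.
have scale (v : V) : v != 0 -> `| `|v|^-1 *: v | = 1.
  by move=> v0; rewrite normrZ normfV normr_id mulVf// normr_eq0.
have cf : {within [set v : V | `|v| = 1], continuous f}.
  apply: continuous_subspaceT => v.
  have Cf : Ck 0 [set: V] f.
    have E (x : V) : setT x -> \sum_i \sum_j M i j * (x 0 i * x 0 j) = f x by rewrite /f quad_formE.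
    apply: (Ck_ext openT E); apply: (Ck_sum openT) => i; apply: (Ck_sum openT) => j.
    exact: (CkM openT (Ck_cst 0 _ _) (CkM openT (Ck_coord 0 _ i) (Ck_coord 0 _ j))).
  exact: (Ck_continuous Cf).
(* The sphere is empty only if 0 is the sole vector, and then any constant works. *)
have [S0|/set0P/negP] := pselect ([set v : V | `|v| = 1] !=set0); last first.
  move=> /negPn/eqP S0; exists 1 => // v.
  have -> : v = 0.
    apply/eqP; apply: contraT => /scale v1; suff : set0 (`|v|^-1 *: v) by [].
    by rewrite -S0.
  by rewrite normr0 mul0mx mul0mx mxE expr0n/= mulr0.
have [w /[!inE]/= w1 wmin] := compact_EVT_min S0 compact_sphere cf.
have w0 : w != 0 by apply: contraPneq w1 => ->; rewrite normr0 => /esym/eqP; rewrite oner_eq0.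
exists (f w); first exact: pd.
move=> v; have [->|v0] := eqVneq v 0.
  by rewrite normr0 expr0n/= mulr0 mul0mx mul0mx mxE.
have := wmin (`|v|^-1 *: v); rewrite inE => /(_ (scale v v0)).
by rewrite fZ exprVn ler_pdivlMl ?exprn_gt0 ?normr_gt0// mulrC.
Qed.

End matrix_bounds.

Section quadratic_form.
Context {R : realType} {d : nat}.
Local Notation V := 'rV[R]_d.
Variables (A0 : 'M[R]_d) (x0 : V).
Hypothesis pdA : sym_posdef A0.

Let unitA : A0 \in unitmx.
Proof.
rewrite -row_free_unit -kermx_eq0; apply/eqP/row_matrixP => i; rewrite row0.
apply/eqP; apply: contraT => /(proj2 pdA); rewrite -row_mul mulmx_ker row0 mul0mx mxE.
by rewrite ltxx.
Qed.

Let B := invmx A0.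

Let Bsym i j : B i j = B j i.
Proof.
have E : B^T = B by rewrite /B trmx_inv (proj1 pdA).
by rewrite -{1}E mxE.
Qed.

(** The inverse matrix is chosen so that, for the constant matrix A0, a(Dq, Dq) = 4 q and a:D^2q = 2
    d hold exactly. With variable coefficients only A(x) - A0 enters the errors. *)
Definition inv_form (x : V) : R := \sum_i \sum_j B i j * ((x 0 i - x0 0 i) * (x 0 j - x0 0 j)).

Let w (x : V) : V := (x - x0) *m B.

Let wA x : w x *m A0 = x - x0.
Proof. by rewrite /w -mulmxA mulVmx// mulmx1. Qed.

Lemma inv_formE x : inv_form x = (w x *m A0 *m (w x)^T) 0 0.
Proof.
have E : B^T = B by rewrite /B trmx_inv (proj1 pdA).
rewrite wA /w trmx_mul E mulmxA quad_formE.
by apply: eq_bigr => i _; apply: eq_bigr => j _; rewrite !mxE.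
Qed.

Lemma inv_form_Ck k : Ck k setT inv_form.
Proof.
apply: (Ck_sum openT) => i; apply: (Ck_sum openT) => j.
apply: (CkM openT (Ck_cst k _ _)).
have C l : Ck k setT (fun x : V => x 0 l + - x0 0 l) := CkD openT (Ck_coord k _ l) (Ck_cst k _ _).
exact: (CkM openT (C i) (C j)).
Qed.

Let coord_derive x (l i : 'I_d) :
  is_derive x (delta_mx 0 l : V) (fun x : V => x 0 i - x0 0 i) ((i == l)%:R : R).
Proof.
have H := is_deriveB (is_derive_coord i (is_derive_id x (delta_mx 0 l : V)))
  (is_derive_cst (x0 0 i : R) x (delta_mx 0 l : V)).
by rewrite subr0 mxE eqxx /= in H.
Qed.

Lemma partial_inv_form l x : partial l inv_form x = 2 * w x 0 l.
Proof.
have D : is_derive x (delta_mx 0 l : V) inv_form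
    (\sum_i \sum_j B i j * ((x 0 i - x0 0 i) * (j == l)%:R + (x 0 j - x0 0 j) * (i == l)%:R)).
  apply: is_derive_sum_fun => i; apply: is_derive_sum_fun => j.
  exact: (is_deriveZ (B i j) (is_deriveM (coord_derive x l i) (coord_derive x l j))).
have [_ E] := D; rewrite /partial E /w mxE.
transitivity (\sum_i (B i l * (x 0 i - x0 0 i)) + \sum_j (B l j * (x 0 j - x0 0 j))).
  transitivity (\sum_i (\sum_j B i j * (x 0 i - x0 0 i) * (j == l)%:R) +
    \sum_i (\sum_j B i j * (x 0 j - x0 0 j) * (i == l)%:R)).
    rewrite -big_split/=; apply: eq_bigr => i _; rewrite -big_split/=; apply: eq_bigr => j _.
    by rewrite mulrDr !mulrA.
  congr (_ + _).
    apply: eq_bigr => i _; rewrite (bigD1 l)//= eqxx mulr1 big1 ?addr0// => j /negbTE ->.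
    by rewrite mulr0.
  rewrite (bigD1 l)//= [X in _ + X]big1 ?addr0.
    by apply: eq_bigr => j _; rewrite eqxx mulr1.
  by move=> i /negbTE il; rewrite big1// => j _; rewrite il mulr0.
rewrite mulr_natl mulr2n; congr (_ + _); apply: eq_bigr => i _; by rewrite !mxE mulrC// Bsym.
Qed.

Lemma partial2_inv_form i j x : partial j (partial i inv_form) x = 2 * B j i.
Proof.
have -> : partial i inv_form = fun x => \sum_l (2 * B l i) * (x 0 l - x0 0 l).
  apply/funext => y; rewrite partial_inv_form /w mxE mulr_sumr; apply: eq_bigr => l _.
  by rewrite !mxE -mulrA [_ * B _ _]mulrC.
have D : is_derive x (delta_mx 0 j : V) (fun x : V => \sum_l (2 * B l i) * (x 0 l - x0 0 l))
    (\sum_l (2 * B l i) * (l == j)%:R).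
  by apply: is_derive_sum_fun => l; exact: (is_deriveZ (2 * B l i) (coord_derive x j l)).
have [_ E] := D; rewrite /partial E (bigD1 j)//= eqxx mulr1 big1 ?addr0// => l /negbTE ->.
by rewrite mulr0.
Qed.

Lemma inv_form_gradient (A : V -> 'M[R]_d) x :
  gradient_form A inv_form x - 4 * inv_form x =
  4 * \sum_i \sum_j (A x - A0) i j * (w x 0 i * w x 0 j).
Proof.
rewrite inv_formE quad_formE /gradient_form.
transitivity (4 * (\sum_i \sum_j A x i j * (w x 0 i * w x 0 j)) -
  4 * \sum_i \sum_j A0 i j * (w x 0 i * w x 0 j)).
  congr (_ - _); rewrite mulr_sumr; apply: eq_bigr => i _; rewrite mulr_sumr.
  by apply: eq_bigr => j _; rewrite !partial_inv_form; ring.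
rewrite -mulrBr; congr (_ * _); rewrite -sumrB; apply: eq_bigr => i _.
by rewrite -sumrB; apply: eq_bigr => j _; rewrite !mxE mulrBl.
Qed.

Lemma inv_form_second_order (A : V -> 'M[R]_d) x :
  second_order A inv_form x - 2 * d%:R = 2 * \sum_i \sum_j (A x - A0) i j * B j i.
Proof.
have tr : \sum_i \sum_j A0 i j * B j i = d%:R.
  transitivity (\tr (A0 *m B)); first by apply: eq_bigr => i _; rewrite mxE.
  by rewrite mulmxV// mxtrace1.
rewrite -tr /second_order !mulr_sumr -sumrB; apply: eq_bigr => i _.
rewrite !mulr_sumr -sumrB; apply: eq_bigr => j _.
by rewrite partial2_inv_form !mxE; ring.
Qed.

(** With w = (x - x0) A0^(-1) the form is w A0 w^T, so positivity of A0 bounds w by the square root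
    of the form; and x - x0 is w A0. *)
Lemma inv_form_bounds : exists C : R, 0 <= C /\ forall x,
  [/\ 0 <= inv_form x, inv_form x <= C * `|x - x0| ^+ 2,
      `|w x| <= C * Num.sqrt (inv_form x) & `|x - x0| <= C * Num.sqrt (inv_form x)].
Proof.
have [kp kp0 kpP] := posdef_lower pdA.
pose D := Num.sqrt kp^-1; have D0 : 0 <= D := sqrtr_ge0 _.
exists (mx_abs B + D + mx_abs A0 * D); split; first by rewrite !addr_ge0// ?mulr_ge0 ?mx_abs_ge0.
move=> x; have H := kpP (w x); rewrite -inv_formE in H.
have q0 : 0 <= inv_form x by rewrite (le_trans _ H)// mulr_ge0 ?exprn_ge0 ?(ltW kp0).
have wD : `|w x| <= D * Num.sqrt (inv_form x).
  rewrite -sqrtrM ?invr_ge0 ?(ltW kp0)// -[leLHS]ger0_norm// -sqrtr_sqr ler_wsqrtr//.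
  by rewrite ler_pdivlMl.
have a0 := mx_abs_ge0 B; have b0 := mx_abs_ge0 A0; have s0 := sqrtr_ge0 (inv_form x).
split => //.
- have -> : inv_form x = \sum_i \sum_j B i j * ((x - x0) 0 i * (x - x0) 0 j).
    by apply: eq_bigr => i _; apply: eq_bigr => j _; rewrite !mxE.
  rewrite (le_trans (ler_norm _))// (le_trans (bilinear_le _ _ _))// -expr2.
  by rewrite ler_wpM2r ?exprn_ge0// -addrA lerDl addr_ge0// mulr_ge0.
- by rewrite (le_trans wD)// ler_wpM2r// addrAC lerDr addr_ge0// mulr_ge0.
- rewrite -wA (le_trans (mulmx_norm_le _ _))//.
  apply: (@le_trans _ _ (mx_abs A0 * (D * Num.sqrt (inv_form x)))); first by rewrite ler_wpM2l.
  by rewrite mulrA ler_wpM2r// lerDr addr_ge0.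
Qed.

End quadratic_form.

Lemma local_density_bound {R : realType} {d : nat} (Om : set 'rV[R]_d) (A : 'rV[R]_d -> 'M[R]_d)
    (b : 'rV[R]_d -> 'rV[R]_d) (x0 : 'rV[R]_d) (rr Lam : R) : (0 < d)%N -> open Om ->
  Ck_mx 2 Om A -> Ck_rV 1 Om b -> Om x0 -> sym_posdef (A x0) -> 0 < rr -> 0 <= Lam ->
  exists (z : 'rV[R]_d -> R) (C : R), [/\ 0 <= C, admissible Om z, (forall x, 0 <= z x <= 8),
    (forall x, z x != 0 -> `|x - x0| < rr) &
    forall (eps : R) u lam, 0 < eps <= 1 -> EP_solution A b Om eps u lam -> lam <= Lam ->
      u x0 <= C * (eps ^+ 2) ^- d.*2 * expect Om u z].
Proof.
move=> d0 oOm CA Cb Ox0 pdA rr0 Lam0.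
have [D [D0 qP]] := inv_form_bounds x0 pdA.
set q := inv_form (A x0) x0 in qP.
have [r1 r10 [cK KO]] := relatively_compact_ball oOm Ox0.
set K := closure _ in cK KO.
have /choice[rA /choice[LA LAP]] : forall ij : 'I_d * 'I_d, exists r M : R, [/\ 0 < r, 0 <= M &
    forall x y, ball x0 r x -> ball x0 r y -> `|A x ij.1 ij.2 - A y ij.1 ij.2| <= M * `|x - y|].
  by move=> ij; exact: (Ck1_lipschitz_near oOm (CkS (CA ij.1 ij.2)) Ox0).
have [rb [Lb [rb0 Lb0 LbP]]] := Ck_rV_lipschitz_near oOm Cb Ox0.
pose rA0 := \big[Order.min/1]_ij rA ij.
have rA00 : 0 < rA0 by apply: lt_bigmin => // ij _; have [] := LAP ij.
pose r2 := Order.min (Order.min r1 rA0) (Order.min rb rr).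
have r20 : 0 < r2 by rewrite !lt_min r10 rA00 rb0.
(* On {c q <= 2} this forces |x - x0|^2 <= D^2 q < r2^2, so both cut-offs live in the small ball. *)
pose c := 4 * (D ^+ 2 + 1) / r2 ^+ 2.
have D20 : 0 <= D ^+ 2 by exact: sqr_ge0.
have c0 : 0 < c by rewrite divr_gt0 ?exprn_gt0// mulr_gt0// ltr_wpDl.
have near x : c * q x <= 2 -> `|x - x0| < r2.
  move=> cq; have [q0 _ _ vN] := qP x.
  rewrite -(@ltr_pXn2r _ 2)// ?nnegrE ?(ltW r20)//.
  apply: (@le_lt_trans _ _ (D ^+ 2 * q x)).
    by rewrite -[q x]sqr_sqrtr// -exprMn lerXn2r ?nnegrE// mulr_ge0// sqrtr_ge0.
  have : (D ^+ 2 + 1) * q x <= r2 ^+ 2 / 2.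
    rewrite -(ler_pM2l c0) mulrCA mulrC; apply: (@le_trans _ _ (2 * (D ^+ 2 + 1))).
      by rewrite ler_wpM2r// addr_ge0.
    by rewrite /c le_eqVlt; apply/orP; left; apply/eqP; field; rewrite gt_eqF.
  have r220 : 0 < r2 ^+ 2 by rewrite exprn_gt0.
  move: q0 r220; rewrite mulrDl mul1r; move: (r2 ^+ 2) (D ^+ 2 * q x) (q x) => X Y Z; lra.
pose L := \sum_ij LA ij; have L0 : 0 <= L by apply: sumr_ge0 => ij _; have [] := LAP ij.
pose Mb := `|b x0| + Lb * rb; have Mb0 : 0 <= Mb by rewrite addr_ge0// mulr_ge0// ltW.
pose Bm := mx_abs (invmx (A x0)); have Bm0 : 0 <= Bm by exact: mx_abs_ge0.
(* One summand each for the gradient form, the second-order term and the drift. *)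
pose C1 := 4 * L * D ^+ 3 + 2 * L * D * Bm + 2 * d%:R * Mb * D.
have D30 : 0 <= D ^+ 3 by exact: exprn_ge0.
have t1 : 0 <= 4 * L * D ^+ 3 by rewrite !mulr_ge0.
have t2 : 0 <= 2 * L * D * Bm by rewrite !mulr_ge0.
have t3 : 0 <= 2 * d%:R * Mb * D by rewrite !mulr_ge0.
have C10 : 0 <= C1 by rewrite !addr_ge0.
have Aabs x : `|x - x0| < r2 -> mx_abs (A x - A x0) <= L * `|x - x0|.
  move=> xr; rewrite /mx_abs pair_big /= /L mulr_suml ler_sum// => ij _.
  have [rA1 LA1 H] := LAP ij; rewrite !mxE.
  apply: H; last exact: ballxx.
  rewrite -ball_normE /= distrC (lt_le_trans xr)//.
  rewrite (@le_trans _ _ rA0)//; first by rewrite !ge_min lexx orbT.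
  exact: bigmin_le.
have qA x : c * q x <= 1 ->
  [/\ `|gradient_form A q x - 4 * q x| <= C1 * Num.sqrt (q x) ^+ 3,
   `|second_order A q x - 2 * d%:R| <= C1 * Num.sqrt (q x) &
   `|transport b q x| <= C1 * Num.sqrt (q x)].
  move=> cq1; have /near xr : c * q x <= 2 by rewrite (le_trans cq1)// ler1n.
  have [q0 _ wN vN] := qP x; have Ax := Aabs x xr.
  have N0 : 0 <= Num.sqrt (q x) := sqrtr_ge0 _.
  have AxN : mx_abs (A x - A x0) <= L * (D * Num.sqrt (q x)) by rewrite (le_trans Ax)// ler_wpM2l.
  set N := Num.sqrt (q x) in wN vN N0 AxN *; set w := _ *m _ in wN.
  split.
  - rewrite /q inv_form_gradient// normrM [`|4|]ger0_norm//.
    apply: (@le_trans _ _ (4 * (L * (D * N) * (D * N * (D * N))))).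
      rewrite ler_wpM2l// (le_trans (bilinear_le _ _ _))//.
      by rewrite ler_pM// ?mx_abs_ge0 ?mulr_ge0// ler_pM.
    rewrite (_ : 4 * _ = 4 * L * D ^+ 3 * N ^+ 3); last by ring.
    by rewrite ler_wpM2r ?exprn_ge0// /C1 -addrA lerDl addr_ge0.
  - rewrite /q inv_form_second_order// normrM [`|2|]ger0_norm//.
    apply: (@le_trans _ _ (2 * (L * (D * N) * Bm))).
      rewrite ler_wpM2l//; apply: (@le_trans _ _ (mx_abs (A x - A x0) * Bm)); last by rewrite ler_wpM2r.
      rewrite (le_trans (ler_norm_sum _ _ _))// /mx_abs mulr_suml ler_sum// => i _.
      rewrite (le_trans (ler_norm_sum _ _ _))// mulr_suml ler_sum// => j _.
      rewrite normrM ler_wpM2l// /Bm /mx_abs (bigD1 j)//= (bigD1 i)//= -addrA lerDl addr_ge0//.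
        by apply: sumr_ge0.
      by apply: sumr_ge0 => k _; exact: sumr_ge0.
    rewrite (_ : 2 * _ = 2 * L * D * Bm * N); last by ring.
    by rewrite ler_wpM2r// /C1 addrAC lerDr addr_ge0.
  - rewrite (le_trans (ler_norm_sum _ _ _))//.
    have bx : `|b x| <= Mb.
      have -> : b x = b x0 + (b x - b x0) by rewrite addrC subrK.
      rewrite (le_trans (ler_normD _ _))// lerD2l.
      have xb : ball x0 rb x.
        by rewrite -ball_normE /= distrC (lt_le_trans xr)// !ge_min lexx orbT.
      rewrite (le_trans (LbP _ _ xb (ballxx _ rb0)))// ler_wpM2l// ltW//.
      by rewrite (lt_le_trans xr)// !ge_min lexx orbT.
    apply: (@le_trans _ _ (\sum_(i < d) Mb * (2 * (D * N)))).
      apply: ler_sum => i _; rewrite normrM ler_pM//; first exact: le_trans (coord_norm_le _ _) bx.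
      rewrite /q partial_inv_form// normrM [`|2|]ger0_norm// ler_wpM2l//.
      exact: le_trans (coord_norm_le _ _) wN.
    rewrite sumr_const card_ord (_ : Mb * (2 * (D * N)) *+ d = 2 * d%:R * Mb * D * N); last first.
      by rewrite -[LHS]mulr_natl; ring.
    by rewrite ler_wpM2r// /C1 lerDr addr_ge0.
have q0 x : 0 <= q x by have [] := qP x.
have qK x : c * q x <= 2 -> K x.
  move=> /near xr; apply: subset_closure; rewrite -ball_normE /= distrC (lt_le_trans xr)//.
  by rewrite !ge_min lexx.
have Cq : Ck 2 setT q by exact: inv_form_Ck.
pose kap := (Lam + 1) * kernel_constant d c C1 * 2 / d%:R.
pose CC := 16 * (1 + D) ^+ d.+1.
have CC0 : 0 < CC by rewrite mulr_gt0// exprn_gt0// ltr_pwDl.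
exists (mass_bump q c), (CC * (expR kap * 2)); split.
- by rewrite mulr_ge0 ?(ltW CC0)// mulr_ge0// expR_ge0.
- have tz : test_fun 2 K (mass_bump q c) by exact: test_mass_bump.
  exact: (test_fun_admissible Om cK tz).
- move=> x; rewrite pos_cube_ge0/= /mass_bump /pos_cube.
  have cq0 : 0 <= c * q x by rewrite mulr_ge0// ltW.
  rewrite (@le_trans _ _ (2 ^+ 3))//; last by rewrite -natrX ler_nat.
  by rewrite lerXn2r ?nnegrE ?le_max ?lexx ?orbT// ge_max ler0n andbT gerBl.
- move=> x zx; have : c * q x <= 2.
    by rewrite leNgt; apply: contra zx => cq2; rewrite /mass_bump pos_cube0// subr_le0 ltW.
  by move=> /near xr; rewrite (lt_le_trans xr)// !ge_min lexx !orbT.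
move=> eps u lam eps01 sol lamL.
have H := density_le_mass oOm CA Cb Cq q0 cK KO c0 qK d0 C10 qA eps01 sol lamL Ox0 D0
  (fun x => let: And4 _ h _ _ := qP x in h) Lam0.
move: H; rewrite -/kap -/CC ler_pdivrMr// => /le_trans; apply.
by rewrite le_eqVlt; apply/orP; left; apply/eqP; ring.
Qed.

(** * Exponential smallness against the logarithmic limit *)

Lemma expR_ge_exprn {R : realType} (n : nat) (x : R) : 0 <= x ->
  (x / n.+1%:R) ^+ n.+1 <= expR x.
Proof.
move=> x0; have -> : expR x = expR (x / n.+1%:R) ^+ n.+1.
  by rewrite -expRM_natr divfK.
rewrite lerXn2r ?nnegrE ?expR_ge0 ?divr_ge0//.
by rewrite (le_trans _ (expR_ge1Dx _))// lerDr.
Qed.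

Theorem theorem1p2 (R : realType) (d k : nat) (Om : set 'rV[R]_d)
    (b : 'rV[R]_d -> 'rV[R]_d) (A : 'rV[R]_d -> 'M[R]_d)
    (Att : set 'rV[R]_d) (eps0 : R)
    (u : R -> 'rV[R]_d -> R) (lam : R -> R) :
  (2 < k)%N ->
  open Om -> connected Om ->
  Ck_rV k Om b ->
  Ck_mx k.+1 Om A -> (forall x, Om x -> sym_posdef (A x)) ->
  positively_invariant b Om ->
  maximal_attractor b Om Att ->
  0 < eps0 ->
  (forall eps, 0 < eps < eps0 -> EP_solution A b Om eps (u eps) (lam eps)) ->
  tight Om [set eps | 0 < eps < eps0] u ->
  (forall x, Att x -> eps ^+ 2 / 2 * ln (u eps x) @[eps --> 0^'+] --> (0 : R)) ->
  chain_transitive b Om Att.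
Proof.
move=> k2 oOm cOm Cbk CAk pdA pinv attr eps00 sol tgt lim.
have CA : Ck_mx 2 Om A.
  by move=> i j; apply: (@Ck_le R d 2 k.+1 Om _ _ (CAk i j)); exact: ltnW (leqW k2).
have Cb : Ck_rV 1 Om b.
  by move=> i; apply: (@Ck_le R d 1 k Om _ _ (Cbk i)); exact: ltnW (ltnW k2).
have AO : Att `<=` Om by case: attr.
(* In dimension 0 there is only one point, and a single link of length [T] has no jump. *)
have [d0|d0] := posnP d.
  move=> x y Ax Ay eta T eta0 T0; exists 1%N, (fun n => if n == 2%N then y else x), (fun=> T).
  split => // i /andP[i1 i2]; have -> : i = 1%N by apply/eqP; rewrite eqn_leq i1 i2.
  split => //; first exact: AO.
  rewrite /enorm big1 ?sqrtr0// => j _.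
  by have := ltn_ord j; rewrite [X in (_ < X)%N]d0.
have lipb z : Om z -> lipschitz_near b z by exact: (Ck_rV_lipschitz_near oOm Cb).
apply: contrapT => nCT.
have [W [M [K [x0 [[M0 lipW] W01 [cK KO KW] decW [Ax0 Wx0]]]]]] :=
  lyapunov_of_not_chain_transitive oOm lipb pinv cOm attr nCT.
have [S [K' [CS S01 [cK' KO' SK'] bS Sx0]]] :=
  smooth_lyapunov oOm lipb pinv M0 lipW W01 cK KO KW decW Wx0.
have Ox0 := AO _ Ax0.
have [rr rr0 Srr] : exists2 rr : R, 0 < rr & forall x, `|x - x0| < rr -> 3 / 8 <= S x <= 5 / 8.
  have cS := Ck_continuous CS (I : setT x0).
  have e16 : 0 < 16^-1 :> R by rewrite invr_gt0.
  have near : \forall x \near x0, `|S x0 - S x| <= 16^-1.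
    exact: (@cvgrPdist_le _ _ _ (nbhs x0) _ _ _).1 cS _ e16.
  have /nbhs_ballP[rr /= rr0 rrP] := near; exists rr => // x xr.
  have : `|S x0 - S x| <= 16^-1 by apply: rrP; rewrite -ball_normE /= distrC.
  move: Sx0; rewrite !ler_norml; move: (S x) (S x0); clear => p q /andP[? ?] /andP[? ?].
  by apply/andP; split; lra.
have half0 : 0 < 2^-1 :> R by rewrite invr_gt0.
have [Kt [cKt KtO mKt]] := tgt _ half0.
have [Lam [Lam0 LamP]] := eigenvalue_le oOm CA Cb cKt KtO.
have [z [C [C0 az z8 zrr zP]]] := local_density_bound d0 oOm CA Cb Ox0 (pdA _ Ox0) rr0 Lam0.
have [kp [C' [e1 [kp0 C'0 e10 mP]]]] := expectation_near_level_le oOm CA pdA Cb CS cK' KO' SK' bS.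
pose C3 := C * (8 * C').
have C30 : 0 <= C3 by rewrite mulr_ge0// mulr_ge0.
have upper eps : 0 < eps < eps0 -> eps <= 1 -> eps <= e1 ->
    u eps x0 <= C3 * (eps ^+ 2) ^- d.*2 * expR (- (kp / eps ^+ 2)).
  move=> epsI eps1 epse1; have /andP[epsp _] := epsI; have sole := sol _ epsI.
  have [Cu _ u0 u1 _] := sole.
  have cu x : Om x -> {for x, continuous (u eps)} by move=> Ox; exact: Ck_continuous Cu Ox.
  have eps01 : 0 < eps <= 1 by rewrite epsp.
  have lamL := LamP _ _ _ eps01 sole (mKt _ epsI).
  have H1 := zP _ _ _ eps01 sole lamL.
  (* [z] is bounded by 2^3 = 8; the rescaling brings it into [0, 1]. *)
  pose m x := 8^-1 * z x.
  have am : admissible Om m := admissibleM (admissible_cst Om _) az.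
  have H2 : expect Om (u eps) m <= C' * expR (- (kp / eps ^+ 2)).
    apply: (mP eps _ (lam eps)) => //; first by rewrite epsp.
    - move=> x; have /andP[z0 z_8] := z8 x; rewrite /m mulr_ge0 ?invr_ge0//=.
      by rewrite ler_pdivrMl// mulr1.
    - move=> x mx; apply/Srr/zrr; apply: contraNneq mx => zx.
      by rewrite /m zx mulr0.
  have E8 : expect Om (u eps) m = 8^-1 * expect Om (u eps) z.
    exact: (expectZ oOm cu u0 u1 8^-1 az).
  rewrite E8 ler_pdivrMl// in H2.
  rewrite (le_trans H1)// (le_trans (ler_wpM2l _ H2))//.
    by rewrite mulr_ge0// invr_ge0 exprn_ge0// exprn_ge0// ltW.
  by rewrite /C3 le_eqVlt; apply/orP; left; apply/eqP; ring.
(* The exponential is compared with a power one higher than the 2d lost in the density bound. *)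
pose N := d.*2; pose a := (kp / 2 / N.+1%:R) ^+ N.+1.
have a0 : 0 < a by rewrite exprn_gt0// !divr_gt0.
have kp40 : 0 < kp / 4 by rewrite divr_gt0.
have key : \forall eps \near (0 : R)^'+, False.
  near=> eps.
  have epsp : 0 < eps by near: eps; exact: nbhs_right_gt.
  have epsI : 0 < eps < eps0.
    by rewrite epsp /=; near: eps; exact: nbhs_right_lt.
  have eps1 : eps <= 1 by near: eps; exact: nbhs_right_le.
  have epse1 : eps <= e1 by near: eps; exact: nbhs_right_le.
  have epsa : eps < a / (C3 + 1).
    by near: eps; apply: nbhs_right_lt; rewrite divr_gt0// ltr_wpDl.
  have ln4 : `|0 - eps ^+ 2 / 2 * ln (u eps x0)| < kp / 4.
    near: eps; exact: (@cvgrPdist_lt _ _ _ (0 : R)^'+ _ _ _).1 (lim _ Ax0) _ kp40.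
  have [_ _ u0 _ _] := sol _ epsI; have ux := u0 _ Ox0.
  have e20 : 0 < eps ^+ 2 by rewrite exprn_gt0.
  pose T := (eps ^+ 2)^-1; have T0 : 0 < T by rewrite invr_gt0.
  (* The limit allows only half of the exponent kp / eps^2, so a factor exp(-kp / (2 eps^2)) remains
     to be contradicted. *)
  have low : expR (- (kp / 2 * T)) <= u eps x0.
    rewrite -[leRHS](lnK ux) ler_expR; move: ln4; rewrite sub0r normrN ltr_norml => /andP[+ _].
    rewrite -ltr_pdivrMl ?divr_gt0// => /ltW; apply: le_trans.
    by rewrite le_eqVlt /T; apply/orP; left; apply/eqP; field; rewrite gt_eqF.
  have H := le_trans low (upper _ epsI eps1 epse1).
  have {}H : expR (kp / 2 * T) <= C3 * T ^+ N.
    rewrite -exprVn -/T -/N (_ : kp / eps ^+ 2 = kp / 2 * T + kp / 2 * T) in H; last first.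
      by rewrite /T; field; rewrite gt_eqF.
    rewrite opprD expRD mulrA -[leLHS]mul1r ler_pM2r ?expR_gt0// in H.
    by move: H; rewrite expRN ler_pdivlMr ?expR_gt0// mul1r.
  have H2 := expR_ge_exprn N (_ : 0 <= kp / 2 * T).
  have {}H2 : a * T ^+ N.+1 <= C3 * T ^+ N.
    rewrite (le_trans _ H)// (le_trans _ (H2 _))//; last by rewrite mulr_ge0 ?divr_ge0 ?(ltW kp0)// ltW.
    by rewrite /a -exprMn mulrAC.
  (* After division by T^N this reads a <= C3 eps^2, which fails for eps < a / (C3 + 1). *)
  rewrite exprS mulrA ler_pM2r ?exprn_gt0// /T ler_pdivrMr// in H2.
  suff : a < a by rewrite ltxx.
  rewrite (le_lt_trans H2)// (@le_lt_trans _ _ (C3 * eps))//.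
    by rewrite ler_wpM2l// expr2 ler_piMl// ltW.
  move: epsa; rewrite ltr_pdivlMr ?ltr_wpDl// => /le_lt_trans; apply.
  by rewrite mulrC ler_wpM2l ?(ltW epsp)// lerDl.
by have [] := filter_ex key.
Unshelve. all: by end_near. Qed.
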